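(* Let $F$ be a finite group. Let $\eta$ be the real root of $X^3+X^2+X-2$ and let $\alpha_0=\frac{\log 2}{\log 2-\log\eta}$. Given $\alpha_0\le\delta\le\alpha<\beta\le\gamma\le 1$, there exist sequences $\omega(\delta),\omega(\gamma)\in\{0,1,2\}^{\mathbb N}$ with $\lim_{r\to\infty}\frac{\log\log b_{\omega(\delta)}(r)}{\log r}=\delta$ and $\lim_{r\to\infty}\frac{\log\log b_{\omega(\gamma)}(r)}{\log r}=\gamma$, and integers $m_1<n_1<m_2<n_2<\dots$, such that for the sequence $$\omega(\alpha,\beta,\gamma,\delta)=\omega(\delta)|_{0\dots m_1}\,\omega(\gamma)|_{m_1+1\dots n_1}\,\omega(\delta)|_{n_1+1\dots m_2}\,\omega(\gamma)|_{m_2+1\dots n_2}\dots$$ the pseudo period exponents of the group $\Gamma_{\omega(\alpha,\beta,\gamma,\delta)}=F\wr_XG_{\omega(\alpha,\beta,\gamma,\delta)}$ satisfy $$u(\alpha,\beta)\le\frac{1}{\gamma-\beta}\quad\text{and}\quad l(\alpha,\beta)\le\frac{1}{\alpha-\delta},$$ with the convention $\frac10=+\infty$.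
   Context: Let $T$ be the infinite rooted binary tree, with vertices the finite words over $\{0,1\}$ and boundary $\partial T=\{0,1\}^{\mathbb N}$. The group $Aut(T)$ acts on the right, and $g\in Aut(T)$ is written $g=(g_0,g_1)\tau$ with $g_0,g_1\in Aut(T)$, $\tau\in S_2$ (permutations of $\{0,1\}$), meaning $(ty)\cdot g=\tau(t)\,(y\cdot g_t)$ for $t\in\{0,1\}$; this identifies $Aut(T)$ with $(Aut(T)\times Aut(T))\rtimes S_2$. Let $\varepsilon$ be the nontrivial element of $S_2$. For $\omega=\omega_0\omega_1\omega_2\dots\in\{0,1,2\}^{\mathbb N}$ let $\sigma\omega=\omega_1\omega_2\dots$ be the shift and let $\omega|_{i\dots j}=\omega_i\omega_{i+1}\dots\omega_j$. The group $G_\omega=\langle a,b_\omega,c_\omega,d_\omega\rangle\le Aut(T)$ is generated by $a=(1,1)\varepsilon$ and the recursively defined $b_\omega=(u^b(\omega_0),b_{\sigma\omega})$, $c_\omega=(u^c(\omega_0),c_{\sigma\omega})$, $d_\omega=(u^d(\omega_0),d_{\sigma\omega})$, where $u^b(0)=u^b(1)=a$, $u^b(2)=id$; $u^c(0)=u^c(2)=a$, $u^c(1)=id$; $u^d(1)=u^d(2)=a$, $u^d(0)=id$. Let $\rho=1^\infty\in\partial T$ (fixed by $b_\omega,c_\omega,d_\omega$) and $X=\rho G_\omega$ its orbit. For a finite group $F$, $\Gamma_\omega=F\wr_X G_\omega=(\Sigma_X F)\rtimes G_\omega$, where $\Sigma_X F$ is the group of finitely supported functions $\varphi:X\to F$,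 $G_\omega$ acts by $(g.\varphi)(x)=\varphi(xg)$, and elements $\varphi g$ multiply by $(\varphi_1g_1)(\varphi_2g_2)=(\varphi_1(g_1.\varphi_2))(g_1g_2)$. For $f\in F$ let $\varphi_f\in\Sigma_XF$ be the function with value $f$ at $\rho$ and $id_F$ elsewhere. The generating set of $\Gamma_\omega$ is $S_\omega=\{a\}\sqcup\{\varphi_f v\mid v\in\{id,b_\omega,c_\omega,d_\omega\},f\in F\}$, and $b_\omega(r)$ is the number of elements of $\Gamma_\omega$ of word length at most $r$ with respect to $S_\omega$. Given $\alpha'<\beta'$ and a function $b:\mathbb N\to\mathbb N$ (here the growth function of the group), the upper set is $U(\alpha',\beta')=\{s\in\mathbb N: \log b(s)\ge s^{\beta'}\}$ and the lower set is $L(\alpha',\beta')=\{t\in\mathbb N:\log b(t)\le t^{\alpha'}\}$ (restricted to integers at least $2$). When both are infinite, decompose them alternatingly as $U=\bigsqcup_{i\ge0}U_i$ and $L=\bigsqcup_{i\ge0}L_i$ with $U_i,L_i$ nonempty, every element of $U_i$ being larger than all elements of $L_j$ for $j\le i-1$ and smaller than all elements of $L_j$ for $j\ge i$, and every element of $L_i$ being larger than all elements of $U_j$ for $j\le i$ and smaller than all elements of $U_j$ for $j\ge i+1$ (the finitely many elements of $L$ smaller than $\min U$ are discarded). Put $s_i=\min U_i$, $s_i'=\max U_i$, $t_i=\min L_i$, $t_i'=\max L_i$, and $$u_{\alpha',\beta'}=\limsup_{i\to\infty}\frac{\log s_{i+1}}{\log t_i'},\qquad l_{\alpha',\beta'}=\limsup_{i\to\infty}\frac{\log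 t_i}{\log s_i'} .$$ The upper and lower pseudo period exponents are $u(\alpha,\beta)=\lim u_{\alpha',\beta'}$ and $l(\alpha,\beta)=\lim l_{\alpha',\beta'}$, the limits being in $[1,+\infty]$ as $\alpha'\to\alpha$ with $\alpha'>\alpha$ and $\beta'\to\beta$ with $\beta'<\beta$. *)

(* Defs.v *)
From HB Require Import structures.
From mathcomp Require Import all_boot all_order all_algebra all_fingroup.
From mathcomp Require Import finmap.
From mathcomp Require Import all_classical all_reals all_analysis.

Set Implicit Arguments.
Unset Strict Implicit.
Unset Printing Implicit Defensive.

Import Order.TTheory GRing.Theory Num.Theory.
Import numFieldNormedType.Exports.

Local Open Scope classical_set_scope.
Local Open Scope group_scope.

Section GeneratedSubgroup.
Variables (G : groupType) (A : set G).

Definition gen_set : set G := smallest [set H : set G | group_closed (mem H)] A.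

Lemma gen_set_closed : group_closed (mem gen_set).
Proof.
split=> [|x y]; rewrite ?inE; first by move=> H [[+ _] _]; rewrite inE.
move=> Ax Ay H [HH AH].
have [/= _ /(_ x y)] := HH; rewrite !inE; apply.
  by have := Ax H (conj HH AH).
by have := Ay H (conj HH AH).
Qed.

Definition gen_type := {g : G | g \in gen_set}.
HB.instance Definition _ := [isSub of gen_type for @sval _ _].
HB.instance Definition _ := [Choice of gen_type by <:].
HB.instance Definition _ :=
  SubChoice_isSubGroup.Build G (fun g => g \in gen_set) gen_type gen_set_closed.

Lemma mem_gen_set g : A g -> g \in gen_set.
Proof. by move=> Ag; rewrite inE; apply: sub_gen_smallest. Qed.

Definition gen_elt g (Ag : A g) : gen_type := Sub g (mem_gen_set Ag).

End GeneratedSubgroup.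

Section WordGrowth.
Variables (G : groupType) (S : set G).

Definition word_ball (r : nat) : set G :=
  [set g | exists w : seq G,
     [/\ (size w <= r)%N,
         forall s, s \in w -> S s \/ S s^-1
       & g = \big[*%g/1]_(s <- w) s]].

Definition word_growth (r : nat) : nat := #|` fset_set (word_ball r)|.

Lemma word_ball_finite r : finite_set S -> finite_set (word_ball r).
Proof.
move=> finS; elim: r => [|r IH].
  apply: (sub_finite_set _ (finite_set1 (1 : G))) => g [w []].
  by case: w => // _ _ ->; rewrite big_nil.
have finT : finite_set (S `|` (fun x => x^-1) @` S).
  by rewrite finite_setU; split=> //; apply: finite_image.
have finM : finite_set
    [set x * y | x in S `|` (fun x => x^-1) @` S & y in word_ball r].
  exact: finite_image2.
have finU := conj IH finM; rewrite -finite_setU in finU.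
apply: (sub_finite_set _ finU) => g [[|s w] [sz ws ->]].
  by left; exists [::]; split.
right; exists s.
  have [Ss|Ss] := ws s (mem_head _ _); first by left.
  by right; exists s^-1 => //; rewrite invgK.
exists (\big[*%g/1]_(x <- w) x); last by rewrite big_cons.
by exists w; split=> // x xw; apply: ws; rewrite in_cons xw orbT.
Qed.

End WordGrowth.

Record right_action (G : groupType) (X : Type) := RightAction {
  ract :> X -> G -> X;
  ract1 : forall x, ract x 1 = x;
  ractM : forall x g h, ract x (g * h) = ract (ract x g) h
}.

(* The pairs (phi, g), standing for the product phi g, with phi finitely
   supported. *)
Record wreath_elt (F G : groupType) (X : Type) := Wreath {
  wbase : X -> F;
  wtop : G;
  wbase_fin : finite_set [set x | wbase x != 1]
}.

(* The action only matters for the group structure put on this type. *)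
Definition wreath_product (F G : groupType) (X : Type) (_ : right_action G X) :=
  wreath_elt F G X.

Section PermutationalWreathProduct.
Variables (F G : groupType) (X : Type) (to : right_action G X).
Local Notation wreath := (wreath_product F to).

HB.instance Definition _ := gen_eqMixin wreath.
HB.instance Definition _ := gen_choiceMixin wreath.

Lemma wreath_eq (p q : wreath) : wbase p =1 wbase q -> wtop p = wtop q -> p = q.
Proof.
case: p q => [f g fP] [f' g' fP'] /= /funext eqf eqg; subst.
by congr Wreath; apply: Prop_irrelevance.
Qed.

Lemma ractK g : cancel (to^~ g) (to^~ g^-1).
Proof. by move=> x; rewrite -ractM mulgV ract1. Qed.

Lemma finite_shift (f : X -> F) g : finite_set [set x | f x != 1] ->
  finite_set [set x | f (to x g) != 1].
Proof.
move=> fin; apply: (finite_preimage (f := to^~ g) _ fin) => x y _ _.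
exact: can_inj (ractK g) x y.
Qed.

Lemma wone_fin : finite_set [set x : X | (1 : F) != 1].
Proof. by apply: (sub_finite_set _ (finite_set0 X)) => x /=; rewrite eqxx. Qed.

Lemma wmul_fin (p q : wreath) :
  finite_set [set x | wbase p x * wbase q (to x (wtop p)) != 1].
Proof.
have fin := conj (wbase_fin p) (finite_shift (wtop p) (wbase_fin q)).
rewrite -finite_setU in fin; apply: (sub_finite_set _ fin) => x /=.
have [->|] := eqVneq (wbase p x) 1; last by left.
by rewrite mul1g; right.
Qed.

Lemma winv_fin (p : wreath) :
  finite_set [set x | (wbase p (to x (wtop p)^-1))^-1 != 1].
Proof.
apply: (sub_finite_set _ (finite_shift (wtop p)^-1 (wbase_fin p))) => x /=.
by apply: contra_neq => ->; rewrite invg1.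
Qed.

Definition wone : wreath := Wreath 1 wone_fin.
Definition wmul (p q : wreath) : wreath := Wreath (wtop p * wtop q) (wmul_fin p q).
Definition winv (p : wreath) : wreath := Wreath (wtop p)^-1 (winv_fin p).

Lemma wmulA : associative wmul.
Proof.
move=> p q r; apply: wreath_eq => /= [x|]; last exact: mulgA.
by rewrite ractM mulgA.
Qed.

Lemma wmul1g : left_id wone wmul.
Proof.
by move=> p; apply: wreath_eq => /= [x|]; rewrite ?ract1 mul1g.
Qed.

Lemma wmulg1 : right_id wone wmul.
Proof. by move=> p; apply: wreath_eq => /= [x|]; rewrite mulg1. Qed.

Lemma wmulVg : left_inverse wone winv wmul.
Proof. by move=> p; apply: wreath_eq => /= [x|]; rewrite mulVg. Qed.

Lemma wmulgV : right_inverse wone winv wmul.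
Proof.
by move=> p; apply: wreath_eq => /= [x|]; rewrite ?ractK mulgV.
Qed.

HB.instance Definition _ :=
  isGroup.Build wreath wmulA wmul1g wmulg1 wmulVg wmulgV.

End PermutationalWreathProduct.

(* Vertices are words over {0,1}, with 0 = false and 1 = true; the children of
   [w] are [rcons w t].  An automorphism [g] is applied as [g w] for w.g. *)
Record treeAut := TreeAut {
  ta :> seq bool -> seq bool;
  ta_inv : seq bool -> seq bool;
  taK : cancel ta ta_inv;
  ta_invK : cancel ta_inv ta;
  ta_root : ta [::] = [::];
  ta_edge : forall w t, exists t', ta (rcons w t) = rcons (ta w) t'
}.

HB.instance Definition _ := gen_eqMixin treeAut.
HB.instance Definition _ := gen_choiceMixin treeAut.

Lemma treeAut_eq (g h : treeAut) : g =1 h -> g = h.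
Proof.
move=> /funext eqgh.
have eqV : ta_inv g = ta_inv h.
  by apply/funext=> w; rewrite -{1}(ta_invK h w) -eqgh taK.
case: g h eqgh eqV => [f f' f1 f2 f3 f4] [k k' k1 k2 k3 k4] /= eqf eqf'; subst.
by congr TreeAut; apply: Prop_irrelevance.
Qed.

Definition tone : treeAut.
Proof. by exists id id => // w t; exists t. Defined.

Definition tmul (g h : treeAut) : treeAut.
Proof.
exists (h \o g) (ta_inv g \o ta_inv h).
- exact: can_comp (taK h) (taK g).
- exact: can_comp (ta_invK g) (ta_invK h).
- by rewrite /= !ta_root.
- move=> w t /=; have [t1 ->] := ta_edge g w t.
  by have [t2 ->] := ta_edge h (g w) t1; exists t2.
Defined.

Definition tinv (g : treeAut) : treeAut.
Proof.
exists (ta_inv g) g.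
- exact: ta_invK.
- exact: taK.
- by rewrite -{1}(ta_root g) taK.
- move=> w t; case/lastP E: (ta_inv g (rcons w t)) => [|v t'].
    move/(congr1 g): E; rewrite ta_invK ta_root => /(congr1 size).
    by rewrite size_rcons.
  exists t'; congr rcons; have [t2 E2] := ta_edge g v t'.
  move/(congr1 g): E; rewrite ta_invK E2 => /eqP.
  by rewrite eqseq_rcons => /andP[/eqP -> _]; rewrite taK.
Defined.

Lemma tmulA : associative tmul. Proof. by move=> g h k; apply: treeAut_eq. Qed.
Lemma tmul1g : left_id tone tmul. Proof. by move=> g; apply: treeAut_eq. Qed.
Lemma tmulg1 : right_id tone tmul. Proof. by move=> g; apply: treeAut_eq. Qed.
Lemma tmulVg : left_inverse tone tinv tmul.
Proof. by move=> g; apply: treeAut_eq => w; apply: ta_invK. Qed.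
Lemma tmulgV : right_inverse tone tinv tmul.
Proof. by move=> g; apply: treeAut_eq => w; apply: taK. Qed.

HB.instance Definition _ :=
  isGroup.Build treeAut tmulA tmul1g tmulg1 tmulVg tmulgV.

(* [tree_node g0 g1 e] is (g_0, g_1) tau, where tau is the nontrivial element of
   S_2 if and only if [e] is true. *)
Definition tree_node (g0 g1 : treeAut) (e : bool) : treeAut.
Proof.
exists (fun w => if w is t :: y then (t (+) e) :: (if t then g1 else g0) y
                 else [::])
       (fun w => if w is t :: y then
                   (t (+) e) :: ta_inv (if t (+) e then g1 else g0) y
                 else [::]).
- by case=> //= t y; rewrite addbK taK.
- by case=> //= t y; rewrite addbK ta_invK.
- by [].
- case=> [|s y] t /=; first by exists (t (+) e); case: t; rewrite ta_root.
  have [t' Et'] := ta_edge (if s then g1 else g0) y t.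
  by exists t'; rewrite Et'.
Defined.

(* The prefixes of x.g are the images under g of the prefixes of x. *)
Definition bd_act (x : nat -> bool) (g : treeAut) : nat -> bool :=
  fun n => nth false (g (mkseq x n.+1)) n.

Lemma size_ta (g : treeAut) w : size (g w) = size w.
Proof.
elim/last_ind: w => [|w t IH]; first by rewrite ta_root.
by have [t' ->] := ta_edge g w t; rewrite !size_rcons IH.
Qed.

Lemma mkseqSr T (x : nat -> T) n : mkseq x n.+1 = rcons (mkseq x n) (x n).
Proof. by rewrite /mkseq -addn1 iotaD map_cat cats1. Qed.

Lemma mkseq_bd_act x g n : mkseq (bd_act x g) n = g (mkseq x n).
Proof.
elim: n => [|n IH]; first by rewrite /= ta_root.
rewrite mkseqSr IH /bd_act mkseqSr.
have [t' ->] := ta_edge g (mkseq x n) (x n).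
by rewrite nth_rcons size_ta size_mkseq ltnn eqxx.
Qed.

Lemma bd_act1 x : bd_act x 1 = x.
Proof. by apply/funext=> n; rewrite /bd_act nth_mkseq. Qed.

Lemma bd_actM x g h : bd_act x (g * h) = bd_act (bd_act x g) h.
Proof. by apply/funext=> n; rewrite {2}/bd_act mkseq_bd_act. Qed.

Section GrigorchukGroups.

Definition om_shift (om : nat -> 'I_3) : nat -> 'I_3 := fun n => om n.+1.

Definition tree_a : treeAut := tree_node 1 1 true.

Fixpoint directed_fun (u : 'I_3 -> treeAut) om (w : seq bool) : seq bool :=
  match w with
  | [::] => [::]
  | false :: y => false :: u (om 0%N) y
  | true :: y => true :: directed_fun u (om_shift om) y
  end.

Fixpoint directed_inv (u : 'I_3 -> treeAut) om (w : seq bool) : seq bool :=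
  match w with
  | [::] => [::]
  | false :: y => false :: ta_inv (u (om 0%N)) y
  | true :: y => true :: directed_inv u (om_shift om) y
  end.

Definition directed (u : 'I_3 -> treeAut) (om : nat -> 'I_3) : treeAut.
Proof.
exists (directed_fun u om) (directed_inv u om).
- by move=> w; elim: w om => [|[] w IH] om //=; rewrite ?IH ?taK.
- by move=> w; elim: w om => [|[] w IH] om //=; rewrite ?IH ?ta_invK.
- by [].
- move=> w t; elim: w om => [|[] w IH] om /=.
  + by exists t; case: t => //; rewrite ta_root.
  + by have [t' ->] := IH (om_shift om); exists t'.
  + by have [t' ->] := ta_edge (u (om 0%N)) w t; exists t'.
Defined.

Lemma directedE u om :
  directed u om = tree_node (u (om 0%N)) (directed u (om_shift om)) false.
Proof. by apply: treeAut_eq => -[|[] w]. Qed.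

Definition u_b (k : 'I_3) : treeAut := if k == 2%N :> nat then 1 else tree_a.
Definition u_c (k : 'I_3) : treeAut := if k == 1%N :> nat then 1 else tree_a.
Definition u_d (k : 'I_3) : treeAut := if k == 0%N :> nat then 1 else tree_a.

Definition tree_b := directed u_b.
Definition tree_c := directed u_c.
Definition tree_d := directed u_d.

Variable om : nat -> 'I_3.

Definition grig_gens : set treeAut :=
  [set tree_a; tree_b om; tree_c om; tree_d om].

Definition grig := gen_type grig_gens.
HB.instance Definition _ := Group.on grig.

Definition grig_a : grig :=
  gen_elt (or_introl (or_introl (or_introl erefl)) : grig_gens tree_a).
Definition grig_b : grig :=
  gen_elt (or_introl (or_introl (or_intror erefl)) : grig_gens (tree_b om)).
Definition grig_c : grig :=
  gen_elt (or_introl (or_intror erefl) : grig_gens (tree_c om)).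
Definition grig_d : grig :=
  gen_elt (or_intror erefl : grig_gens (tree_d om)).

Definition rho : nat -> bool := fun=> true.

Definition orbit_set : set (nat -> bool) :=
  [set x | exists g : grig, x = bd_act rho (val g)].

Definition orbit_pt := {x : nat -> bool | x \in orbit_set}.

Lemma orbit_act_subproof (x : orbit_pt) (g : grig) :
  bd_act (val x) (val g) \in orbit_set.
Proof.
case: x => x /=; rewrite !inE => -[h ->].
by exists (h * g); rewrite valM bd_actM.
Qed.

Definition orb_act (x : orbit_pt) (g : grig) : orbit_pt :=
  Sub (bd_act (val x) (val g)) (orbit_act_subproof x g).

Lemma orbit_act1 x : orb_act x 1 = x.
Proof. by apply: val_inj; apply: bd_act1. Qed.

Lemma orbit_actM x g h : orb_act x (g * h) = orb_act (orb_act x g) h.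
Proof. by apply: val_inj; apply: bd_actM. Qed.

Definition orbit_action : right_action grig orbit_pt :=
  RightAction orbit_act1 orbit_actM.

Lemma rho_orbit : rho \in orbit_set.
Proof. by rewrite inE; exists 1; rewrite val1 bd_act1. Qed.

Definition orbit_rho : orbit_pt := Sub rho rho_orbit.

Variable F : finGroupType.

Definition Gamma := wreath_product F orbit_action.
HB.instance Definition _ := Group.on Gamma.

Definition delta_rho (f : F) : orbit_pt -> F :=
  fun x => if `[< x = orbit_rho >] then f else 1.

Lemma delta_rho_fin f : finite_set [set x | delta_rho f x != 1].
Proof.
apply: (sub_finite_set _ (finite_set1 orbit_rho)) => x /=.
by rewrite /delta_rho; case: asboolP => // _; rewrite eqxx.
Qed.

Definition Gamma_a : Gamma := Wreath grig_a (wone_fin F orbit_pt).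
Definition Gamma_phi (f : F) (v : grig) : Gamma :=
  Wreath v (delta_rho_fin f).

Definition Gamma_gens : set Gamma :=
  [set Gamma_a] `|`
  [set g | exists f v,
     [set 1; grig_b; grig_c; grig_d] v /\ g = Gamma_phi f v].

Lemma Gamma_gens_finite : finite_set Gamma_gens.
Proof.
rewrite /Gamma_gens finite_setU; split; first exact: finite_set1.
have finV : finite_set [set 1; grig_b; grig_c; grig_d].
  by rewrite !finite_setU; do !split; exact: finite_set1.
have fin := finite_image2 (fun f v => Gamma_phi f v)
  (@finite_finset F setT) finV.
by apply: (sub_finite_set _ fin) => g [f [v [Vv ->]]]; exists f => //; exists v.
Qed.

Definition Gamma_growth : nat -> nat := word_growth Gamma_gens.

End GrigorchukGroups.

Local Close Scope group_scope.
Local Open Scope ring_scope.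

Section PseudoPeriods.
Variable R : realType.
Implicit Types (b : nat -> nat) (alpha beta : R).

Definition upper_set b beta : set nat :=
  [set s | (2 <= s)%N /\ s%:R `^ beta <= ln (b s)%:R].

Definition lower_set b alpha : set nat :=
  [set t | (2 <= t)%N /\ ln (b t)%:R <= t%:R `^ alpha].

Record alternating_decomposition (U L : set nat) (Us Ls : nat -> set nat) :
    Prop := {
  alt_Us_neq0 : forall i, Us i !=set0;
  alt_Ls_neq0 : forall i, Ls i !=set0;
  alt_Us_triv : trivIset setT Us;
  alt_Ls_triv : trivIset setT Ls;
  alt_Us_cover : \bigcup_i Us i = U;
  alt_Ls_cover : \bigcup_i Ls i = L `\` [set t | forall s, U s -> (t < s)%N];
  alt_gt : forall i j s t, (j < i)%N -> Us i s -> Ls j t -> (t < s)%N;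
  alt_lt : forall i j s t, (i <= j)%N -> Us i s -> Ls j t -> (s < t)%N
}.

Definition min_of (A : set nat) : nat := infimum 0%N A.
Definition max_of (A : set nat) : nat := supremum 0%N A.

(* [v] is u_{alpha',beta'}: U and L are infinite, so that their alternating
   decomposition exists (it is then unique), and v is the limsup. *)
Definition is_upper_exponent b alpha' beta' (v : \bar R) : Prop :=
  exists Us Ls,
    alternating_decomposition (upper_set b beta') (lower_set b alpha') Us Ls /\
    v = limn_esup
      (fun i => (ln (min_of (Us i.+1))%:R / ln (max_of (Ls i))%:R)%:E).

Definition is_lower_exponent b alpha' beta' (v : \bar R) : Prop :=
  exists Us Ls,
    alternating_decomposition (upper_set b beta') (lower_set b alpha') Us Ls /\
    v = limn_esup
      (fun i => (ln (min_of (Ls i))%:R / ln (max_of (Us i))%:R)%:E).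

Definition is_limit_exponent (P : R -> R -> \bar R -> Prop) alpha beta
    (l : \bar R) : Prop :=
  exists2 v : R -> R -> \bar R,
    \forall x \near (alpha^'+, beta^'-), P x.1 x.2 (v x.1 x.2) &
    v x.1 x.2 @[x --> (alpha^'+, beta^'-)] --> l.

Definition is_upper_pseudo_period b := is_limit_exponent (is_upper_exponent b).
Definition is_lower_pseudo_period b := is_limit_exponent (is_lower_exponent b).

Definition has_growth_exponent b (e : R) : Prop :=
  ln (ln (b r)%:R) / ln r%:R @[r --> \oo] --> e.

End PseudoPeriods.

(* m_1, n_1, m_2, n_2, ... are [m 0], [n 0], [m 1], [n 1], ... *)
Definition interleave (om1 om2 : nat -> 'I_3) (m n : nat -> nat) : nat -> 'I_3 :=
  fun k => if `[< exists i, (m i < k <= n i)%N >] then om2 k else om1 k.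

(* Main.v *)
Require Import Defs.
From mathcomp Require Import all_boot all_order all_algebra all_fingroup.
From mathcomp Require Import finmap.
From mathcomp Require Import all_classical all_reals all_analysis.
From mathcomp Require Import zify ring lra.

(* Cut the levels into blocks, the i-th one of length 3 (i+1)^2 + (i+1),
   along which omega first runs through 012012... and is then constantly 0.
   Passing to the two sections divides the average of suitably weighted word
   lengths by 2 at a level where omega stays constant, and by 2 / eta at a
   level where it rotates, and both rates are attained. Hence, if A_i is log
   2 times the number of levels before the block i, and E_i - A_i is - log
   eta times the number of rotations among them, then log log b(r) is close
   to A_i when log r is close to E_i. A block can thus follow any slope of
   log log b against log r in [alpha_0, 1]. For the mixed sequence, the slope
   is switched from delta to gamma when the path (E, A) comes near the line
   of slope alpha, and from gamma to delta near the line of slope beta.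
   Between two consecutive points of the lower and upper sets there is no
   switch, and the elementary geometry of a segment of slope gamma or delta
   gives the two limits (gamma - alpha) / (gamma - beta) and (beta - delta) /
   (alpha - delta), which are at most the announced bounds.

   The upper estimate of b encodes an element by its portrait. The lower one
   must come from G_omega itself, as F may be trivial: a word of controlled
   length passes 2^k slots in which the letter c may be inserted or not, and
   random lifts of letters to deeper levels are applied between the slots, so
   that the inserted letters rarely disturb each other. By Markov's
   inequality, for half of the choices at most a small number of slots fail
   to be read off from the element, which therefore determines the choice up
   to few errors. *)

(** The block boundaries do not depend on the slope, so changing the slope at a boundary amounts to
    interleaving the two constant-slope sequences. Block i has size of order i^2: rounding its
    number of rotations costs O(i), while a bounded number of blocks is negligible against the i^3
    levels before, which absorbs the losses of both growth estimates. The number eta comes from an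
    eigenvector: while omega rotates, lifting words from a subtree to the whole tree multiplies the
    weights eta^2, eta, 1 by exactly 2 / eta, thanks to eta^3 + eta^2 + eta = 2. The obstacle in the
    lower bound is that a letter c can alter the digit by which another slot is read. This requires
    a run of digits 1 up to a level p. The random lifts spread a test point over many distinct
    words, few of which have that run. The zeros at the ends of blocks provide h further levels at
    which b can be lifted, and b does no harm, since its sections at the levels p and N used for
    reading are trivial. The factor 2^h so gained beats a loss that is polynomial in the number k of
    doublings. *)

Set Implicit Arguments.
Unset Strict Implicit.
Unset Printing Implicit Defensive.

(* Keeps only what has been moved to the goal: lra is slow in large contexts. *)
Ltac tidy := repeat match goal with H : is_true _ |- _ => clear H end.

(** * Lifting letters to deeper levels *)

Section Letters.
Local Open Scope group_scope.

(** Each of b, c, d is named by the value of omega at which its section is trivial, so that the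
    cyclic permutation [ordS] of the phases also permutes the letters. *)
Definition ltr_u (y k : 'I_3) : treeAut := if k == y then 1 else tree_a.

Definition tree_y (y : 'I_3) : (nat -> 'I_3) -> treeAut := directed (ltr_u y).

Definition y_d : 'I_3 := Ordinal (isT : 0 < 3).
Definition y_c : 'I_3 := Ordinal (isT : 1 < 3).
Definition y_b : 'I_3 := Ordinal (isT : 2 < 3).

Lemma tree_a_cons t w : tree_a (t :: w) = ~~ t :: w.
Proof. by case: t. Qed.

Lemma tree_aa : tree_a * tree_a = 1.
Proof. by apply: treeAut_eq => -[|[] w]. Qed.

Lemma tree_y_true y om w : tree_y y om (true :: w) = true :: tree_y y (om_shift om) w.
Proof. by []. Qed.

Lemma tree_y_false y om w : tree_y y om (false :: w) = false :: ltr_u y (om 0%N) w.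
Proof. by []. Qed.

Lemma tree_mulE (g h : treeAut) w : (g * h) w = h (g w).
Proof. by []. Qed.

Lemma tree_1E (w : seq bool) : (1 : treeAut) w = w.
Proof. by []. Qed.

Lemma tree_take (g : treeAut) n w : g (take n w) = take n (g w).
Proof.
elim/last_ind: w => [|w t IH]; first by rewrite ta_root.
have [t' E] := ta_edge g w t.
have [le_w|lt_w] := leqP n (size w).
  by rewrite E -!cats1 takel_cat // IH takel_cat // size_ta.
by rewrite !take_oversize // ?size_ta size_rcons.
Qed.

Lemma tree_inj (g : treeAut) : injective g.
Proof. exact: can_inj (taK g). Qed.

(** Case analysis on y - x modulo 3: by cyclic symmetry three cases replace nine. *)
Lemma ord3P (P : 'I_3 -> 'I_3 -> Prop) :
  (forall x, P x x) -> (forall x, P x (ordS x)) -> (forall x, P x (ordS (ordS x))) ->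
  forall x y, P x y.
Proof.
move=> P0 P1 P2 x y; suff [->|[->|->]] : y = x \/ y = ordS x \/ y = ordS (ordS x) by [].
case: x y => -[|[|[]]] // hx [[|[|[]]] // hy];
  by [left; apply: val_inj | right; left; apply: val_inj | right; right; apply: val_inj].
Qed.

Lemma ordS3K (x : 'I_3) : ordS (ordS (ordS x)) = x.
Proof. by apply: val_inj; case: x => -[|[|[]]]. Qed.

Lemma ordS3_neq (x : 'I_3) : (ordS x == x = false) * (x == ordS x = false)
  * (ordS (ordS x) == x = false) * (x == ordS (ordS x) = false)
  * (ordS (ordS x) == ordS x = false) * (ordS x == ordS (ordS x) = false).
Proof. by case: x => -[|[|[]]]. Qed.

End Letters.

Arguments tree_y : simpl never.
Arguments tree_a : simpl never.
Arguments ta : simpl never.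

(** * A substitution that inverts the section map *)

Section Substitution.
Local Open Scope group_scope.

Lemma ltr_uM x k w : ltr_u (ordS (ordS x)) k (ltr_u (ordS x) k w) = ltr_u x k w.
Proof.
elim/ord3P: x / k => k; rewrite /ltr_u ?eqxx ?ordS3_neq ?ordS3K ?ordS3_neq ?eqxx //.
- by rewrite -tree_mulE tree_aa.
Qed.

(** Together with the identity the letters form a Klein four-group, since at each value of omega
    exactly one of the three sections is trivial. *)
Lemma tree_y_ordS x om w :
  tree_y (ordS (ordS x)) om (tree_y (ordS x) om w) = tree_y x om w.
Proof.
elim: w om => [|[] w IH] om //; first by rewrite !tree_y_true IH.
by rewrite !tree_y_false ltr_uM.
Qed.

Lemma tree_aK : involutive tree_a.
Proof. by move=> w; rewrite -[LHS]/((tree_a * tree_a) w) tree_aa. Qed.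

Fixpoint pw om (w : seq 'I_3) : treeAut :=
  if w is y :: w' then tree_a * (tree_y y om * pw om w') else 1.

Lemma pw_consE om y w x :
  pw om (y :: w) x = pw om w (tree_y y om (tree_a x)).
Proof. by []. Qed.

Lemma pw_catE om w1 w2 x : pw om (w1 ++ w2) x = pw om w2 (pw om w1 x).
Proof. by elim: w1 x => //= y w IH x; rewrite pw_consE IH. Qed.

Lemma pwa_cons om y t z : tree_y y om (tree_a (t :: z)) =
  ~~ t :: (if t then ltr_u y (om 0%N) z else tree_y y (om_shift om) z).
Proof. by case: t. Qed.

(** A letter y stands for the pair a y. Where omega is x, both sections of the image of a word are
    that word, up to factors a at its ends. In the case of three letters, one child sees x itself
    and the other one sees (x+1)(x+2) = x. *)
Definition zeta1 (x y : 'I_3) : seq 'I_3 :=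
  if y == x then [:: ordS x; x; ordS (ordS x)] else [:: y; y].

Definition zeta x w := flatten [seq zeta1 x y | y <- w].

Definition flip (e : bool) (z : seq bool) := if e then tree_a z else z.

Lemma flipK e : involutive (flip e).
Proof. by case: e => // z; apply: tree_aK. Qed.

Lemma ltr_u_neq y k : y != k -> ltr_u y k = tree_a.
Proof. by rewrite /ltr_u eq_sym => /negbTE ->. Qed.

Lemma ltr_u_eq k : ltr_u k k = 1.
Proof. by rewrite /ltr_u eqxx. Qed.

Lemma pw_zeta om w t z :
  let p := odd (count_mem (om 0%N) w) in
  pw om (zeta (om 0%N) w) (t :: z) =
  t (+) p :: flip (~~ (t (+) p)) (pw (om_shift om) w (flip (~~ t) z)).
Proof.
have aa := tree_aK.
have aE z' : tree_a z' = flip true z' by [].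
elim: w t z => [|y w IH] t z; first by rewrite /= addbF flipK.
rewrite /zeta map_cons [flatten _]/= -/(zeta _ _) pw_catE /zeta1 [count_mem _ _]/=.
have [yx|yx] := eqVneq y (om 0%N); rewrite oddD.
  rewrite 3!pw_consE !pwa_cons IH pw_consE; case: t => /=.
    rewrite yx !ltr_u_neq ?ordS3_neq //= aa.
    by rewrite negbK; case: (odd _).
  by rewrite yx ltr_u_eq tree_1E tree_y_ordS aa.
rewrite 2!pw_consE !pwa_cons IH pw_consE; case: t => /=;
  by rewrite ltr_u_neq ?aa.
Qed.

Fixpoint lift_word (om : nat -> 'I_3) l (w : seq 'I_3) : seq 'I_3 :=
  if l is l'.+1 then zeta (om 0%N) (lift_word (om_shift om) l' w) else w.

(** The letter x yields each of the three letters once, any other letter yields two copies of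
    itself. *)
Lemma odd_count_zeta x y w : odd (count_mem y (zeta x w)) = odd (count_mem x w).
Proof.
elim: w => [|v w IH] //; rewrite /zeta /= -/(zeta _ _) count_cat !oddD IH.
congr (_ (+) _); rewrite /zeta1; have [_|_] /= := eqVneq v x.
  by clear IH; elim/ord3P: x / y => x; rewrite ?eqxx ?ordS3_neq ?ordS3K ?eqxx ?ordS3_neq.
by case: eqP.
Qed.

Lemma odd_count_lift om l y w :
  odd (count_mem y (lift_word om l.+1 w)) = odd (count_mem (om l) w).
Proof.
elim: l om y => [|l IH] om y; first by rewrite /= odd_count_zeta.
by rewrite [lift_word _ _ _]/= odd_count_zeta; apply: IH.
Qed.

Definition om_shiftn l (om : nat -> 'I_3) : nat -> 'I_3 := fun n => om (l + n)%N.

(* The lift of [y] to level [l] flips the digit [l] and lets [y] act from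
   there on; the digit [e] seen by [y] is the flipped one up to a reflection. *)
Lemma lift_act om l y x : (0 < l)%N ==> (y != om l.-1) -> (l < size x)%N ->
  exists e, pw om (lift_word om l [:: y]) x =
    take l x ++ ~~ nth false x l ::
      behead (tree_y y (om_shiftn l om) (e :: drop l.+1 x)).
Proof.
elim: l om x => [|l IH] om [|t x] // yl lx.
  exists (~~ t); rewrite pw_consE /= tree_a_cons drop0.
  by case: t {lx}.
rewrite [lift_word _ _ _]/=; set w1 := lift_word (om_shift om) l [:: y].
(* The hypothesis on [om l.-1] makes this count even at every level passed, so that the lift fixes
   the digits before l. *)
have p0 : odd (count_mem (om 0%N) w1) = false.
  rewrite /w1; case: l yl {IH lx w1} => [|l] yl.
    by rewrite /= (negbTE yl).
  by rewrite odd_count_lift /= (negbTE yl).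
rewrite pw_zeta p0 addbF.
have [|| e ->] := IH (om_shift om) (flip (~~ t) x).
- by case: l yl {IH lx w1 p0}.
- by case: (t) => /=; rewrite ?size_ta; apply: lx.
exists e; congr (_ :: _).
case: l {IH yl w1 p0} lx => [|l] lx.
  by case: t lx; case: x => // -[] x.
case: t lx => lx; first by case: x lx.
 by case: x lx => [|[] x].
Qed.

End Substitution.

(** * Which digits a lift can change *)

Section Digits.
Local Open Scope group_scope.

(** Along the leading 1s the letter reproduces itself; at the first 0 it leaves its section, which
    is a or trivial, so at most the digit after the first 0 changes. *)
Lemma tree_y_nth y om x j : nth false (tree_y y om x) j =
  nth false x j (+) [&& 0 < j < size x, y != om j.-1 & index false x == j.-1]%N.
Proof.
elim: x om j => [|[] x IH] om [|j] //.
- rewrite tree_y_true /= IH; case: j => [|j] /=; first by rewrite !andbF.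
  by rewrite ltnS eqSS.
- rewrite tree_y_false /ltr_u [om 0%N == y]eq_sym.
  case: j => [|j] /=.
    case: eqVneq => [|ne] /=; first by rewrite andbF addbF.
    by case: x {IH} => // t x; rewrite tree_a_cons /= addbT.
  rewrite !andbF addbF; case: eqP => // _.
  by case: x {IH} => // t x; rewrite tree_a_cons.
Qed.

Definition lift_elt om l y := pw om (lift_word om l [:: y]).

Section LiftDigits.
Variables (om : nat -> 'I_3) (l : nat) (y : 'I_3).
Hypothesis yl : (0 < l)%N ==> (y != om l.-1).
Variable x : seq bool.
Hypothesis lx : (l < size x)%N.

Lemma lift_lt i : (i < l)%N -> nth false (lift_elt om l y x) i = nth false x i.
Proof.
move=> il; have [e ->] := lift_act yl lx.
by rewrite nth_cat size_take lx il nth_take.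
Qed.

Lemma lift_eq : nth false (lift_elt om l y x) l = ~~ nth false x l.
Proof.
have [e ->] := lift_act yl lx.
by rewrite nth_cat size_take lx ltnn subnn.
Qed.

(** Beyond level l the lift acts as one letter y; the bit e stands for the digit l as this letter
    sees it. *)
Lemma lift_gt : exists e, forall j, (l < j)%N -> nth false (lift_elt om l y x) j =
  nth false x j (+) [&& j < size x, y != om j.-1
                      & index false (e :: drop l.+1 x) == j.-1 - l]%N.
Proof.
have [e E] := lift_act yl lx; exists e => j lj.
rewrite E nth_cat size_take lx ltnNge ltnW //=.
have -> : (j - l = (j - l.+1).+1)%N by lia.
rewrite /= nth_behead tree_y_nth /= nth_drop size_drop subnKC //.
rewrite /om_shiftn; have -> : (l + (j - l.+1) = j.-1)%N by lia.
have -> : (j - l.+1 = j.-1 - l)%N by lia.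
by congr (_ (+) (_ && _)); lia.
Qed.

(** A 0 at i stops the letter before it can touch level P. The default value [true] makes the
    hypothesis on digit i imply that i lies inside x. *)
Lemma lift_safe P i : (l < i)%N -> (i.+1 < P)%N -> nth true x i = false ->
  forall j, (P <= j)%N -> nth false (lift_elt om l y x) j = nth false x j.
Proof.
move=> li iP xi j Pj; have [e E] := lift_gt; rewrite E; last by lia.
have ix : (i < size x)%N by rewrite ltnNge; apply/negP => h; rewrite nth_default in xi.
have : (index false (e :: drop l.+1 x) <= i - l)%N.
  rewrite leqNgt; apply/negP => /(before_find false (a := pred1 false)).
  have -> : (i - l = (i - l.+1).+1)%N by lia.
  by rewrite /= nth_drop subnKC // (set_nth_default true) // xi.
case: (index _ _ =P _) => [->|_]; last by rewrite !andbF addbF.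
lia.
Qed.

(** The lifted b stops at the first 0 that it meets, which lies before p, at p or at N; in the last
    two cases its section is trivial. *)
Lemma lift_b_safe p N : y = y_b -> (l < p < N)%N -> om p = y_b -> om N = y_b ->
  (forall i, (p < i < N)%N -> nth true x i = true) -> nth true x N = false ->
  forall j, (p < j)%N -> nth false (lift_elt om l y x) j = nth false x j.
Proof.
move=> yb /andP[lp pN] omp omN x1 xN j pj; have [e E] := lift_gt; rewrite E; last by lia.
have Nx : (N < size x)%N by rewrite ltnNge; apply/negP => h; rewrite nth_default in xN.
have leN : (index false (e :: drop l.+1 x) <= N - l)%N.
  rewrite leqNgt; apply/negP => /(before_find false (a := pred1 false)).
  have -> : (N - l = (N - l.+1).+1)%N by lia.
  by rewrite /= nth_drop subnKC ?(set_nth_default true) // ?xN //; lia.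
case: (ltnP j (size x)) => [jx|]; last by rewrite andFb addbF.
case: (index _ _ =P _) => [K|_]; last by rewrite !andbF addbF.
rewrite K in leN; have [jp|jp] := eqVneq j.-1 p; first by rewrite jp omp yb eqxx andbF addbF.
have [jN|jN] := eqVneq j.-1 N; first by rewrite jN omN yb eqxx andbF addbF.
have : nth false (e :: drop l.+1 x) (j.-1 - l) = false.
  rewrite -K nth_index // -index_mem K /= size_drop; lia.
have -> : (j.-1 - l = (j.-1 - l.+1).+1)%N by lia.
rewrite /= nth_drop subnKC; last by lia.
rewrite (set_nth_default true); last by lia.
by rewrite x1 //; lia.
Qed.

End LiftDigits.

Lemma tree_y_safe om y x P i : (i.+1 < P)%N -> nth true x i = false ->
  forall j, (P <= j)%N -> nth false (tree_y y om x) j = nth false x j.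
Proof.
move=> iP xi j Pj; rewrite tree_y_nth.
have ix : (i < size x)%N by rewrite ltnNge; apply/negP => h; rewrite nth_default in xi.
have : (index false x <= i)%N.
  rewrite leqNgt; apply/negP => /(before_find true (a := pred1 false)).
  by rewrite /= xi.
case: (index _ _ =P _) => [->|_]; last by rewrite !andbF addbF.
lia.
Qed.

End Digits.

(** * Lower bound for the growth *)

Section Bits.

Fixpoint bits m : seq (seq bool) :=
  if m is m'.+1 then [seq false :: s | s <- bits m'] ++ [seq true :: s | s <- bits m']
  else [:: [::]].

Lemma size_bits m : size (bits m) = 2 ^ m.
Proof. by elim: m => //= m IH; rewrite size_cat !size_map IH expnS mul2n addnn. Qed.

Lemma mem_bits m s : (s \in bits m) = (size s == m).
Proof.
elim: m s => [|m IH] [|b s] /=; rewrite ?mem_cat //.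
  by apply/negbTE/negP => /orP[] /mapP[].
rewrite eqSS -IH; apply/orP/idP => [[] /mapP[t ? [_ ->]] //|ms].
by case: b; [right|left]; apply: map_f.
Qed.

Lemma uniq_bits m : uniq (bits m).
Proof.
elim: m => //= m IH; rewrite cat_uniq !map_inj_uniq ?IH //=; try by move=> ? ? [].
by rewrite andbT; apply/hasPn => _ /mapP[t _ ->]; apply/negP => /mapP[].
Qed.

Lemma sum_bitsS m (f : seq bool -> nat) : \sum_(s <- bits m.+1) f s =
  \sum_(s <- bits m) (f (false :: s) + f (true :: s)).
Proof. by rewrite /= big_cat !big_map big_split. Qed.

Lemma sum_bitsD m n (f : seq bool -> nat) : \sum_(s <- bits (m + n)) f s =
  \sum_(s1 <- bits m) \sum_(s2 <- bits n) f (s1 ++ s2).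
Proof.
elim: m f => [|m IH] f; first by rewrite big_seq1.
rewrite addSn !sum_bitsS IH; apply: eq_bigr => s _.
by rewrite -big_split.
Qed.

Lemma sum_bits_const m c : \sum_(s <- bits m) c = 2 ^ m * c.
Proof. by rewrite big_const_seq count_predT size_bits iter_addn_0 mulnC. Qed.

(** Some choice is at most the average; this replaces the random lifts by a fixed product of
    lifts. *)
Lemma sum_bits_le m (f : seq bool -> nat) M :
  \sum_(s <- bits m) f s <= M -> exists2 s, size s = m & 2 ^ m * f s <= M.
Proof.
move=> le; have [/hasP[s]|/hasPn no] := boolP (has (fun s => 2 ^ m * f s <= M) (bits m)).
  by rewrite mem_bits => /eqP; exists s.
have m0 : 0 < 2 ^ m by rewrite expn_gt0.
suff : 2 ^ m * M.+1 <= 2 ^ m * M by rewrite leq_pmul2l // ltnn.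
rewrite -sum_bits_const; apply: leq_trans (leq_mul (leqnn _) le).
rewrite big_distrr /= big_seq [leqRHS]big_seq; apply: leq_sum => s /no.
by rewrite -ltnNge.
Qed.

Lemma markov_bits m (f : seq bool -> nat) M c :
  \sum_(s <- bits m) f s <= M -> 2 * M <= 2 ^ m * c ->
  2 ^ m <= 2 * count (fun s => f s <= c) (bits m).
Proof.
move=> le Mc.
have : 2 ^ m = count (fun s => f s <= c) (bits m) + count (fun s => c < f s) (bits m).
  rewrite -size_bits -(count_predC (fun s => f s <= c)); congr (_ + _).
  by apply: eq_count => s /=; rewrite -ltnNge.
have : c.+1 * count (fun s => c < f s) (bits m) <= M.
  apply: leq_trans le; rewrite -sum1_count big_distrr /= big_mkcond.
  by apply: leq_sum => s _; case: ifP => //; rewrite muln1.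
nia.
Qed.

End Bits.

Section Words.
Local Open Scope group_scope.

(* [None] stands for a, and [Some y] for the letter y. *)
Definition lval om (l : option 'I_3) : treeAut :=
  if l is Some y then tree_y y om else tree_a.

Definition wval om (w : seq (option 'I_3)) : treeAut :=
  foldr (fun l g => lval om l * g) 1 w.

Lemma wval_cons om l w x : wval om (l :: w) x = wval om w (lval om l x).
Proof. by []. Qed.

Lemma wval_cat om w1 w2 : wval om (w1 ++ w2) = wval om w1 * wval om w2.
Proof. by elim: w1 => [|l w IH] /=; rewrite ?mul1g // IH mulgA. Qed.

Lemma wval_catE om w1 w2 x : wval om (w1 ++ w2) x = wval om w2 (wval om w1 x).
Proof. by rewrite wval_cat. Qed.

Definition pletters (w : seq 'I_3) : seq (option 'I_3) :=
  flatten [seq [:: None; Some y] | y <- w].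

Lemma wval_pletters om w : wval om (pletters w) = pw om w.
Proof. by elim: w => //= y w IH; rewrite -IH. Qed.

Lemma size_pletters w : size (pletters w) = (2 * size w)%N.
Proof. by elim: w => //= y w IH; rewrite IH mulnS. Qed.

End Words.

(** * Programs, and reading their bits off an element *)

Section Programs.
Variables (om : nat -> 'I_3) (p N : nat).
Hypotheses (omp : om p = y_b) (omN : om N = y_b) (pN : p < N).

(* A program is a word with slots for free bits: a bit 1 inserts the letter c.
   The label [Some d] of a block marks that it contains one letter c, which moves
   the digits beyond p only when the digits d, ..., p-1 are all 1. *)
Inductive instr := Bit | Op of seq (option 'I_3) & option nat.

Definition bitw (b : bool) : seq (option 'I_3) := if b then [:: Some y_c] else [::].

Fixpoint pword (P : seq instr) (s : seq bool) : seq (option 'I_3) :=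
  match P with
  | [::] => [::]
  | Bit :: P' => bitw (head false s) ++ pword P' (behead s)
  | Op w _ :: P' => w ++ pword P' s
  end.

Fixpoint nbits (P : seq instr) : nat :=
  match P with
  | [::] => 0
  | Bit :: P' => (nbits P').+1
  | Op _ _ :: P' => nbits P'
  end.

Fixpoint pcost (P : seq instr) : nat :=
  match P with
  | [::] => 0
  | Bit :: P' => (pcost P').+1
  | Op w _ :: P' => size w + pcost P'
  end.

Lemma size_pword P s : size (pword P s) <= pcost P.
Proof.
elim: P s => [|[|w d] P IH] s //=; rewrite size_cat ?leq_add2l //.
by case: (head false s); rewrite /= ?add1n ?add0n ?ltnS // leqW.
Qed.

Lemma nbits_cat P Q : nbits (P ++ Q) = nbits P + nbits Q.
Proof. by elim: P => [|[|w d] P IH] //=; rewrite IH. Qed.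

Lemma pcost_cat P Q : pcost (P ++ Q) = pcost P + pcost Q.
Proof. by elim: P => [|[|w d] P IH] //=; rewrite IH ?addnA. Qed.

Lemma pword_cat P Q s t : size s = nbits P ->
  pword (P ++ Q) (s ++ t) = pword P s ++ pword Q t.
Proof.
elim: P s => [|[|w d] P IH] s /=; first by case: s.
  by case: s => // b s [] /IH /= ->; rewrite catA.
by move=> /IH ->; rewrite catA.
Qed.

(** The condition under which a letter at work from level d on may pass p: it meets no 0 before. The
    digits before d and the digit p remain free. *)
Definition allones d (x : seq bool) := all id (drop d (take p x)).

Definition danger (o : option nat) x := if o is Some d then allones d x else false.

Fixpoint dang (P : seq instr) s x : nat :=
  match P with
  | [::] => 0
  | Bit :: P' => allones 0 x + dang P' (behead s) (wval om (bitw (head false s)) x)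
  | Op w o :: P' => danger o x + dang P' s (wval om w x)
  end.

Definition ones : seq bool := nseq p.+1 true.

(** Each slot is tested on a point beginning with 1s up to beyond p, and only the instructions after
    the slot can spoil the test. *)
Fixpoint dtot (P : seq instr) s : nat :=
  match P with
  | [::] => 0
  | Bit :: P' => dang P' (behead s) ones + dtot P' (behead s)
  | Op _ _ :: P' => dtot P' s
  end.

(** The positions of the test points when the program is over: a program appended to it acts on
    these. *)
Fixpoint ends (P : seq instr) s : seq (seq bool) :=
  match P with
  | [::] => [::]
  | Bit :: P' => wval om (pword P' (behead s)) ones :: ends P' (behead s)
  | Op _ _ :: P' => ends P' s
  end.

Lemma size_ends P s : size (ends P s) = nbits P.
Proof. by elim: P s => [|[|w d] P IH] s //=; rewrite IH. Qed.

Lemma all_size_ends P s : all (fun x => size x == p.+1) (ends P s).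
Proof.
elim: P s => [|[|w d] P IH] s //=.
by rewrite IH andbT size_ta size_nseq.
Qed.

Lemma dang_cat P Q s t x : size s = nbits P ->
  dang (P ++ Q) (s ++ t) x = dang P s x + dang Q t (wval om (pword P s) x).
Proof.
elim: P s x => [|[|w d] P IH] s x /=; first by case: s.
  by case: s => // b s [] /IH /= ->; rewrite wval_catE addnA.
by move=> /IH ->; rewrite wval_catE addnA.
Qed.

Lemma dtot_cat P Q s t : size s = nbits P ->
  dtot (P ++ Q) (s ++ t) = dtot P s + \sum_(x <- ends P s) dang Q t x + dtot Q t.
Proof.
elim: P s => [|[|w d] P IH] s /=; first by case: s => //; rewrite big_nil.
  case: s => // b s [] es /=; rewrite IH // dang_cat // big_cons; lia.
by move=> /IH.
Qed.

Lemma dtot_op P s : nbits P = 0 -> dtot P s = 0.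
Proof. by elim: P s => [|[]] //= w o P IH s /IH. Qed.

Lemma allones_take d x : allones d (take p.+1 x) = allones d x.
Proof. by rewrite /allones take_takel. Qed.

Lemma dang_take P s x : dang P s (take p.+1 x) = dang P s x.
Proof.
elim: P s x => [|[|w o] P IH] s x //=; rewrite tree_take IH ?allones_take //.
by case: o => //= d; rewrite allones_take.
Qed.

(** The points considered look like the test point beyond p: 1s before N, a 0 at N, and digit N.+1,
    which carries the bit. *)
Definition good (i : instr) := if i is Op w o then
  (if o is Some d then d <= p else true) /\
  forall x, size x = N.+2 -> (forall i, p < i < N -> nth true x i = true) ->
    nth true x N = false -> ~~ danger o x ->
    forall j, p < j -> nth false (wval om w x) j = nth false x j else True.

Fixpoint goods P := if P is i :: P' then good i /\ goods P' else True.

Lemma goods_cat P Q : goods (P ++ Q) <-> goods P /\ goods Q.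
Proof. by elim: P => [|i P IH] /=; [tauto | rewrite IH; tauto]. Qed.

Lemma allonesPn d x : size x > p -> ~~ allones d x ->
  exists2 i, d <= i < p & nth true x i = false.
Proof.
move=> px /(all_nthP true) h.
have [/existsP[i /andP[di /negbTE xi]]|/existsPn no] :=
  boolP [exists i : 'I_p, (d <= i) && ~~ nth true x i].
  by exists i; rewrite // di ltn_ord.
case: h => i; rewrite size_drop size_take px => ip.
rewrite nth_drop nth_take; last by lia.
have lip : d + i < p by lia.
by have := no (Ordinal lip); rewrite /= leq_addr /= negbK.
Qed.

(** As long as no danger occurs, the digits beyond p are unchanged, so the point keeps the shape
    that [good] requires at the next instruction. *)
Lemma nodanger P s x : goods P -> size x = N.+2 ->
  (forall i, p < i < N -> nth true x i = true) -> nth true x N = false ->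
  dang P s x = 0 ->
  forall j, p < j -> nth false (wval om (pword P s) x) j = nth false x j.
Proof.
elim: P s x => [|i P IH] s x //= [gi gP] szx x1 xN.
have step w : (forall j, p < j -> nth false (wval om w x) j = nth false x j) ->
  let y := wval om w x in [/\ size y = N.+2,
   (forall i, p < i < N -> nth true y i = true) & nth true y N = false].
  move=> wP y; have szy : size y = N.+2 by rewrite size_ta.
  split => //.
    move=> k pk; rewrite (set_nth_default false) ?wP ?szy; try lia.
    by rewrite (set_nth_default true) ?x1 ?szx //; lia.
  rewrite (set_nth_default false) ?wP ?szy; try lia.
  by rewrite (set_nth_default true) ?xN ?szx //; lia.
case: i gi => [|w o] /= gi /eqP; rewrite addn_eq0 => /andP[d0 /eqP dP] j pj;
  rewrite wval_catE.
  have wP k : p < k ->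
    nth false (wval om (bitw (head false s)) x) k = nth false x k.
    case: (head false s) => // pk; rewrite wval_cons /=.
    have [||i ip xi] := @allonesPn 0 x; [by rewrite szx; lia | by case: allones d0 |].
    by apply: (@tree_y_safe _ _ _ p.+1 i) => //; lia.
  have [szy y1 yN] := step _ wP.
  by rewrite IH // wP.
have [_ gi2] := gi; have wP := gi2 x szx x1 xN (_ : ~~ danger o x).
have {}wP : forall j, p < j -> nth false (wval om w x) j = nth false x j.
  by apply: wP; case: danger d0.
have [szy y1 yN] := step _ wP.
by rewrite IH // wP.
Qed.

(** On this point c flips the last digit, because omega is b, and not c, at level N; the last digit
    thus records whether c was inserted. *)
Definition tau : seq bool := nseq N true ++ [:: false; true].
Definition flag (g : treeAut) := nth false (g tau) N.+1.

Fixpoint errs (P : seq instr) s : seq bool :=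
  match P with
  | [::] => [::]
  | Bit :: P' => (flag (wval om (pword P s)) (+) ~~ head false s) :: errs P' (behead s)
  | Op _ _ :: P' => errs P' s
  end.

Lemma size_errs P s : size (errs P s) = nbits P.
Proof. by elim: P s => [|[|w d] P IH] s //=; rewrite IH. Qed.

(** The flag, corrected by the error pattern, gives the first bit; the letter it stands for is
    cancelled, and the next bit is read off the remaining product. *)
Lemma errs_inj P s s' : size s = nbits P -> size s' = nbits P ->
  wval om (pword P s) = wval om (pword P s') -> errs P s = errs P s' -> s = s'.
Proof.
elim: P s s' => [|[|w d] P IH] s s' /=; [by case: s; case: s'| |].
  case: s => // b s; case: s' => // b' s' [es] [es'] /= E [].
  rewrite E => /addbI/negb_inj eb; subst b' => /IH; move=> -> //.
  by move: E; rewrite !wval_cat => /mulgI.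
by move=> es es'; rewrite !wval_cat => /mulgI; apply: IH.
Qed.

Lemma tree_y_ones y om' n : tree_y y om' (nseq n true) = nseq n true.
Proof. by elim: n om' => // n IH om'; rewrite /= tree_y_true IH. Qed.

(** A slot is misread only if its test point meets a danger afterwards. *)
Lemma count_errs P s : goods P -> count id (errs P s) <= dtot P s.
Proof.
elim: P s => [|[|w d] P IH] s //= [gi gP]; last exact: IH.
apply: leq_add; last exact: IH.
set b := head false s; set Q := bitw b.
case d0 : (dang P (behead s) ones) => [|n]; last by case: (_ (+) _).
suff -> : flag (wval om (Q ++ pword P (behead s))) = ~~ b by rewrite addbb.
have szt : size tau = N.+2 by rewrite /tau size_cat size_nseq /= addn2.
have tauN : nth true tau N = false by rewrite /tau nth_cat size_nseq ltnn subnn.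
have tau1 i : i < N -> nth true tau i = true.
  by move=> iN; rewrite /tau nth_cat size_nseq iN nth_nseq iN.
have idx : index false tau = N.
  rewrite /tau index_cat; case: ifP => [/nseqP[]//|_].
  by rewrite size_nseq /= addn0.
pose x := wval om Q tau.
have xE j : nth false x j = nth false tau j (+) [&& b & j == N.+1].
  rewrite /x /Q; case: (b); last by rewrite addbF.
  rewrite -[wval om _ _]/(tree_y y_c om tau) tree_y_nth idx szt; congr (_ (+) _).
  case: j => [|j] //=; rewrite eqSS [N == j]eq_sym.
  by case: (j =P N) => [->|_]; rewrite ?andbF // omN ltnSn.
have szx : size x = N.+2 by rewrite size_ta.
have tN1 : nth false tau N.+1 = true.
  by rewrite /tau nth_cat size_nseq ltnNge leqnSn subSnn.
rewrite /flag wval_catE -/x (nodanger gP szx) ?xE ?tN1 ?eqxx //; last by lia.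
- by case: b @Q x xE szx.
- move=> i ip; rewrite (set_nth_default false) ?szx; last by lia.
  rewrite xE (_ : (i == N.+1) = false) ?andbF ?addbF; last by lia.
  by rewrite (set_nth_default true) ?tau1 ?szt //; lia.
- rewrite (set_nth_default false) ?szx // xE (_ : (N == N.+1) = false) ?andbF ?addbF;
    last by lia.
  by rewrite (set_nth_default true) ?szt.
- rewrite -dang_take; suff -> : take p.+1 x = ones by [].
  rewrite -tree_take (_ : take p.+1 tau = ones).
    by rewrite /Q; case: (b) => //; apply: tree_y_ones.
  have [h|h] := ltnP p.+1 N.
    rewrite /tau take_cat size_nseq h /ones.
    by rewrite take_nseq // ltnW.
  rewrite /tau (_ : N = p.+1); last by lia.
  by rewrite -[X in take X](size_nseq p.+1 true) take_size_cat ?size_nseq.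
Qed.

End Programs.

(** * Counting dangers over many points *)

Section Counting.
Variables (om : nat -> 'I_3) (p N : nat).
Hypotheses (omp : om p = y_b) (omN : om N = y_b) (pN : p < N).
Local Notation dang := (dang om p).
Local Notation allones := (allones p).

Lemma allonesE d y : size y = p.+1 -> d <= p -> allones d y ->
  y = take d y ++ nseq (p - d) true ++ [:: nth false y p].
Proof.
move=> sy dp ay; have std : size (take d y) = d by rewrite size_takel // sy; lia.
apply: (@eq_from_nth _ false) => [|i iy].
  by rewrite !size_cat std size_nseq sy /=; lia.
rewrite nth_cat std; case: ltnP => id; first by rewrite nth_take.
rewrite nth_cat size_nseq; case: ltnP => ip; last first.
  have -> : i = p by move: iy; rewrite sy; lia.
  by rewrite subnn.
rewrite nth_nseq ip; move/(all_nthP false): ay => /(_ (i - d)).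
rewrite size_drop size_takel ?sy // nth_drop subnKC // nth_take; last by lia.
by apply.
Qed.

(** Such a point is determined by its digits before d and its digit p. *)
Lemma count_allones d ys : d <= p -> uniq ys -> all (fun y => size y == p.+1) ys ->
  count (allones d) ys <= 2 ^ d.+1.
Proof.
move=> dp uys /allP sz; rewrite -size_filter -size_bits.
rewrite -(size_map (fun y => take d y ++ [:: nth false y p]) [seq y <- ys | allones d y]).
apply: uniq_leq_size => [|_ /mapP[y + ->]].
  rewrite map_inj_in_uniq ?filter_uniq // => y y'.
  rewrite !mem_filter => /andP[ay /sz/eqP sy] /andP[ay' /sz/eqP sy'] /eqP.
  rewrite eqseq_cat ?size_takel ?sy ?sy' //; try lia.
  move=> /andP[/eqP e1 /eqP[e2]].
  by rewrite (allonesE sy dp ay) (allonesE sy' dp ay') e1 e2.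
rewrite mem_filter => /andP[_ /sz/eqP sy].
by rewrite mem_bits size_cat size_takel ?sy ?addn1 //; lia.
Qed.

Definition label_size (o : option nat) := if o is Some d then 2 ^ d.+1 else 0.

Fixpoint wsum (P : seq instr) : nat :=
  match P with
  | [::] => 0
  | Bit :: P' => 2 + wsum P'
  | Op _ o :: P' => label_size o + wsum P'
  end.

Lemma wsum_cat P Q : wsum (P ++ Q) = wsum P + wsum Q.
Proof. by elim: P => [|[|w o] P IH] //=; rewrite IH ?addnA. Qed.

(** The points remain distinct while the word moves them, so [count_allones] applies afresh at every
    instruction. *)
Lemma sum_dang P s ys : goods om p N P -> uniq ys ->
  all (fun y => size y == p.+1) ys -> \sum_(y <- ys) dang P s y <= wsum P.
Proof.
elim: P s ys => [|i P IH] s ys; first by rewrite big1_eq.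
move=> [gi gP] uys sz; rewrite [wsum _]/=.
have aux w t : \sum_(y <- ys) dang P t (wval om w y) <= wsum P.
  rewrite -(big_map (wval om w) xpredT (dang P t)); apply: IH => //.
    by rewrite map_inj_uniq //; apply: tree_inj.
  by rewrite all_map; apply: sub_all sz => y /=; rewrite size_ta.
have cnt d : d <= p -> \sum_(y <- ys) (allones d y : nat) <= 2 ^ d.+1.
  by move=> dp; rewrite -[leqLHS]big_mkcond sum1_count count_allones.
case: i gi => [|w [d|]] /= gi; rewrite ?big_split leq_add ?aux ?(cnt 0) //.
  by apply: cnt; case: gi.
by rewrite big1_eq.
Qed.

(** The harmless b is preferred. If omega is b just before level l, a lift of b would move earlier
    digits; then c is lifted, and the label records the danger. *)
Definition ins_letter l := if l is l'.+1 then (if om l' == y_b then y_c else y_b) else y_b.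

Definition ins_label l :=
  if l is l'.+1 then (if om l' == y_b then Some l.+1 else None) else None.

Definition ins_word l := pletters (lift_word om l [:: ins_letter l]).

Lemma wval_ins l : wval om (ins_word l) = lift_elt om l (ins_letter l).
Proof. exact: wval_pletters. Qed.

Lemma ins_neq l : (0 < l) ==> (ins_letter l != om l.-1).
Proof. by case: l => //= l; case: (om l =P y_b) => [->|/eqP] //; rewrite eq_sym. Qed.

Definition opt_word (b : bool) l := if b then ins_word l else [::].

Lemma ins_good b l : l < p -> good om p N (Op (opt_word b l) (ins_label l)).
Proof.
move=> lp; split; first by case: l lp => //= l lp; case: ifP.
move=> x szx x1 xN nd j pj; case: b => //=; rewrite wval_ins.
have lx : l < size x by rewrite szx; lia.
case lbl: (ins_label l) nd => [d|] nd.
  have dE : d = l.+1 by case: l lbl {lp nd lx} => //= l; case: ifP => // _ [].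
  rewrite {}dE in nd.
  have [|i lip xi] := @allonesPn p N pN l.+1 x _ nd; first by rewrite szx; lia.
  by apply: (@lift_safe om l _ (ins_neq l) x lx p.+1 i) => //; lia.
apply: (@lift_b_safe om l _ (ins_neq l) x lx p N) => //; last by rewrite lp.
by case: l lbl {lp nd lx} => //= l; case: ifP.
Qed.

(* The levels of L increase, and the deepest one comes first in the word. *)
Fixpoint uops (L : seq nat) (e : seq bool) : seq instr :=
  if L is l :: L' then
    uops L' (behead e) ++ [:: Op (opt_word (head false e) l) (ins_label l)]
  else [::].

Definition uword L e := pword (uops L e) [::].

Lemma nbits_uops L e : nbits (uops L e) = 0.
Proof. by elim: L e => //= l L IH e; rewrite nbits_cat IH. Qed.

Lemma uops_good L e : all (fun l => l < p) L -> goods om p N (uops L e).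
Proof.
elim: L e => //= l L IH e /andP[lp Lp]; apply/goods_cat; split; first exact: IH.
by split => //; apply: ins_good.
Qed.

Lemma uword_cons l L b e :
  uword (l :: L) (b :: e) = uword L e ++ opt_word b l.
Proof.
have := @pword_cat (uops L e) [:: Op (opt_word b l) (ins_label l)] [::] [::].
by rewrite nbits_uops /= cats0; apply.
Qed.

Lemma uword_low L e x i : all (fun l => i < l < size x) L -> size e = size L ->
  nth false (wval om (uword L e) x) i = nth false x i.
Proof.
elim: L e => [|l L IH] [|b e] //= /andP[/andP[il lx] Lx] [sz].
rewrite uword_cons wval_catE -(IH e) //; case: b => //=; rewrite wval_ins.
by rewrite lift_lt ?ins_neq ?size_ta.
Qed.

(** The lift at the first, shallowest level l comes last and the others leave digit l alone, so
    digit l of the result tells whether this lift is present, and it can be cancelled. *)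
Lemma uword_inj L x e e' : sorted ltn L -> all (fun l => l < size x) L ->
  size e = size L -> size e' = size L ->
  wval om (uword L e) x = wval om (uword L e') x -> e = e'.
Proof.
elim: L e e' => [|l L IH] [|b e] [|b' e'] //= sL /andP[lx Lx] [se] [se'].
have L1 : all (fun l' => l < l' < size x) L.
  have /allP lL := order_path_min ltn_trans sL.
  by apply/allP => l' l'L; rewrite (allP Lx) // andbT; apply: lL.
rewrite !uword_cons !wval_catE => E.
have bb : b = b'.
  move/(congr1 (fun z => nth false z l)): E.
  case: b; case: b' => //=; rewrite wval_ins lift_eq ?ins_neq ?size_ta //;
    rewrite !uword_low //; by case: nth.
by rewrite -bb in E *; congr (_ :: _); apply: IH (path_sorted sL) Lx se se' _;
  apply: tree_inj E.
Qed.

(** In the sum over all e, a labelled level brings at most 2 dangerous points for each value of its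
    own bit, and every shallower level doubles the count. *)
Fixpoint own (L : seq nat) : nat :=
  if L is l :: L' then 2 * own L' + (if ins_label l is Some _ then 4 else 0) else 0.

Lemma sum_uops L x : size x = p.+1 -> sorted ltn L -> all (fun l => l < p) L ->
  \sum_(e <- bits (size L)) dang (uops L e) [::] x <= own L.
Proof.
move=> sx; elim: L => [|l L IH] sL /= => [_|/andP[lp Lp]]; first by rewrite big_seq1.
have sL' := path_sorted sL.
have Lx : all (fun l => l < size x) L by rewrite sx; apply: sub_all Lp => k; lia.
have L1 : all (fun l' => l < l' < size x) L.
  have /allP lL := order_path_min ltn_trans sL.
  by apply/allP => l' l'L; rewrite (allP Lx) // andbT; apply: lL.
have -> : \sum_(e <- bits (size L).+1) dang (uops (l :: L) e) [::] x =
  \sum_(e <- bits (size L)) 2 * (dang (uops L e) [::] x +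
     danger p (ins_label l) (wval om (uword L e) x)).
  rewrite sum_bitsS; apply: eq_bigr => e _; rewrite mul2n -addnn.
  have E b : dang (uops L e ++ [:: Op (opt_word b l) (ins_label l)]) [::] x =
      dang (uops L e) [::] x + danger p (ins_label l) (wval om (uword L e) x).
    have := @dang_cat om p (uops L e) [:: Op (opt_word b l) (ins_label l)] [::] [::] x.
    by rewrite nbits_uops /= addn0; apply.
  have U b : uops (l :: L) (b :: e) =
    uops L e ++ [:: Op (opt_word b l) (ins_label l)] by [].
  by rewrite !U !E.
rewrite -big_distrr /= big_split /= mulnDr; apply: leq_add.
  by rewrite leq_mul2l IH.
case lbl : ins_label => [d|]; last by rewrite big1_eq.
have {lbl} -> : d = l.+1 by case: l lbl {lp sL L1} => //= l; case: ifP => // _ [].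
(* The points [f e] are distinct and agree with x up to level l; if their digits from l.+1 to p - 1
   are all 1, only digit p is free. *)
rewrite -[4]/(2 * 2) leq_mul2l /= -[leqLHS]big_mkcond sum1_count.
pose f e := wval om (uword L e) x.
rewrite -size_filter -[2]/(size [seq take l.+1 x ++ nseq (p - l.+1) true ++ [:: b] | b <- [:: false; true]]).
rewrite -(size_map f); apply: uniq_leq_size => [|_ /mapP[e + ->]].
  rewrite map_inj_in_uniq ?filter_uniq ?uniq_bits // => e e'.
  rewrite !mem_filter !mem_bits => /andP[_ /eqP se] /andP[_ /eqP se'].
  exact: uword_inj.
rewrite mem_filter mem_bits => /andP[ae /eqP se].
have sfe : size (f e) = p.+1 by rewrite size_ta.
rewrite (allonesE sfe lp ae) (_ : take l.+1 (f e) = take l.+1 x).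
  by apply/mapP; exists (nth false (f e) p) => //; case: nth.
apply: (@eq_from_nth _ false); first by rewrite !size_take sfe sx.
move=> i; rewrite size_take sfe ltnS lp => il; rewrite !nth_take //.
apply: uword_low => //; apply: sub_all L1 => k; lia.
Qed.

End Counting.

(** * Doubling construction of a program *)

Section Existence.
Variables (om : nat -> 'I_3) (p N : nat).
Hypotheses (omp : om p = y_b) (omN : om N = y_b) (pN : p < N).
Variables (h k Mc : nat) (top : nat -> nat).

(** The levels up to j spread a test point over 2^(j+1) points, which matches the 2^j slots of the
    program; the h levels from [top j] on carry no label and lower the proportion of failures by a
    further 2^h. *)
Definition levels j := iota 0 j.+1 ++ iota (top j) h.

Hypothesis top_gt : forall j, j < k -> j < top j.
Hypothesis top_le : forall j, j < k -> top j + h <= p.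
Hypothesis top_b : forall j l, j < k -> top j <= l < top j + h -> om l.-1 != y_b.
Hypothesis cost : forall j, j < k ->
  \sum_(l <- levels j) size (ins_word om l) <= 2 ^ j * Mc.

Lemma own_top j t n : j < k -> top j <= t -> t + n <= top j + h ->
  own om (iota t n) = 0.
Proof.
move=> jk; elim: n t => //= n IH t tt tn; rewrite IH; [|lia|lia].
case: t tt tn => // t tt tn /=; case: eqP => // bt.
have /negP[] : om t != y_b by apply: (@top_b j t.+1) => //; lia.
by rewrite bt.
Qed.

(** Adding 4 turns the recursion of [own] into a plain doubling. *)
Lemma own_cat L L' : own om (L ++ L') + 4 <= 2 ^ size L * (own om L' + 4).
Proof.
elim: L => [|l L IH] /=; first by rewrite expn0 mul1n.
rewrite expnS; case: ins_label => [_|]; nia.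
Qed.

Lemma own_levels j : j < k -> own om (levels j) <= 2 ^ j.+3.
Proof.
move=> jk; have := own_cat (iota 0 j.+1) (iota (top j) h).
rewrite -/(levels j) (@own_top j) // size_iota !expnS; lia.
Qed.

Lemma levels_sorted j : j < k -> sorted ltn (levels j).
Proof.
move=> jk; rewrite sorted_pairwise ?pairwise_cat; last exact: ltn_trans.
rewrite -!(sorted_pairwise ltn_trans) !iota_ltn_sorted !andbT.
by apply/allrelP => x y; rewrite !mem_iota => hx hy; have := top_gt jk; rewrite /=; lia.
Qed.

Lemma levels_lt j : j < k -> all (fun l => l < p) (levels j).
Proof.
move=> jk; have t1 := top_gt jk; have t2 := top_le jk.
by apply/allP => l; rewrite mem_cat !mem_iota; lia.
Qed.

Lemma size_levels j : size (levels j) = j.+1 + h.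
Proof. by rewrite size_cat !size_iota. Qed.

Lemma pcost_uops L e : pcost (uops om L e) <= \sum_(l <- L) size (ins_word om l).
Proof.
elim: L e => [|l L IH] e //=; rewrite big_cons pcost_cat addnC leq_add ?IH //=.
by rewrite addn0; case: (head false e).
Qed.

Lemma wsum_uops j e : j < k -> wsum (uops om (levels j) e) <= 2 ^ j.+3.
Proof.
move=> jk.
have H0 n t e1 : top j <= t -> t + n <= top j + h -> wsum (uops om (iota t n) e1) = 0.
  elim: n t e1 => //= n IH t e1 tt tn; rewrite wsum_cat IH ?addn0; [|lia|lia].
  case: t tt tn => //= t tt tn; case: eqP => // bt.
  have /negP[] : om t != y_b by apply: (@top_b j t.+1) => //; lia.
  by rewrite bt.
have H L n e' : wsum (uops om (iota n L ++ iota (top j) h) e') + 2 ^ n.+2 <= 2 ^ (n + L).+2.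
  elim: L n e' => [|L IH] n e' /=; first by rewrite H0 // addn0.
  rewrite wsum_cat /= addn0; have := IH n.+1 (behead e').
  have : label_size (ins_label om n) <= 2 ^ n.+2.
    by case: n {IH} => //= n; case: ifP.
  rewrite addSn addnS !expnS.
  lia.
have := H j.+1 0 e; rewrite add0n -/(levels j); lia.
Qed.

(** Q is replaced by Q u Q, where u is a product of lifts at [levels j]. A test point of the first
    copy enters the second one through u; over all u it takes distinct positions, on which the total
    danger of Q is at most [wsum Q]. Some u does as well as the average. *)
Lemma program j : j <= k -> exists Q, [/\ nbits Q = 2 ^ j, goods om p N Q,
  wsum Q <= 2 ^ j * (8 * j + 2), pcost Q <= 2 ^ j * (1 + j * Mc) &
  (\sum_(s <- bits (2 ^ j)) dtot om p Q s) * 2 ^ h <=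
    2 ^ (2 ^ j) * 2 ^ j * (2 * j ^ 2 + 4 * j)].
Proof.
elim: j => [_|j IH jk].
  exists [:: Bit]; split => //=.
  by rewrite !big_cons big_nil.
have [Q [nQ gQ wQ cQ dQ]] := IH (ltnW jk); set n := 2 ^ j in nQ wQ cQ dQ *.
set L := levels j; have sL := levels_sorted jk; have lL := levels_lt jk.
pose f e := \sum_(s1 <- bits n) \sum_(x <- ends om p Q s1) \sum_(s2 <- bits n)
  dang om p (uops om L e ++ Q) s2 x.
have [e se fe] : exists2 e, size e = size L &
    2 ^ size L * f e <= 2 ^ n * (n * (2 ^ n * (own om L + wsum Q))).
  apply: sum_bits_le; rewrite exchange_big -sum_bits_const big_seq [leqRHS]big_seq.
  apply: leq_sum => s1; rewrite mem_bits => /eqP s1n.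
  have cst c : n * c = \sum_(x <- ends om p Q s1) c.
    by rewrite big_const_seq count_predT size_ends iter_addn_0 nQ mulnC.
  rewrite exchange_big cst big_seq [leqRHS]big_seq.
  apply: leq_sum => x xQ.
  have sx : size x = p.+1 by apply/eqP/(allP (all_size_ends om p Q s1)).
  rewrite exchange_big -sum_bits_const big_seq [leqRHS]big_seq.
  apply: leq_sum => s2; rewrite mem_bits => /eqP s2n.
  have E e : dang om p (uops om L e ++ Q) s2 x =
      dang om p (uops om L e) [::] x + dang om p Q s2 (wval om (uword om L e) x).
    by have := @dang_cat om p (uops om L e) Q [::] s2 x; rewrite nbits_uops; apply.
  under eq_bigr do rewrite E.
  rewrite big_split leq_add //; first exact: (sum_uops om pN sx sL lL).
  rewrite -(big_map (fun e => wval om (uword om L e) x) xpredT (dang om p Q s2)).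
  apply: (sum_dang pN) => //.
    rewrite map_inj_in_uniq ?uniq_bits // => e e'; rewrite !mem_bits => /eqP se /eqP se'.
    apply: uword_inj => //; rewrite sx; apply: sub_all lL => l; lia.
  by apply/allP => _ /mapP[e _ ->]; rewrite size_ta sx.
exists (Q ++ (uops om L e ++ Q)); split.
- by rewrite nbits_cat (nbits_cat (uops om L e)) nbits_uops nQ expnS mul2n -addnn.
- by apply/goods_cat; split=> //; apply/goods_cat; split=> //; apply: uops_good.
- rewrite wsum_cat (wsum_cat (uops om L e)); have := wsum_uops e jk.
  rewrite !expnS -/n -/L; nia.
- rewrite pcost_cat (pcost_cat (uops om L e)) expnS -/n; have := leq_trans (pcost_uops L e) (cost jk).
  rewrite -/n; nia.
have -> : 2 ^ j.+1 = n + n by rewrite expnS -/n; lia.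
have -> : \sum_(s <- bits (n + n)) dtot om p (Q ++ uops om L e ++ Q) s =
    2 * (2 ^ n * \sum_(s <- bits n) dtot om p Q s) + f e.
  rewrite sum_bitsD /f.
  transitivity (\sum_(s1 <- bits n) \sum_(s2 <- bits n) (dtot om p Q s1 +
    (\sum_(x <- ends om p Q s1) dang om p (uops om L e ++ Q) s2 x + dtot om p Q s2))).
    rewrite big_seq [RHS]big_seq; apply: eq_bigr => s1; rewrite mem_bits => /eqP s1n.
    apply: eq_bigr => s2 _; rewrite (dtot_cat _ pN) ?nQ // -addnA; congr (_ + (_ + _)).
    have := @dtot_cat om p N pN (uops om L e) Q [::] s2.
    rewrite nbits_uops => -> //; rewrite dtot_op ?nbits_uops //.
    have : size (ends om p (uops om L e) [::]) = 0 by rewrite size_ends nbits_uops.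
    by move/size0nil => ->; rewrite big_nil.
  under eq_bigr do rewrite big_split sum_bits_const big_split /= exchange_big /=.
  by rewrite big_split big_split /= sum_bits_const -big_distrr /=; lia.
have szL : 2 ^ size L = 2 * n * 2 ^ h by rewrite size_levels expnD expnS.
have ow : own om L <= 8 * n by have := own_levels jk; rewrite !expnS -/n -/L; lia.
have n0 : 0 < n by rewrite expn_gt0.
have {}fe : 2 ^ h * f e <= 2 ^ n * 2 ^ n * n * (4 * j + 5).
  have wow : own om L + wsum Q <= n * (8 * j + 10) by nia.
  have := leq_trans fe (leq_mul (leqnn _) (leq_mul (leqnn _) (leq_mul (leqnn _) wow))).
  rewrite szL; move: (2 ^ h) (2 ^ n) (f e) => H M fe'.
  have -> : 2 * n * H * fe' = 2 * n * (H * fe') by rewrite !mulnA.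
  have -> : M * (n * (M * (n * (8 * j + 10)))) = 2 * n * (M * M * n * (4 * j + 5)).
    by ring.
  by rewrite leq_pmul2l // muln_gt0.
have := leq_mul (leqnn (2 * 2 ^ n)) dQ.
rewrite mulnDl expnD.
move: (2 ^ h) (2 ^ n) (f e) fe (\sum_(s <- _) _) => H M g fg D hD.
(* The step from j to j + 1 in the quadratic leaves room for 8 j + 12, while 4 j + 5 is needed. *)
have -> : M * M * (n + n) * (2 * j.+1 ^ 2 + 4 * j.+1) =
    2 * M * (M * n * (2 * j ^ 2 + 4 * j)) + M * M * n * (8 * j + 12).
  by rewrite !expnS expn0 -addn1; ring.
have -> : 2 * (M * D) * H = 2 * M * (D * H) by ring.
rewrite leq_add // [g * H]mulnC (leq_trans fg) // leq_mul2l; apply/orP; right; lia.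
Qed.

End Existence.

Lemma count_sparse n c : count (fun e => count id e <= c) (bits n) <= n.+1 ^ c.
Proof.
elim: n c => [|n IH] c; first by rewrite /= exp1n.
rewrite [bits _]/= count_cat !count_map /=.
case: c => [|c].
  rewrite [X in _ + X](@eq_count _ _ pred0) ?count_pred0 ?addn0 //.
  by apply: leq_trans (IH 0) _; rewrite !expn0.
have le c' : n.+1 ^ c' <= n.+2 ^ c'.
  by case: c' => // c'; rewrite leq_exp2r.
apply: leq_trans (leq_add (IH c.+1) (IH c)) _.
rewrite -[X in _ ^ _ + X]mul1n expnS -mulnDl addn1 expnS leq_mul2l /=.
exact: le.
Qed.

Section Many.
Variables (om : nat -> 'I_3) (p N : nat).
Hypotheses (omN : om N = y_b) (pN : p < N).

(** A choice of bits is determined by its element and its error pattern, and [count_sparse] bounds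
    the number of patterns with at most c errors. *)
Lemma many_elements n c h D Q : nbits Q = n -> goods om p N Q ->
  (\sum_(s <- bits n) dtot om p Q s) * 2 ^ h <= D ->
  2 * D <= 2 ^ n * (2 ^ h * c) ->
  exists Us : seq treeAut, [/\ uniq Us,
    forall g, g \in Us -> exists2 w, size w <= pcost Q & g = wval om w &
    2 ^ n <= 2 * (size Us * n.+1 ^ c)].
Proof.
move=> nQ gQ dQ Dc.
have mk : 2 ^ n <= 2 * count (fun s => dtot om p Q s <= c) (bits n).
  apply: (markov_bits (leqnn _)).
  rewrite -(leq_pmul2r (expn_gt0 2 h : 0 < 2 ^ h)); nia.
pose G := [seq s <- bits n | dtot om p Q s <= c].
pose W s := wval om (pword Q s).
exists (undup [seq W s | s <- G]); split; first exact: undup_uniq.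
  move=> g; rewrite mem_undup => /mapP[s _ ->].
  by exists (pword Q s); rewrite ?size_pword.
apply: leq_trans mk _; rewrite leq_mul2l /= -size_filter -/G.
pose E := [seq e <- bits n | count id e <= c].
apply: (@leq_trans (size (undup [seq W s | s <- G]) * size E)); last first.
  by rewrite leq_mul2l size_filter count_sparse orbT.
rewrite -(size_allpairs pair) -(size_map (fun s => (W s, errs om N Q s)) G).
apply: uniq_leq_size => [|_ /mapP[s sG ->]].
  rewrite map_inj_in_uniq ?filter_uniq ?uniq_bits // => s s'.
  rewrite !mem_filter !mem_bits => /andP[_ /eqP sn] /andP[_ /eqP sn'] [].
  by apply: errs_inj; rewrite nQ.
apply: allpairs_f.
  by rewrite mem_undup; apply: map_f.
rewrite mem_filter mem_bits size_errs nQ eqxx andbT.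
apply: leq_trans (count_errs omN pN s gQ) _.
by move: sG; rewrite mem_filter => /andP[].
Qed.

End Many.

Section GrowthLowerBound.
Variables (om : nat -> 'I_3) (F : finGroupType).
Local Open Scope group_scope.

Definition grig_y (y : 'I_3) : grig om :=
  if y == y_b then grig_b om else if y == y_c then grig_c om else grig_d om.

Lemma val_grig_y y : val (grig_y y) = tree_y y om.
Proof. by case: y => -[|[|[|//]]] hy; rewrite (bool_irrelevance hy isT). Qed.

Definition gam_letter (l : option 'I_3) : Gamma om F :=
  if l is Some y then Gamma_phi 1 (grig_y y) else Gamma_a om F.

Definition gam_word (w : seq (option 'I_3)) : Gamma om F :=
  \big[*%g/1]_(l <- w) gam_letter l.

Lemma wtop_gam_word w : val (wtop (gam_word w)) = wval om w.
Proof.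
rewrite /gam_word; elim: w => [|l w IH]; first by rewrite big_nil.
rewrite big_cons -[wtop _]/(wtop (gam_letter l) * wtop (\big[*%g/1]_(j <- w) gam_letter j)).
by rewrite valM IH; case: l => // y; rewrite [val _]val_grig_y.
Qed.

Lemma gam_letter_gen l : @Gamma_gens om F (gam_letter l).
Proof.
case: l => [y|]; last by left.
right; exists 1, (grig_y y); split=> //; rewrite /grig_y.
by case: eqP => _; [left; left; right | case: eqP => _; [left; right | right]].
Qed.

Lemma growth_ge (Us : seq treeAut) r : uniq Us ->
  (forall g, g \in Us -> exists2 w, (size w <= r)%N & g = wval om w) ->
  (size Us <= Gamma_growth om F r)%N.
Proof.
move=> uU UsP; have [ws wsU wsr] : exists2 ws, map (wval om) ws = Us &
    all (fun w => (size w <= r)%N) ws.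
  elim: Us {uU} UsP => [|g Us IH] UsP; first by exists [::].
  have [|ws wsU wsr] := IH; first by move=> g' gU; apply: UsP; rewrite inE gU orbT.
  have [w wr ->] := UsP g (mem_head _ _).
  by exists (w :: ws); rewrite /= ?wsU ?wr.
have uG : uniq (map gam_word ws).
  apply: (@map_uniq _ _ (fun g : Gamma om F => val (wtop g))).
  by rewrite -map_comp (eq_map wtop_gam_word) wsU.
rewrite -wsU size_map -(size_map gam_word) /Gamma_growth /word_growth.
have <- : #|` [fset g in map gam_word ws]%fset| = size (map gam_word ws).
  by rewrite card_fseq undup_id.
apply/fsubset_leq_card/fsubsetP => g gi.
have /mapP[w ww ->] : g \in map gam_word ws by move: gi; rewrite inE.
rewrite in_fset_set; last first.
  exact/word_ball_finite/Gamma_gens_finite.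
rewrite inE; exists (map gam_letter w); split.
- by rewrite size_map (allP wsr).
- by move=> _ /mapP[l _ ->]; left; apply: gam_letter_gen.
- by rewrite big_map.
Qed.

End GrowthLowerBound.

(** * Words along the blocks of omega *)

Definition rotates (c : nat -> bool) (om : nat -> 'I_3) :=
  forall i, om i.+1 = if c i then ordS (om i) else om i.

Section Weights.
Import Order.TTheory GRing.Theory Num.Theory.
Local Open Scope ring_scope.
Variables (R : realFieldType) (eta : R).
Hypotheses (eta0 : 0 < eta) (etaE : eta ^+ 3 + eta ^+ 2 + eta = 2).

Lemma eta_lt1 : eta < 1.
Proof.
rewrite ltNge; apply/negP => h; have := etaE; rewrite !exprS expr0 mulr1; nra.
Qed.

Lemma eta_gt : 4 / 5 < eta.
Proof.
rewrite ltNge; apply/negP => h; have := etaE; rewrite !exprS expr0 mulr1.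
have h2 : eta * eta <= 4 / 5 * (4 / 5) by apply: ler_pM => //; apply: ltW.
have h3 : eta * (eta * eta) <= 4 / 5 * (4 / 5 * (4 / 5)).
  by apply: ler_pM => //; rewrite ?mulr_ge0 // ltW.
lra.
Qed.

(* The weight of a y, for a letter y that becomes trivial now, after one
   rotation, or after two rotations of the phase x. *)
Definition wrot (x y : 'I_3) : R :=
  if y == x then eta ^+ 2 else if y == ordS x then eta else 1.

(** An eigenvector of the substitution for constant omega, with eigenvalue 2: the phase letter gives
    1 + 2 + 1, any other letter 1 + 1. *)
Definition wstat (x y : 'I_3) : R := if y == x then 2 else 1.

Definition wpair (b : bool) x y := if b then wrot x y else wstat x y.

Lemma wpair_ge b x y : eta ^+ 2 <= wpair b x y.
Proof.
have e1 := eta_lt1; have e2 : eta ^+ 2 <= eta by rewrite expr2 ger_pMr // ltW.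
rewrite /wpair /wrot /wstat.
by case: b; case: ifP => // _; try case: ifP => _; lra.
Qed.

Lemma wpair_le b x y : wpair b x y <= 2.
Proof.
have e1 := eta_lt1; have e2 : eta ^+ 2 <= eta by rewrite expr2 ger_pMr // ltW.
rewrite /wpair /wrot /wstat.
by case: b; case: ifP => // _; try case: ifP => _; lra.
Qed.

(** The value 8, just before rotations resume, pays for the passage from [wstat] to [wrot]; this
    happens once per block. *)
Definition mu (c : nat -> bool) i : R :=
  if c i then 2 / eta else if c i.+1 then 8 else 2.

(** As long as omega rotates this is an equality: x, x+1, x+2 give eta + 1 + eta^2 = 2 / eta, 2 eta
    and 2, while their weights for the next phase are 1, eta^2 and eta. *)
Lemma wpair_zeta (c : nat -> bool) om y : rotates c om ->
  \sum_(v <- zeta1 (om 0%N) y) wpair (c 0%N) (om 0%N) v <=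
    mu c 0 * wpair (c 1%N) (om 1%N) y.
Proof.
move=> rot; have e1 := eta_lt1; have e2 := eta_gt.
have ee : eta^-1 * eta = 1 by rewrite mulVf ?gt_eqF.
have E : 2 / eta = eta ^+ 2 + eta + 1.
  by apply: (@mulIf _ eta); rewrite ?gt_eqF // mulfVK ?gt_eqF // -etaE; ring.
have := rot 0%N; rewrite /mu; move: (om 0%N) (om 1%N) => x x' ->.
rewrite E /zeta1 /wpair /wrot /wstat.
have etaE' : eta * eta * eta + eta * eta + eta = 2 by rewrite -etaE; ring.
case: (c 0%N); case: (c 1%N); elim/ord3P: x / y => x;
  rewrite ?eqxx ?ordS3_neq ?ordS3K ?eqxx ?ordS3_neq;
  rewrite !big_cons big_nil ?eqxx ?ordS3_neq ?ordS3K ?eqxx ?ordS3_neq; nra.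
Qed.

Lemma wpair_lift c om l y : rotates c om ->
  \sum_(v <- lift_word om l [:: y]) wpair (c 0%N) (om 0%N) v <=
    (\prod_(i < l) mu c i) * wpair (c l) (om l) y.
Proof.
elim: l c om => [|l IH] c om rot; first by rewrite big_seq1 big_ord0 mul1r.
have rot' : rotates (fun i => c i.+1) (om_shift om) by move=> i; apply: rot.
have mu0 c' i : 0 <= mu c' i.
  rewrite /mu; case: ifP => _; last by case: ifP.
  by rewrite divr_ge0 // ltW.
apply: (@le_trans _ _ (mu c 0 * \sum_(v <- lift_word (om_shift om) l [:: y])
    wpair (c 1%N) (om 1%N) v)).
  rewrite /= /zeta big_flatten /= big_map mulr_sumr; apply: ler_sum => v _.
  exact: wpair_zeta.
rewrite big_ord_recl -mulrA; apply: ler_wpM2l => //.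
exact: IH rot'.
Qed.

(** The constant combines the two letters of each pair a y with the extreme weights 2 and eta^2. *)
Lemma size_ins_word c om l : rotates c om ->
  (size (ins_word om l))%:R <= 4 / eta ^+ 2 * \prod_(i < l) mu c i.
Proof.
move=> rot; have e20 : 0 < eta ^+ 2 by rewrite exprn_gt0.
have mu0 : 0 <= \prod_(i < l) mu c i.
  apply: prodr_ge0 => i _; rewrite /mu; case: ifP => _; last by case: ifP.
  by rewrite divr_ge0 // ltW.
rewrite size_pletters mulrAC ler_pdivlMr // natrM -mulrA.
set w := lift_word _ _ _.
have : (size w)%:R * eta ^+ 2 <= \sum_(v <- w) wpair (c 0%N) (om 0%N) v.
  rewrite -sum1_size natr_sum mulr_suml; apply: ler_sum => v _.
  by rewrite mul1r wpair_ge.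
move/le_trans/(_ (wpair_lift _ _ rot)) => h.
have := le_trans h (ler_wpM2l mu0 (wpair_le _ _ _)); lra.
Qed.

End Weights.

Section Blocks.

(* The i-th block occupies the levels from [bstart i] to [bstart i.+1]; it
   consists of (012)^(p i) followed by more than i zeros. *)
Definition bstart i := i * i.+1 ^ 2.

Arguments bstart : simpl never.

Lemma bstartS i : bstart i.+1 = bstart i + (3 * i.+1 ^ 2 + i.+1).
Proof. by rewrite /bstart !expnS !expn0; ring. Qed.

Lemma bstart_mono i j : i < j -> bstart i < bstart j.
Proof.
elim: j => // j IH; rewrite ltnS leq_eqVlt => /predU1P[->|/IH lt]; rewrite bstartS; lia.
Qed.

Lemma bstart_le i j : i <= j -> bstart i <= bstart j.
Proof. by rewrite leq_eqVlt => /predU1P[->//|/bstart_mono/ltnW]. Qed.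

Definition bidx l := find (fun i => l < bstart i.+1) (iota 0 l.+1).

Lemma bidxP l : bstart (bidx l) <= l < bstart (bidx l).+1.
Proof.
have h : has (fun i => l < bstart i.+1) (iota 0 l.+1).
  apply/hasP; exists l; first by rewrite mem_iota /= add0n.
  by rewrite /bstart !expnS expn0; nia.
have ls : bidx l < l.+1 by move: h; rewrite has_find size_iota.
apply/andP; split; last by have := nth_find 0 h; rewrite nth_iota.
case E : (bidx l) => [|b]; first by [].
have := @before_find _ 0 (fun i => l < bstart i.+1) (iota 0 l.+1) b.
rewrite -/(bidx l) E ltnSn nth_iota ?add0n; last by lia.
by move=> /(_ isT); rewrite ltnNge => /negbFE.
Qed.

Lemma bidx_eq i l : bstart i <= l < bstart i.+1 -> bidx l = i.
Proof.
move=> /andP[h1 h2]; have /andP[h3 h4] := bidxP l.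
have [lt|lt|//] := ltngtP (bidx l) i.
- have := bstart_le lt; lia.
- have := bstart_le lt; lia.
Qed.

Variable p : nat -> nat.
Hypothesis p_gt0 : forall i, 0 < p i.
Hypothesis p_le : forall i, p i <= i.+1 ^ 2.

Definition boff l := l - bstart (bidx l).

Definition brot l := boff l < 3 * p (bidx l).

Definition bom l : 'I_3 :=
  if brot l then Ordinal (ltn_pmod (boff l) (isT : 0 < 3)) else y_d.

(** Both junctions fit: the periods 012 end with 2, whose successor is 0, and the zeros are followed
    by the initial 0 of the next block. *)
Lemma bom_rotates : rotates brot bom.
Proof.
move=> l; have /andP[h1 h2] := bidxP l.
have pl := p_le (bidx l); have := bstartS (bidx l) => bS.
have [h3|h3] := ltnP l.+1 (bstart (bidx l).+1).
  have E : bidx l.+1 = bidx l by apply: bidx_eq; lia.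
  have oE : boff l.+1 = (boff l).+1 by rewrite /boff E; lia.
  rewrite /bom /brot oE E; apply: val_inj.
  case: (ltnP (boff l) (3 * p (bidx l))) => h4; case: ltnP => //= h5; lia.
have lE : l.+1 = bstart (bidx l).+1 by lia.
have E : bidx l.+1 = (bidx l).+1 by apply: bidx_eq; rewrite lE leqnn bstart_mono.
have o0 : boff l.+1 = 0 by rewrite /boff E lE subnn.
have -> : brot l = false by rewrite /brot /boff; lia.
have -> : bom l = y_d by rewrite /bom /brot /boff; case: ltnP => //; lia.
by rewrite /bom o0; case: ifP => // _; apply: val_inj.
Qed.

(** Provides the levels p and N of the programs. *)
Lemma bom_two i : bom (bstart i + 2) = y_b.
Proof.
have bE : bidx (bstart i + 2) = i by apply: bidx_eq; rewrite bstartS; lia.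
have oE : boff (bstart i + 2) = 2 by rewrite /boff bE; lia.
rewrite /bom /brot oE bE; case: ifP; first by move=> _; apply: val_inj.
by have := p_gt0 i; lia.
Qed.

Lemma bom_zero i l : bstart i.+1 <= l + i.+1 -> l < bstart i.+1 -> bom l = y_d.
Proof.
rewrite bstartS => h1 h2; have pl := p_le i.
have bE : bidx l = i by apply: bidx_eq; rewrite bstartS; lia.
by rewrite /bom /brot /boff bE; case: ltnP => //; lia.
Qed.

Definition rots i := \sum_(j < i) 3 * p j.

Section RealMu.
Import Order.TTheory GRing.Theory Num.Theory.
Local Open Scope ring_scope.
Variables (R : realFieldType) (eta : R).
Hypotheses (eta0 : 0 < eta) (etaE : eta ^+ 3 + eta ^+ 2 + eta = 2).

Lemma brotE i t : (t < 3 * i.+1 ^ 2 + i.+1)%N -> brot (bstart i + t) = (t < 3 * p i)%N.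
Proof.
move=> ti; have bE : bidx (bstart i + t) = i.
  by apply: bidx_eq; rewrite bstartS; lia.
by rewrite /brot /boff bE addKn.
Qed.

Lemma prod_mu_block i t : (t < 3 * i.+1 ^ 2 + i.+1)%N ->
  \prod_(j < t) mu eta brot (bstart i + j) = 2 ^+ t * eta^-1 ^+ minn t (3 * p i).
Proof.
have pl := p_le i; elim: t => [|t IH] ti; first by rewrite big_ord0 min0n mulr1.
rewrite big_ord_recr /= IH; last by lia.
rewrite /mu -addnS !brotE; [|lia|lia].
have [h1|h1] := ltnP t (3 * p i).
  rewrite (minn_idPl h1).
  by rewrite !exprSr; ring.
have -> : (t.+1 < 3 * p i)%N = false by lia.
rewrite (minn_idPr (leqW h1)).
by rewrite !exprSr; ring.
Qed.

Lemma prod_mu i : \prod_(j < bstart i) mu eta brot j =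
  2 ^+ (bstart i + 2 * i) * eta^-1 ^+ rots i.
Proof.
elim: i => [|i IH]; first by rewrite big_ord0 /rots big_ord0 mulr1.
have pl := p_le i; have [t tE] : exists t, (t = 3 * i.+1 ^ 2 + i)%N by eexists.
have bE : bstart i.+1 = (bstart i + t.+1)%N by rewrite bstartS; lia.
rewrite bE big_split_ord /= IH /rots [in RHS]big_ord_recr /= -/(rots i).
rewrite big_ord_recr /= (@prod_mu_block i t); last by lia.
rewrite /mu brotE; last by lia.
have -> : (t < 3 * p i)%N = false by lia.
rewrite (_ : (bstart i + t).+1 = bstart i.+1 + 0)%N; last by lia.
rewrite brotE; last by lia.
rewrite muln_gt0 p_gt0 /=.
rewrite (_ : minn t (3 * p i) = 3 * p i)%N; last by lia.
rewrite (_ : bstart i + t.+1 + 2 * i.+1 = (bstart i + 2 * i) + (t + 3))%N; last by lia.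
by rewrite !exprD; ring.
Qed.

End RealMu.

End Blocks.

Definition blen i := 3 * i.+1 ^ 2 + i.+1.

Lemma blen_mono i j : i <= j -> blen i <= blen j.
Proof. by move=> ij; rewrite /blen !expnS !expn0; nia. Qed.

Lemma bstart_le_pow i : bstart i <= 2 ^ (3 * i.+1).
Proof.
have := ltn_expl i.+1 (isT : 1 < 2); move: (2 ^ i.+1) (expnM 2 i.+1 3) => t.
rewrite mulnC => ->; rewrite /bstart !expnS !expn0 => it.
by have : i.+1 * (i.+1 * i.+1) <= t * (t * t); [rewrite !leq_mul // ltnW | nia].
Qed.

Lemma blen_ge i : 6 + (3 * i.+1 + 3 * i.+1) <= 12 * blen i - 2 * i.+1.
Proof. by rewrite /blen; nia. Qed.

(** There are at most 2^(n/4) error patterns, and Markov's inequality costs a factor 2; as n >= 4,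
    at least 2^(n/2) elements remain. *)
Lemma half_count k c s (n := 2 ^ k) : 0 < k -> 4 <= n -> 4 * k.+1 * c <= n ->
  2 ^ n <= 2 * (s * n.+1 ^ c) -> 2 ^ (2 ^ k.-1) <= s.
Proof.
move=> k0 n4 cn big; have n0 : 0 < n by rewrite expn_gt0.
have kc : n.+1 ^ c <= 2 ^ (k.+1 * c).
  by rewrite expnM; case: (c) => // c'; rewrite leq_exp2r // expnS -/n; lia.
have e4 : 2 ^ (k.+1 * c) <= 2 ^ (n %/ 4).
  by rewrite leq_exp2l // leq_divRL // mulnC mulnA.
have nE : n = 2 * 2 ^ k.-1 by rewrite -expnS prednK.
have -> : 2 ^ k.-1 = n %/ 2 by rewrite nE mulKn.
have := leq_trans big (leq_mul (leqnn 2) (leq_mul (leqnn _) (leq_trans kc e4))).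
have -> : 2 ^ n = 2 ^ (n %/ 2) * 2 ^ (n - n %/ 2 - n %/ 4) * 2 ^ (n %/ 4).
  rewrite -!expnD; congr (2 ^ _); clearbody n; move: n4; tidy; lia.
rewrite [2 * _]mulnA leq_pmul2r ?expn_gt0 //.
have : 2 ^ 1 <= 2 ^ (n - n %/ 2 - n %/ 4).
  rewrite leq_exp2l //; clearbody n; move: n4; tidy; lia.
move: (2 ^ (n %/ 2)) (2 ^ (n - _ - _)); tidy; nia.
Qed.

Section LowerBound.
Import Order.TTheory GRing.Theory Num.Theory.
Variables (R : archiRealFieldType) (eta : R).
Hypotheses (eta0 : (0 < eta)%R) (etaE : (eta ^+ 3 + eta ^+ 2 + eta = 2)%R).
Variables (p : nat -> nat) (F : finGroupType).
Hypothesis p_gt0 : forall i, 0 < p i.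
Hypothesis p_le : forall i, p i <= i.+1 ^ 2.
Variables (i h : nat).
Hypothesis hi : h <= i.
Local Notation k := (bstart i).
Hypothesis kh : 32 * (k * (k.+1 * k.+2)) <= 2 ^ h.

(** The block must come after that of j and end with more than h zeros: the letter lifted at l
    depends on omega at l - 1, so h levels need one zero before them. *)
Definition topblock j := maxn (bidx j).+1 h.
Definition toplevel j := bstart (topblock j).+1 - h.

Lemma bidx_lt j : j < k -> bidx j < i.
Proof.
have /andP[h1 _] := bidxP j; move=> jk; rewrite ltnNge; apply/negP => h2.
have := bstart_le h2; lia.
Qed.

Lemma topblock_le j : j < k -> topblock j <= i.
Proof. by move/bidx_lt; rewrite /topblock; lia. Qed.

Lemma toplevelE j : toplevel j + h = bstart (topblock j).+1 /\
  bstart (topblock j) < toplevel j.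
Proof.
have : h <= topblock j by rewrite leq_maxr.
rewrite /toplevel bstartS; lia.
Qed.

Lemma toplevel_gt j : j < toplevel j.
Proof.
have /andP[_ h1] := bidxP j; have [_ h2] := toplevelE j.
have : bstart (bidx j).+1 <= bstart (topblock j) by rewrite bstart_le // leq_maxl.
lia.
Qed.

Lemma toplevel_zero j l : toplevel j <= l < toplevel j + h -> bom p l.-1 != y_b.
Proof.
have [h1 h2] := toplevelE j => hl; rewrite (@bom_zero p p_le (topblock j)) //.
  have : h <= topblock j by rewrite leq_maxr.
  lia.
lia.
Qed.

Lemma bstart_top j : j < k -> bstart (topblock j).+1 <= j + 2 * blen i + bstart h.+1.
Proof.
move=> jk; have bi := bidx_lt jk; have /andP[h1 _] := bidxP j.
have [le|le] := leqP (bidx j).+1 h; last first.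
  rewrite /topblock (maxn_idPl (ltnW le)) !bstartS -/(blen (bidx j)) -/(blen (bidx j).+1).
  have := @blen_mono (bidx j) i; have := @blen_mono (bidx j).+1 i; lia.
rewrite /topblock (maxn_idPr le); lia.
Qed.

Lemma levels_lt_top j l : l \in levels h toplevel j -> l < bstart (topblock j).+1.
Proof.
have [h1 h2] := toplevelE j; have h3 := toplevel_gt j.
by rewrite mem_cat !mem_iota; lia.
Qed.

Section Cost.
Local Open Scope ring_scope.

Lemma mu_ge1 c j : 1 <= mu eta c j.
Proof.
have e1 := eta_lt1 etaE; rewrite /mu; case: ifP => _.
  by rewrite ler_pdivlMr //; lra.
by case: ifP => _; lra.
Qed.

Lemma prod_mu_le c m n : (m <= n)%N ->
  \prod_(j < m) mu eta c j <= \prod_(j < n) mu eta c j.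
Proof.
move=> mn; rewrite -(subnKC mn) big_split_ord /= ler_peMr //.
  by apply: prodr_ge0 => j _; apply: le_trans (mu_ge1 _ _).
elim: (n - m)%N => [|d IH]; first by rewrite big_ord0.
by rewrite big_ord_recr /= mulr_ege1 // mu_ge1.
Qed.

Lemma etaV_ge1 : 1 <= eta^-1.
Proof. by rewrite invf_ge1 // ltW // (eta_lt1 etaE). Qed.

Lemma etaV_le2 : eta^-1 <= 2.
Proof.
have := eta_gt eta0 etaE => e2; rewrite -[2]invrK lef_pV2 ?posrE ?invr_gt0 //; lra.
Qed.

Lemma rots_mono m n : (m <= n)%N -> (rots p m <= rots p n)%N.
Proof.
by move=> mn; rewrite /rots -(subnKC mn) big_split_ord leq_addr.
Qed.

Definition cst : R :=
  16 * k%:R * 2 ^+ (3 * blen i + bstart h.+1 + 2 * i.+1) * eta^-1 ^+ rots p i.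

Lemma cost_levels j : (j < k)%N ->
  (\sum_(l <- levels h toplevel j) size (ins_word (bom p) l))%:R <= 2 ^+ j * cst.
Proof.
move=> jk; set x := topblock j.
have e2 := eta_gt eta0 etaE; have e1 := eta_lt1 etaE.
have [v1 v2] := (etaV_ge1, etaV_le2).
(* Beyond the rotations of the first i blocks at most those of block i occur; as 1 / eta <= 2, they
   are absorbed by 2 ^+ blen i. *)
have Kx : \prod_(l < bstart x.+1) mu eta (brot p) l <=
    2 ^+ (j + 2 * blen i + bstart h.+1 + 2 * i.+1) * (2 ^+ blen i * eta^-1 ^+ rots p i).
  rewrite prod_mu //; apply: ler_pM; rewrite ?exprn_ge0 ?invr_ge0 ?(ltW eta0) //.
     rewrite ler_weXn2l ?ler1n //.
    have := bstart_top jk; have := topblock_le jk; rewrite -/x; lia.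
  apply: (@le_trans _ _ (eta^-1 ^+ rots p i.+1)).
    by rewrite ler_weXn2l // rots_mono // ltnS topblock_le.
  rewrite /rots big_ord_recr /= exprD mulrC ler_wpM2r ?exprn_ge0 ?invr_ge0 ?(ltW eta0) //.
  apply: (@le_trans _ _ (2 ^+ (3 * p i))).
    by rewrite lerXn2r ?nnegrE ?invr_ge0 ?(ltW eta0).
  by rewrite ler_weXn2l ?ler1n // /blen; have := p_le i; lia.
have e4 : 4 / eta ^+ 2 <= 8.
  by rewrite ler_pdivrMr ?exprn_gt0 //; nra.
rewrite natr_sum.
apply: (@le_trans _ _ (\sum_(l <- levels h toplevel j)
   8 * (2 ^+ (j + 2 * blen i + bstart h.+1 + 2 * i.+1) * (2 ^+ blen i * eta^-1 ^+ rots p i)))).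
  rewrite big_seq [leRHS]big_seq; apply: ler_sum => l /levels_lt_top ll.
  apply: le_trans (size_ins_word eta0 etaE l (bom_rotates p_le)) _.
  apply: ler_pM => //.
  - by rewrite divr_ge0 ?exprn_ge0 // ltW.
  - by apply: prodr_ge0 => t _; apply: le_trans (mu_ge1 _ _).
  - by apply: le_trans Kx; apply/prod_mu_le/ltnW.
rewrite big_const_seq count_predT size_levels iter_addr_0 -[leLHS]mulr_natr.
rewrite /cst (_ : j + 2 * blen i + bstart h.+1 + 2 * i.+1 =
  j + (2 * blen i + bstart h.+1 + 2 * i.+1))%N; last by lia.
rewrite (_ : 3 * blen i + bstart h.+1 + 2 * i.+1 =
  blen i + (2 * blen i + bstart h.+1 + 2 * i.+1))%N; last by lia.
rewrite !(exprD _ j) !(exprD _ (blen i)).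
set X := 2 ^+ (2 * _ + _ + _); set Y := 2 ^+ j; set Z := 2 ^+ blen i; set E := eta^-1 ^+ _.
have -> : 8 * (Y * X * (Z * E)) * (j.+1 + h)%:R = (Y * X * Z * E * 8) * (j.+1 + h)%:R by ring.
have -> : Y * (16 * k%:R * (Z * X) * E) = (Y * X * Z * E * 8) * (2 * k)%:R.
  by rewrite natrM; ring.
rewrite ler_wpM2l //; last first.
  rewrite ler_nat; have : (i <= k)%N by rewrite /bstart !expnS expn0; nia.
  lia.
by rewrite !mulr_ge0 ?exprn_ge0 ?invr_ge0 // ltW.
Qed.

End Cost.

Lemma lower_growth r :
  (2 ^+ (k + 15 * blen i + bstart h.+1) * eta^-1 ^+ rots p i <= r%:R)%R -> 0 < i ->
  2 ^ (2 ^ k.-1) <= Gamma_growth (bom p) F r.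
Proof.
move=> rbig i0; have ik : i < k by rewrite /bstart ltn_Pmulr // -(exp1n 2) ltn_exp2r.
pose Mc := (Num.truncn cst).+1.
have [v1 v2] := (etaV_ge1, etaV_le2).
have cst1 : (1 <= cst)%R.
  rewrite /cst !mulr_ege1 ?exprn_ege1 //; try by rewrite ler1n.
  by rewrite ler1n; lia.
have cst0 : (0 <= cst)%R by apply: le_trans cst1.
have McP : (cst <= Mc%:R)%R by rewrite ltW // truncnS_gt.
have McP2 : (Mc%:R <= 2 * cst)%R.
  have : ((Num.truncn cst)%:R <= cst)%R by rewrite truncn_le.
  rewrite /Mc -natr1; lra.
(* All lifts take place before block i.+1; the bits are read in the next two blocks, at their third
   levels, where omega is b. *)
set pp := bstart i.+1 + 2; set N := bstart i.+2 + 2.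
have pN : pp < N by rewrite ltn_add2r bstart_mono.
have omp : bom p pp = y_b := bom_two p_gt0 i.+1.
have omN : bom p N = y_b := bom_two p_gt0 i.+2.
have tle j : j < k -> toplevel j + h <= pp.
  move=> jk; have [-> _] := toplevelE j.
  by have := bstart_le (topblock_le jk : (topblock j).+1 <= i.+1); rewrite /pp; lia.
have tgt j (_ : j < k) := toplevel_gt j.
have tb j l (_ : j < k) := @toplevel_zero j l.
have tc j : j < k -> \sum_(l <- levels h toplevel j) size (ins_word (bom p) l) <= 2 ^ j * Mc.
  move=> jk; rewrite -(ler_nat R) (le_trans (cost_levels jk)) // natrM natrX.
  by rewrite ler_wpM2l // exprn_ge0.
have [Q [nQ gQ _ cQ dQ]] := program omp omN pN tgt tle tb tc (leqnn k).
set n := 2 ^ k in nQ cQ dQ.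
have n0 : 0 < n by rewrite expn_gt0.
(* The number of errors allowed: small enough for [half_count], large enough for Markov's inequality
   by the choice of h. *)
pose c := n %/ (4 * k.+1).
have n4 : 4 * k.+1 <= n.
  have : 2 ^ h <= n by rewrite leq_exp2l // (leq_trans hi) // ltnW.
  apply: leq_trans; apply: leq_trans kh.
  have k0 : 0 < k by apply: leq_ltn_trans ik.
  by move: k0; move: (k) => t; tidy; nia.
have c1 : 0 < c by rewrite divn_gt0.
have nc : n <= 8 * k.+1 * c.
  by have := ltn_ceil n (isT : 0 < 4 * k.+1); move: c1; rewrite -/c; tidy; nia.
have cn : 4 * k.+1 * c <= n by rewrite mulnC leq_trunc_div.
have Dc : 2 * (2 ^ n * n * (2 * k ^ 2 + 4 * k)) <= 2 ^ n * (2 ^ h * c).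
  have -> : 2 * (2 ^ n * n * (2 * k ^ 2 + 4 * k)) = 2 ^ n * (n * (4 * (k * k.+2))).
    by rewrite !expnS !expn0; ring.
  rewrite leq_mul2l; apply/orP; right.
  apply: (@leq_trans (8 * k.+1 * c * (4 * (k * k.+2)))); first by rewrite leq_mul2r nc orbT.
  have -> : 8 * k.+1 * c * (4 * (k * k.+2)) = 32 * (k * (k.+1 * k.+2)) * c by ring.
  by rewrite leq_mul2r kh orbT.
have [Us [uU UsP big]] := many_elements omN pN nQ gQ dQ Dc.
apply: (@leq_trans (size Us)); last first.
  apply: growth_ge => // g /UsP[w wQ ->]; exists w => //.
  apply: leq_trans wQ (leq_trans cQ _).
  rewrite -(ler_nat R) (le_trans _ rbig) // natrM natrD natrM natrX.
  rewrite -addnA exprD -mulrA ler_wpM2l ?exprn_ge0 //.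
  have k1 : (1 <= k%:R :> R)%R by rewrite ler1n (leq_trans _ ik).
  apply: (@le_trans _ _ (3 * (k%:R * cst))%R).
    have : (1 <= k%:R * cst)%R by rewrite mulr_ege1.
    have : (k%:R * Mc%:R <= k%:R * (2 * cst))%R by rewrite ler_wpM2l.
    lra.
  rewrite /cst mulrCA !mulrA ler_wpM2r ?exprn_ge0 ?invr_ge0 ?(ltW eta0) //.
  rewrite (_ : 15 * blen i + bstart h.+1 =
    (12 * blen i - 2 * i.+1) + (3 * blen i + bstart h.+1 + 2 * i.+1)); last first.
    by have := blen_ge i; tidy; lia.
  rewrite (exprD _ (12 * blen i - 2 * i.+1)) ler_wpM2r ?exprn_ge0 //.
  have -> : (k%:R * 3 * 16 * k%:R = (48 * (k * k))%:R :> R)%R by rewrite !natrM; ring.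
  rewrite -natrX ler_nat.
  have ki : k <= 2 ^ (3 * i.+1) := bstart_le_pow i.
  apply: (@leq_trans (2 ^ 6 * (2 ^ (3 * i.+1) * 2 ^ (3 * i.+1)))).
    by rewrite !leq_mul.
  by rewrite -!expnD leq_exp2l // blen_ge.
apply: half_count cn big; first exact: leq_ltn_trans ik.
by apply: leq_trans n4; rewrite leq_pmulr.
Qed.

End LowerBound.

(** * Upper bound for the growth *)

Section GroupWords.
Variable F : finGroupType.
Local Open Scope group_scope.

(* [None] stands for a, and [Some (f, v)] for phi_f v. *)
Local Notation letter := (option (F * option 'I_3)).

Definition vmul (v v' : option 'I_3) :=
  match v, v' with
  | None, _ => v'
  | _, None => v
  | Some i, Some j =>
      if i == j then None else Some (if j == ordS i then ordS j else ordS i)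
  end.

Definition treeV v om : treeAut := if v is Some y then tree_y y om else 1.
Definition ltrV v k : treeAut := if v is Some y then ltr_u y k else 1.

Lemma treeV_true v om w : treeV v om (true :: w) = true :: treeV v (om_shift om) w.
Proof. by case: v. Qed.

Lemma treeV_false v om w : treeV v om (false :: w) = false :: ltrV v (om 0%N) w.
Proof. by case: v. Qed.

Lemma ltrV_mul v v' k w : ltrV v' k (ltrV v k w) = ltrV (vmul v v') k w.
Proof.
have aa := tree_aK; case: v v' => [y|] [y'|] //=.
elim/ord3P: y / y' => y; rewrite ?eqxx ?ordS3_neq /=; elim/ord3P: y / k => y;
  rewrite /ltr_u ?eqxx ?ordS3_neq ?ordS3K ?eqxx ?ordS3_neq //.
Qed.

Lemma treeV_mul v v' om w : treeV v' om (treeV v om w) = treeV (vmul v v') om w.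
Proof.
elim: w om => [|[] w IH] om; first by rewrite !ta_root.
  by rewrite !treeV_true IH.
by rewrite !treeV_false ltrV_mul.
Qed.

Definition gletter_val om (l : letter) : treeAut :=
  if l is Some (_, v) then treeV v om else tree_a.

Definition gword_val om (w : seq letter) : treeAut := foldr (fun l g => gletter_val om l * g) 1 w.

Lemma gword_val_cons om l w x : gword_val om (l :: w) x = gword_val om w (gletter_val om l x).
Proof. by []. Qed.

Definition lamp (l : letter) (x : nat -> bool) : F :=
  if l is Some (f, _) then if `[< x = rho >] then f else 1 else 1.

Fixpoint wlamp om (w : seq letter) (x : nat -> bool) : F :=
  if w is l :: w' then lamp l x * wlamp om w' (bd_act x (gletter_val om l)) else 1.

Definition scons (t : bool) (x : nat -> bool) : nat -> bool :=
  fun n => if n is n'.+1 then x n' else t.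

Lemma sconsE x : x = scons (x 0%N) (fun n => x n.+1).
Proof. by apply/funext => -[|n]. Qed.

Lemma bd_act_scons t t' x (g g' : treeAut) :
  (forall w, g (t :: w) = t' :: g' w) -> bd_act (scons t x) g = scons t' (bd_act x g').
Proof.
move=> gE; apply/funext => n; rewrite /bd_act.
have -> : mkseq (scons t x) n.+1 = t :: mkseq x n.
  by rewrite /mkseq /= -[1%N]addn0 iotaDl -map_comp.
by rewrite gE; case: n => [|n].
Qed.

Definition moves (v : option 'I_3) (k : 'I_3) := if v is Some y then y != k else false.

(** At the child 1 a letter phi_f v leaves itself, lamp included, because rho = 1 rho; at the child
    0 it leaves a or nothing. *)
Fixpoint sec (k : 'I_3) (t : bool) (w : seq letter) : seq letter :=
  match w with
  | [::] => [::]
  | None :: w' => sec k (~~ t) w'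
  | Some (f, v) :: w' =>
      if t then Some (f, v) :: sec k t w'
      else if moves v k then None :: sec k t w' else sec k t w'
  end.

Definition is_a (l : letter) := ~~ isSome l.

Definition par w := odd (count is_a w).

Lemma ltrV_moves v k : ltrV v k = if moves v k then tree_a else 1.
Proof. by case: v => // y; rewrite /= /ltr_u eq_sym; case: eqP. Qed.

Lemma gword_val_sec om t w y : gword_val om w (t :: y) =
  t (+) par w :: gword_val (om_shift om) (sec (om 0%N) t w) y.
Proof.
elim: w t y => [|[[f v]|] w IH] t y; first by rewrite /= addbF.
  rewrite gword_val_cons /par /= add0n -/(par w); case: t.
    by rewrite treeV_true IH.
  rewrite treeV_false IH ltrV_moves; case: (moves _ _) => //.
rewrite gword_val_cons -[gletter_val om None]/tree_a tree_a_cons IH /par /=.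
by case: t; case: odd.
Qed.

Lemma scons_rho t x : `[< scons t x = rho >] = t && `[< x = rho >].
Proof.
apply/asboolP/andP => [E|[-> /asboolP ->]]; last by apply/funext => -[].
split; first by have := congr1 (fun f => f 0%N) E.
by apply/asboolP/funext => n; have := congr1 (fun f => f n.+1) E.
Qed.

Lemma wlamp_sec om t w x :
  wlamp om w (scons t x) = wlamp (om_shift om) (sec (om 0%N) t w) x.
Proof.
elim: w t x => [|[[f v]|] w IH] t x //=; last first.
  by rewrite mul1g (@bd_act_scons t (~~ t) x _ 1) ?bd_act1 // => z; rewrite tree_a_cons.
rewrite scons_rho; case: t => /=.
  by rewrite (@bd_act_scons true true x _ (treeV v (om_shift om))) ?IH // => z;
     rewrite treeV_true.
rewrite (@bd_act_scons false false x _ (ltrV v (om 0%N))) ?IH; last first.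
  by move=> z; rewrite treeV_false.
by rewrite mul1g ltrV_moves; case: moves; rewrite /= ?mul1g ?bd_act1.
Qed.

Definition push (l : letter) (t : seq letter) : seq letter :=
  match l, t with
  | None, None :: t' => t'
  | Some (f, v), Some (f', v') :: t' => Some (f * f', vmul v v') :: t'
  | _, _ => l :: t
  end.

Definition nf w := foldr push [::] w.

Definition alternates := sorted (fun l l' => is_a l != is_a l').

Lemma bd_act_rho om v : bd_act rho (treeV v om) = rho.
Proof.
apply/funext => n; rewrite /bd_act /rho.
have -> : mkseq (fun=> true) n.+1 = nseq n.+1 true.
  by apply: (@eq_from_nth _ true); rewrite size_mkseq ?size_nseq // => i ni;
     rewrite nth_mkseq // nth_nseq ni.
have E m om' : treeV v om' (nseq m true) = nseq m true.
  by elim: m om' => [|m IH] om'; rewrite ?ta_root //= treeV_true IH.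
by rewrite E nth_nseq ltnSn.
Qed.

Lemma bd_act_rhoE om v x : `[< bd_act x (treeV v om) = rho >] = `[< x = rho >].
Proof.
apply/asboolP/asboolP => [E|->]; last exact: bd_act_rho.
have K z : bd_act (bd_act z (treeV v om)) (treeV v om)^-1 = z.
  by rewrite -bd_actM mulgV bd_act1.
by rewrite -(K x) E -{1}(bd_act_rho om v) K.
Qed.

Lemma gword_val_push om l t : gword_val om (push l t) =1 gword_val om (l :: t).
Proof.
case: l t => [[f v]|] [|[[f' v']|] t] x //=; rewrite !tree_mulE //.
  by rewrite -[RHS]/(gword_val om t (treeV v' om (treeV v om x))) treeV_mul.
by rewrite -[RHS]/(gword_val om t (tree_a (tree_a x))) tree_aK.
Qed.

Lemma wlamp_push om l t x : wlamp om (push l t) x = wlamp om (l :: t) x.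
Proof.
case: l t => [[f v]|] [|[[f' v']|] t] //=.
  rewrite bd_act_rhoE -bd_actM mulgA.
  have -> : treeV v om * treeV v' om = treeV (vmul v v') om.
    by apply: treeAut_eq => w; rewrite tree_mulE treeV_mul.
  by case: asboolP => _; rewrite ?mul1g.
by rewrite !mul1g -bd_actM tree_aa bd_act1.
Qed.

Lemma gword_val_nf om w : gword_val om (nf w) = gword_val om w.
Proof.
apply: treeAut_eq; elim: w => //= l w IH x.
by rewrite gword_val_push !gword_val_cons IH.
Qed.

Lemma wlamp_nf om w x : wlamp om (nf w) x = wlamp om w x.
Proof. by elim: w x => //= l w IH x; rewrite wlamp_push /= IH. Qed.

Lemma alternates_nf w : alternates (nf w).
Proof.
elim: w => //= l w; rewrite /alternates; case: (nf w) => [|l' t].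
  by case: l => [[]|].
case: l => [[f v]|]; case: l' => [[f' v']|] /=.
- by case: t.
- by [].
- by [].
- exact: path_sorted.
Qed.

(** Words are normalised before each splitting, since the contraction needs letters that alternate
    with a. *)
Fixpoint portrait om k w : seq bool * seq (seq letter) :=
  if k is k'.+1 then
    let w' := nf w in
    let c0 := portrait (om_shift om) k' (sec (om 0%N) false w') in
    let c1 := portrait (om_shift om) k' (sec (om 0%N) true w') in
    (par w' :: c0.1 ++ c1.1, c0.2 ++ c1.2)
  else ([::], [:: nf w]).

Lemma size_portrait om k w :
  (size (portrait om k w).1).+1 = (2 ^ k)%N /\ size (portrait om k w).2 = (2 ^ k)%N.
Proof.
elim: k om w => [|k IH] om w //=; rewrite !size_cat.
have [h1 h2] := IH (om_shift om) (sec (om 0%N) false (nf w)).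
have [h3 h4] := IH (om_shift om) (sec (om 0%N) true (nf w)).
by rewrite expnS h2 h4; split; lia.
Qed.

Lemma portrait_inj om k w w' : portrait om k w = portrait om k w' ->
  gword_val om w = gword_val om w' /\ wlamp om w =1 wlamp om w'.
Proof.
elim: k om w w' => [|k IH] om w w' /=.
  by move=> [E]; rewrite -(gword_val_nf om w) E gword_val_nf; split=> // x;
     rewrite -(wlamp_nf om w) E wlamp_nf.
set c0 := portrait _ _ _; set c1 := portrait _ _ _; set d0 := portrait _ _ _; set d1 := portrait _ _ _.
move=> [pE /eqP e1 /eqP e2].
have [s1 s2] := size_portrait (om_shift om) k (sec (om 0%N) false (nf w)).
have [s3 s4] := size_portrait (om_shift om) k (sec (om 0%N) false (nf w')).
rewrite -/c0 in s1 s2; rewrite -/d0 in s3 s4.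
rewrite eqseq_cat in e1; last by apply: succn_inj; rewrite s1 s3.
rewrite eqseq_cat in e2; last by rewrite s2 s4.
move: e1 e2 => /andP[/eqP e1 /eqP e3] /andP[/eqP e2 /eqP e4].
have E0 : c0 = d0 by rewrite (surjective_pairing c0) e1 e2 -surjective_pairing.
have E1 : c1 = d1 by rewrite (surjective_pairing c1) e3 e4 -surjective_pairing.
have [v0 l0] := IH _ _ _ E0; have [v1 l1] := IH _ _ _ E1.
split.
  rewrite -(gword_val_nf om w) -(gword_val_nf om w'); apply: treeAut_eq => -[|t y].
    by rewrite !ta_root.
  by rewrite !gword_val_sec pE; case: t; rewrite ?v0 ?v1.
move=> x; rewrite -(wlamp_nf om w) -(wlamp_nf om w') (sconsE x) !wlamp_sec.
by case: (x 0%N); rewrite ?l0 ?l1.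
Qed.

End GroupWords.

(** * Contraction of a weighted word length *)

Section Contraction.
Import Order.TTheory GRing.Theory Num.Theory.
Local Open Scope ring_scope.
Variables (R : realFieldType) (eta : R).
Hypotheses (eta0 : 0 < eta) (etaE : eta ^+ 3 + eta ^+ 2 + eta = 2).
Variable F : finGroupType.
Local Notation letter := (option (F * option 'I_3)).

(** Bartholdi's weights: 1 - eta^3 for a, then 1 - eta, 1 - eta^2 and eta^3 for the letters x, x+1
    and x+2, which makes the pair a y weigh [wrot]. A lamp alone gets the smallest weight 1 -
    eta. *)
Definition wta : R := 1 - eta ^+ 3.

Definition wtv (x : 'I_3) (v : option 'I_3) : R :=
  if v is Some y then wrot eta x y - wta else 1 - eta.

Definition wtl (x : 'I_3) (l : letter) : R :=
  if l is Some (_, v) then wtv x v else wta.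

Definition wtw x (w : seq letter) : R := \sum_(l <- w) wtl x l.

Lemma etaXs : [/\ 0 < eta, eta < 1, eta ^+ 2 <= eta, eta ^+ 3 <= eta ^+ 2 & 0 < eta ^+ 3].
Proof.
have e1 := eta_lt1 etaE; split => //.
- by rewrite expr2 ger_pMr // ltW.
- by rewrite (exprS _ 2) ger_pMl ?exprn_gt0 // ltW.
- by rewrite exprn_gt0.
Qed.

Lemma wtv_ge x v : 1 - eta <= wtv x v.
Proof.
have [? ? ? ? ?] := etaXs; have ? := etaE; case: v => //= y; rewrite /wrot /wta.
by case: ifP => _; [|case: ifP => _]; lra.
Qed.

Lemma wtl_ge x l : 1 - eta <= wtl x l.
Proof.
have [? ? ? ? ?] := etaXs; have ? := etaE; case: l => [[f v]|]; first exact: wtv_ge.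
by rewrite /= /wta; lra.
Qed.

Lemma wtl_le1 x l : wtl x l <= 1.
Proof.
have [? ? ? ? ?] := etaXs; have ? := etaE; case: l => [[f [y|]]|] /=; rewrite /wta; try lra.
by rewrite /wrot; case: ifP => _; [|case: ifP => _]; lra.
Qed.

(** For the heaviest letter the triangle inequality is the equality eta^3 = (1 - eta^2) + (1 -
    eta). *)
Lemma wtv_mul x v v' : wtv x (vmul v v') <= wtv x v + wtv x v'.
Proof.
have [? ? ? ? ?] := etaXs; have ? := etaE; have le1 := wtv_ge x.
have := le1 v; have := le1 v'; case: v v' => [y|] [y'|] /= h1 h2; try lra.
case: eqP => [|]; first by rewrite /=; lra.
clear le1; move: y y' {h1 h2} => y y'.
elim/ord3P: y / y' => y //= _; rewrite ?eqxx ?ordS3_neq ?ordS3K;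
    elim/ord3P: x / y => x; rewrite /wrot ?eqxx ?ordS3_neq ?ordS3K ?eqxx ?ordS3_neq
      ?eqxx ?ordS3_neq /wta; lra.
Qed.

Lemma wtw_cons x l w : wtw x (l :: w) = wtl x l + wtw x w.
Proof. by rewrite /wtw big_cons. Qed.

Lemma wtw_push x l t : wtw x (push l t) <= wtl x l + wtw x t.
Proof.
have [? ? ? ? ?] := etaXs; have ? := etaE.
case: l t => [[f v]|] [|[[f' v']|] t] /=; rewrite ?wtw_cons //=.
  by rewrite addrA lerD2r wtv_mul.
by rewrite /wta; lra.
Qed.

Lemma wtw_nf x w : wtw x (nf w) <= wtw x w.
Proof.
elim: w => //= l w IH; rewrite wtw_cons (le_trans (wtw_push _ _ _)) //.
by rewrite lerD2l.
Qed.

Lemma count_alternates (w : seq letter) : @alternates F w ->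
  (count (fun l => ~~ is_a l) w <= (count (@is_a F) w).+1)%N.
Proof.
suff H l (t : seq letter) : path (fun l l' : letter => is_a l != is_a l') l t ->
    (count (fun l => ~~ is_a l) t <= count (@is_a F) t + is_a l)%N.
  by case: w => [|l t] //= /H; case: (is_a l) => /=; lia.
elim: t l => //= l' t IH l /andP[ll' /IH].
by case: (is_a l) ll'; case: (is_a l') => //=; lia.
Qed.

Lemma wtw_sec x k t w : wtw x (sec k t w) + wtw x (sec k (~~ t) w) =
  \sum_(l <- w | ~~ is_a l) (wtl x l + (if l is Some (_, v) then
     if moves v k then wta else 0 else 0)).
Proof.
elim: w t => [|[[f v]|] w IH] t; rewrite /= ?big_cons /=.
- by rewrite big_nil /wtw big_nil addr0.
- rewrite -(IH t); case: t; case: moves; rewrite /= ?wtw_cons /=; lra.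
- by rewrite -(IH (~~ t)).
Qed.

(** Under a rotation, the three letters give equalities: x leaves no a and has the new weight eta^3
    = eta * eta^2; each of the others moves one step in the cycle, which costs a factor eta. *)
Lemma letter_contraction (b : bool) x v :
  wtv (if b then ordS x else x) v + (if moves v x then wta else 0) <=
    (if b then eta else 1) * (wtv x v + wta).
Proof.
have [e0 e1 e2 e3 e4] := etaXs.
have etaE' : eta * (eta * eta) + eta * eta + eta = 2 by rewrite -etaE; ring.
case: v => [y|] /=; last by case: b; rewrite /wta; nra.
case: b; last by rewrite /wta; case: ifP => _; lra.
elim/ord3P: x / y => x; rewrite /wrot /wta ?eqxx ?ordS3_neq ?ordS3K ?eqxx ?ordS3_neq
  ?eqxx ?ordS3_neq /=; nra.
Qed.

(* Each letter is charged together with one adjacent a. *)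
Lemma contraction (b : bool) x w : @alternates F w ->
  let x' := if b then ordS x else x in
  wtw x' (sec x false w) + wtw x' (sec x true w) <=
    (if b then eta else 1) * (wtw x w + wta).
Proof.
move=> alt; have [e0 e1 e2 e3 e4] := etaXs; have eE := etaE; set x' := if b then ordS x else x.
rewrite /= -/x' [leLHS](wtw_sec x' x false w).
set kap := if b then eta else 1.
have kap0 : 0 < kap by rewrite /kap; case: (b).
have H1 : \sum_(l <- w | ~~ is_a l) (wtl x' l + (if l is Some (_, v) then
     if moves v x then wta else 0 else 0)) <=
   kap * (\sum_(l <- w | ~~ is_a l) wtl x l + (count (fun l => ~~ is_a l) w)%:R * wta).
  have -> : (count (fun l => ~~ is_a l) w)%:R * wta =
      \sum_(l <- w | ~~ is_a l) wta by rewrite big_const_seq iter_addr_0 mulr_natl.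
  rewrite -big_split /= mulr_sumr; apply: ler_sum => -[[f v]|] //= _; exact: letter_contraction.
apply: le_trans H1 _; rewrite ler_wpM2l ?(ltW kap0) //.
have := count_alternates alt; rewrite -(ler_nat R) -natr1 => cnt.
have -> : wtw x w = \sum_(l <- w | ~~ is_a l) wtl x l + (count (@is_a F) w)%:R * wta.
  rewrite /wtw (bigID (@is_a F)) /= addrC; congr (_ + _).
  rewrite [RHS]mulr_natl -iter_addr_0 -big_const_seq.
  by apply: eq_bigr => -[[f v]|].
have wta0 : 0 < wta by rewrite /wta; lra.
have := ler_wpM2r (ltW wta0) cnt; lra.
Qed.

Definition kapp (c : nat -> bool) i : R := if c i then eta else 1.

Lemma prod_kapp01 c k : 0 <= \prod_(i < k) kapp c i <= 1.
Proof.
have [e0 e1 _ _ _] := etaXs.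
elim: k => [|k /andP[IH0 IH1]]; first by rewrite big_ord0 ler01 lexx.
by rewrite big_ord_recr /kapp /=; case: (c k); rewrite ?mulr1 ?IH0 ?IH1 // mulr_ge0
  ?mulr_ile1 // ltW.
Qed.

(** Each of the 2^k - 1 splittings adds at most [wta]. *)
Lemma portrait_weight c om k (w : seq letter) : rotates c om ->
  \sum_(u <- (portrait om k w).2) wtw (om k) u <=
    (\prod_(i < k) kapp c i) * wtw (om 0%N) w + (2 ^+ k - 1) * wta.
Proof.
have [e0 e1 e2 e3 e4] := etaXs; have eE := etaE; have wta0 : 0 < wta by rewrite /wta; lra.
have kap01 c' i : 0 <= kapp c' i <= 1 by rewrite /kapp; case: ifP => _; lra.
elim: k c om w => [|k IH] c om w rot.
  by rewrite /= big_seq1 big_ord0 mul1r subrr mul0r addr0 wtw_nf.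
have rot' : rotates (fun i => c i.+1) (om_shift om) by move=> i; apply: rot.
rewrite /= big_cat /=; set w0 := sec _ _ _; set w1 := sec _ _ _.
apply: le_trans (lerD (IH _ _ w0 rot') (IH _ _ w1 rot')) _.
set K := \prod_(i < k) _.
have K1 : 0 <= K <= 1 := prod_kapp01 _ _.
have /= := contraction (c 0%N) (om 0%N) (alternates_nf w).
rewrite -(rot 0%N) -/w0 -/w1 -/(kapp c 0) => ctr.
have {}ctr : wtw (om 1%N) w0 + wtw (om 1%N) w1 <= kapp c 0 * wtw (om 0%N) w + wta.
  apply: le_trans ctr _; rewrite mulrDr; apply: lerD.
    by rewrite ler_wpM2l ?wtw_nf //; have /andP[] := kap01 c 0%N.
  by rewrite ger_pMl //; have /andP[] := kap01 c 0%N.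
have {ctr} := ler_wpM2l (proj1 (andP K1)) ctr.
have /andP[_ K1'] := K1; have := ler_wpM2r (ltW wta0) K1'.
rewrite big_ord_recl -/(kapp c 0) -/K /om_shift exprS.
move: (wtw _ w0) (wtw _ w1) (wtw _ w) (kapp c 0) (2 ^+ k) => A B C D E h1 h2.
rewrite mulrDr in h2; lra.
Qed.

(** As 1 - eta > 1/10, the length is at most ten times the weight, and each of the two terms of
    [portrait_weight] is at most 2^k. *)
Lemma portrait_length c om k (w : seq letter) : rotates c om ->
  (\prod_(i < k) kapp c i) * (size w)%:R <= 2 ^+ k ->
  (\sum_(u <- (portrait om k w).2) size u <= 20 * 2 ^ k)%N.
Proof.
move=> rot h; have [e0 e1 e2 e3 e4] := etaXs; have eE := etaE.
have e9 : eta < 9 / 10.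
  rewrite ltNge; apply/negP => h9.
  have h2 : 9 / 10 * (9 / 10) <= eta * eta by apply: ler_pM => //; lra.
  have h3 : 9 / 10 * (9 / 10 * (9 / 10)) <= eta * (eta * eta) by apply: ler_pM => //; lra.
  have : eta * (eta * eta) + eta * eta + eta = 2 by rewrite -etaE; ring.
  lra.
have K0 : 0 <= \prod_(i < k) kapp c i.
  by apply: prodr_ge0 => i _; rewrite /kapp; case: ifP => _; lra.
have := portrait_weight k w rot.
have : wtw (om 0%N) w <= (size w)%:R.
  rewrite /wtw -sum1_size natr_sum; apply: ler_sum => l _; exact: wtl_le1.
move=> /(ler_wpM2l K0) h1 h2.
have : (\sum_(u <- (portrait om k w).2) size u)%:R * (1 / 10) <=
    \sum_(u <- (portrait om k w).2) wtw (om k) u.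
  rewrite natr_sum mulr_suml; apply: ler_sum => u _.
  rewrite /wtw -sum1_size natr_sum mulr_suml; apply: ler_sum => l _.
  have := wtl_ge (om k) l; lra.
move=> h3; rewrite -(ler_nat R) natrM natrX.
have p1 : 1 <= 2 ^+ k :> R by rewrite exprn_ege1 // ler1n.
have w1 : wta <= 1 by rewrite /wta; lra.
have w2 : (2 ^+ k - 1) * wta <= (2 ^+ k - 1) by rewrite ler_piMr; lra.
lra.
Qed.

End Contraction.

Section Flatten.
Variable T : eqType.

(** The final [None] makes concatenations uniquely decodable. *)
Definition seal (w : seq T) : seq (option T) := rcons (map Some w) None.

Lemma flatten_seal_inj : injective (fun ws => flatten (map seal ws)).
Proof.
move=> ws ws'; elim: ws ws' => [|w ws IH] [|w' ws'] //=; rewrite /seal.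
- by case: w'.
- by case: w.
move=> E; suff [-> /IH ->] : w = w' /\ flatten (map seal ws) = flatten (map seal ws') by [].
elim: w w' E => [|x w IHw] [|x' w'] //= [].
  by move=> ->.
by move=> -> /IHw[-> ->].
Qed.

Lemma size_flatten_seal ws :
  size (flatten (map seal ws)) = \sum_(w <- ws) size w + size ws.
Proof.
elim: ws => [|w ws IH]; first by rewrite big_nil.
by rewrite /= size_cat IH size_rcons size_map big_cons; lia.
Qed.

End Flatten.

Section PadTuple.
Variables (T : Type) (L : nat).

Definition pad (s : seq T) : seq (option T) := take L (map Some s ++ nseq L None).

Lemma size_pad s : size (pad s) == L.
Proof. by rewrite size_takel // size_cat size_nseq leq_addl. Qed.

Lemma pad_inj s s' : size s <= L -> size s' <= L -> pad s = pad s' -> s = s'.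
Proof.
have E t : size t <= L -> pmap id (pad t) = t.
  move=> tL; rewrite /pad take_cat size_map ltnNge tL /= pmap_cat.
  rewrite (_ : pmap id (map Some t) = t); last by elim: t {tL} => //= x t ->.
  rewrite take_nseq ?leq_subr //; elim: (L - _) => [|n IH] //=; by rewrite cats0.
by move=> h h' e; rewrite -[LHS](E s) // -[RHS](E s') // e.
Qed.

End PadTuple.

Section GrowthUpperBound.
Import Order.TTheory GRing.Theory Num.Theory.
Variables (om : nat -> 'I_3) (F : finGroupType).
Local Notation letter := (option (F * option 'I_3)).
Local Notation sym := (bool + option letter)%type.
Local Open Scope group_scope.

Definition grigV (v : option 'I_3) : grig om :=
  if v is Some y then
    if y == y_b then grig_b om else if y == y_c then grig_c om else grig_d om
  else 1.

Lemma val_grigV v : val (grigV v) = treeV v om.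
Proof.
case: v => [[[|[|[|//]]] hy]|] /=; last by [].
all: by rewrite (bool_irrelevance hy isT).
Qed.

Definition gl (l : letter) : Gamma om F :=
  if l is Some (f, v) then Gamma_phi f (grigV v) else Gamma_a om F.

Definition gw (w : seq letter) : Gamma om F := \big[*%g/1]_(l <- w) gl l.

Lemma gw_cons l w : gw (l :: w) = gl l * gw w.
Proof. by rewrite /gw big_cons. Qed.

Lemma val_wtop_gl l : val (wtop (gl l)) = gletter_val om l.
Proof. by case: l => [[f v]|] //=; rewrite val_grigV. Qed.

Lemma wtop_gw w : val (wtop (gw w)) = gword_val om w.
Proof.
elim: w => [|l w IH]; first by rewrite /gw big_nil.
by rewrite gw_cons -[wtop _]/(wtop (gl l) * wtop (gw w)) valM IH val_wtop_gl.
Qed.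

Lemma wbase_gw w x : wbase (gw w) x = wlamp om w (val x).
Proof.
elim: w x => [|l w IH] x; first by rewrite /gw big_nil.
rewrite gw_cons -[wbase _ x]/(wbase (gl l) x * wbase (gw w) (orb_act x (wtop (gl l)))).
rewrite IH /= val_wtop_gl; congr (_ * _).
case: l => [[f v]|] //=; rewrite /delta_rho; congr (if _ then _ else _).
by apply/asboolP/asboolP => [->|E] //; apply: val_inj.
Qed.

Lemma gw_eq w w' : gword_val om w = gword_val om w' -> wlamp om w =1 wlamp om w' -> gw w = gw w'.
Proof.
move=> E1 E2; apply: wreath_eq => [x|]; first by rewrite !wbase_gw.
by apply: val_inj; rewrite !wtop_gw.
Qed.

Lemma gen_gl s : @Gamma_gens om F s -> exists l, s = gl l.
Proof.
case=> [->|[f [v [Vv ->]]]]; first by exists None.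
suff [v' <-] : exists v', grigV v' = v by exists (Some (f, v')).
case: Vv => [[[->|->]|->]|->].
- by exists None.
- by exists (Some y_b).
- by exists (Some y_c).
- by exists (Some y_d).
Qed.

Lemma glV l : exists l', (gl l)^-1 = gl l'.
Proof.
pose l' : letter := if l is Some (f, v) then Some (f^-1, v) else None.
exists l'; apply: (@mulgI _ (gl l)); rewrite mulgV.
have E0 : gw [::] = 1 by rewrite /gw big_nil.
have -> : gl l * gl l' = gw [:: l; l'] by rewrite !gw_cons E0 mulg1.
rewrite -E0; symmetry.
apply: gw_eq => [|x].
  apply: treeAut_eq => w; rewrite -(gword_val_nf om [:: l; l']) /l'; clear l'.
  by case: l => [[f [y|]]|] //=; rewrite /nf /= ?eqxx.
rewrite -(wlamp_nf om [:: l; l']) /l'; clear l'.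
case: l => [[f [y|]]|] //=; rewrite /nf /= ?eqxx mulgV; by case: ifP; rewrite !mulg1.
Qed.

Lemma ball_gw r g : word_ball (@Gamma_gens om F) r g ->
  exists2 w, (size w <= r)%N & g = gw w.
Proof.
move=> [ss [sr gens ->]]; elim: ss r sr gens => [|s ss IH] r /= sr gens.
  by exists [::] => //; rewrite /gw !big_nil.
case: r sr => // r; rewrite ltnS => sr.
have [|w wr E] := IH r sr; first by move=> t tss; apply: gens; rewrite inE tss orbT.
have [l sl] : exists l, s = gl l.
  have [/gen_gl //|/gen_gl[l sl]] := gens s (mem_head _ _).
  by have [l' E'] := glV l; exists l'; rewrite -E' -sl invgK.
by exists (l :: w); rewrite ?ltnS // big_cons gw_cons sl E.
Qed.

Definition flat_portrait k w : seq sym :=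
  map inl (portrait om k w).1 ++ map inr (flatten (map (@seal letter) (portrait om k w).2)).

Lemma flat_portrait_inj k w w' : flat_portrait k w = flat_portrait k w' ->
  portrait om k w = portrait om k w'.
Proof.
have [s1 s2] := size_portrait om k w; have [s3 s4] := size_portrait om k w'.
rewrite /flat_portrait => /eqP; rewrite eqseq_cat; last first.
  by rewrite !size_map; apply: succn_inj; rewrite s1 s3.
have injl : injective (@inl bool (option letter)) by move=> ? ? [].
have injr : injective (@inr bool (option letter)) by move=> ? ? [].
move=> /andP[/eqP/(inj_map injl) e1 /eqP/(inj_map injr)/flatten_seal_inj e2].
by rewrite (surjective_pairing (portrait om k w)) e1 e2 -surjective_pairing.
Qed.

Section Bound.
Variables (R : realFieldType) (eta : R).
Hypotheses (eta0 : (0 < eta)%R) (etaE : (eta ^+ 3 + eta ^+ 2 + eta = 2)%R).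
Local Open Scope nat_scope.

(** The exponent accounts for the parities (fewer than 2^k), 20 * 2^k letters and 2^k separators;
    codes are padded to this common length. *)
Lemma upper_growth c k r : rotates c om ->
  ((\prod_(i < k) kapp eta c i) * r%:R <= 2 ^+ k)%R ->
  Gamma_growth om F r <= #|{: option sym}| ^ (22 * 2 ^ k).
Proof.
move=> rot h; set L := 22 * 2 ^ k; rewrite /Gamma_growth /word_growth.
set B := fset_set _.
have wdP g : exists w, g \in B -> size w <= r /\ g = gw w.
  have [gB|gB] := boolP (g \in B); last by exists [::].
  move: gB; rewrite in_fset_set; last exact/word_ball_finite/Gamma_gens_finite.
  by rewrite inE => /ball_gw[w wr ->]; exists w.
have [wd {}wdP] := choice wdP.
pose f g : L.-tuple (option sym) := Tuple (size_pad L (flat_portrait k (wd g))).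
have szL g : g \in B -> size (flat_portrait k (wd g)) <= L.
  move=> /wdP[wr _]; rewrite size_cat !size_map size_flatten_seal.
  have [s1 s2] := size_portrait om k (wd g); rewrite s2 /L.
  have : ((\prod_(i < k) kapp eta c i) * (size (wd g))%:R <= 2 ^+ k)%R.
    apply: le_trans h; rewrite ler_wpM2l ?ler_nat //.
    by have /andP[] := prod_kapp01 eta0 etaE c k.
  move/(portrait_length eta0 etaE rot) => hh.
  by apply: leq_trans (leq_add (leqnn _) (leq_add hh (leqnn _))) _; lia.
have uf : uniq (map f B).
  rewrite map_inj_in_uniq ?fset_uniq // => g g' gB g'B.
  move=> /(congr1 val) /= /pad_inj E.
  have {}E := flat_portrait_inj (E (szL _ gB) (szL _ g'B)).
  have [E1 E2] := portrait_inj E.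
  by rewrite (proj2 (wdP _ gB)) (proj2 (wdP _ g'B)); apply: gw_eq.
rewrite -card_tuple -(size_map f) -(card_uniqP uf); exact: max_card.
Qed.

End Bound.

End GrowthUpperBound.

(** * Alternating decompositions and the path followed by log log b *)

Section MinMax.
Local Open Scope classical_set_scope.

Lemma min_ofE (A : set nat) m : A m -> (forall x, A x -> m <= x) -> min_of A = m.
Proof.
move=> Am mA; rewrite /min_of /infimum ifF; last first.
  by apply/negP => /eqP A0; rewrite A0 in Am.
apply: xget_unique; first by split => [x /mA|y]; [|apply].
move=> y [yA yM]; have h1 : (y <= m)%N := yA m Am; have h2 : (m <= y)%N := yM m mA.
by apply/eqP; rewrite eqn_leq h1 h2.
Qed.

Lemma max_ofE (A : set nat) m : A m -> (forall x, A x -> x <= m) -> max_of A = m.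
Proof.
move=> Am mA; rewrite /max_of /supremum ifF; last first.
  by apply/negP => /eqP A0; rewrite A0 in Am.
apply: xget_unique; first by split => [x /mA|y]; [|apply].
move=> y [yA yM]; have h1 : (m <= y)%N := yA m Am; have h2 : (y <= m)%N := yM m mA.
by apply/eqP; rewrite eqn_leq h1 h2.
Qed.

Lemma max_exists (A : set nat) m B : A m -> (forall x, A x -> x <= B) ->
  exists2 M, A M & forall x, A x -> x <= M.
Proof.
move=> Am AB; have ex : exists x, `[< A x >] by exists m; apply/asboolP.
have bd x : `[< A x >] -> x <= B by move=> /asboolP/AB.
by case: (ex_maxnP ex bd) => M /asboolP AM MA; exists M => // x Ax; apply/MA/asboolP.
Qed.

Definition unbounded (A : set nat) := forall M, exists2 s, M <= s & A s.

Lemma next_in (A : set nat) : unbounded A ->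
  exists f, forall M, [/\ M <= f M, A (f M) & forall r, M <= r -> A r -> f M <= r].
Proof.
move=> uA; have ex M : exists s, [/\ M <= s, A s & forall r, M <= r -> A r -> s <= r].
  have [s Ms As] := uA M.
  have ex : exists x, (M <= x) && `[< A x >] by exists s; rewrite Ms; apply/asboolP.
  case: (ex_minnP ex) => m /andP[Mm /asboolP Am] mA; exists m; split=> // r Mr Ar.
  by apply: mA; rewrite Mr; apply/asboolP.
by have [f fP] := choice ex; exists f.
Qed.

Definition consecutive (L U : set nat) t s :=
  [/\ L t, U s, t < s & forall r, t < r < s -> ~ L r /\ ~ U r].

Lemma alternating_exists (U L : set nat) : unbounded U -> unbounded L ->
  (forall n, U n -> L n -> False) ->
  exists Us Ls, [/\ alternating_decomposition U L Us Ls,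
    forall i, i <= max_of (Ls i) /\ consecutive L U (max_of (Ls i)) (min_of (Us i.+1)) &
    forall i, i <= max_of (Us i) /\ consecutive U L (max_of (Us i)) (min_of (Ls i))].
Proof.
move=> uU uL dUL; have [f fP] := next_in uU; have [g gP] := next_in uL.
(* S 0 is the first point of U, T i the first point of L after S i, and S i.+1 the first point of U
   after T i; these points cut U and L into the pieces. *)
pose S := fix S i := if i is i'.+1 then f (g (S i')) else f 0.
pose T i := g (S i).
have US i : U (S i) by case: i => [|i]; [have [] := fP 0 | have [] := fP (g (S i))].
have LT i : L (T i) by have [] := gP (S i).
have ST i : S i < T i.
  have [le _ _] := gP (S i); rewrite ltn_neqAle [_ <= _]le andbT.
  by apply/eqP => E; apply: (dUL (S i)) => //; rewrite E.
have TS i : T i < S i.+1.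
  have [le _ _] := fP (T i); rewrite ltn_neqAle [_ <= _]le andbT.
  by apply/eqP => E; apply: (dUL (T i)) => //; rewrite {1}E.
have minT i r : S i <= r -> L r -> T i <= r by have [_ _] := gP (S i); apply.
have minS i r : T i <= r -> U r -> S i.+1 <= r by have [_ _] := fP (T i); apply.
have minS0 r : U r -> S 0 <= r by have [_ _ h] := fP 0; apply: h.
have lt_TS i j : i < j -> T i < S j.
  elim: j => // j IH; rewrite ltnS leq_eqVlt => /predU1P[->|/IH lt]; first exact: TS.
  by apply: (ltn_trans lt); apply: ltn_trans (ST _) (TS _).
have le_S i j : i <= j -> S i <= S j.
  rewrite leq_eqVlt => /predU1P[->//|/lt_TS lt].
  by apply: ltnW; apply: ltn_trans (ST _) lt.
have le_T i j : i <= j -> T i <= T j.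
  rewrite leq_eqVlt => /predU1P[->//|/lt_TS lt].
  by apply: ltnW; apply: ltn_trans lt (ST _).
have Si i : i <= S i.
  elim: i => // i IH; apply: leq_ltn_trans IH _.
  exact: ltn_trans (ST _) (TS _).
have loc x : S 0 <= x -> exists i, S i <= x < S i.+1.
  move=> x0; have ex : exists i, S i <= x by exists 0.
  have bd i : S i <= x -> i <= x by apply: leq_trans.
  case: (ex_maxnP ex bd) => i ix imax; exists i; rewrite ix ltnNge.
  by apply/negP => /imax; rewrite ltnn.
pose Us i := [set x | U x /\ S i <= x < T i].
pose Ls i := [set x | L x /\ T i <= x < S i.+1].
have alt : alternating_decomposition U L Us Ls.
  split.
  - by move=> i; exists (S i); split=> //; rewrite leqnn ST.
  - by move=> i; exists (T i); split=> //; rewrite leqnn TS.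
  - apply/trivIsetP => i j _ _ /eqP ij; apply/seteqP; split => // x [[_ h1] [_ h2]].
    have [lt|lt|//] := ltngtP i j.
      by have := lt_TS _ _ lt; lia.
    by have := lt_TS _ _ lt; lia.
  - apply/trivIsetP => i j _ _ /eqP ij; apply/seteqP; split => // x [[_ h1] [_ h2]].
    have [lt|lt|//] := ltngtP i j.
      by have := le_S _ _ lt; have := ST j; lia.
    by have := le_S _ _ lt; have := ST i; lia.
  - apply/seteqP; split => [x [i _ [Ux _]] //|x Ux].
    have [i /andP[h1 h2]] := loc x (minS0 _ Ux); exists i => //; split => //.
    by rewrite h1 ltnNge; apply/negP => /minS => /(_ Ux); lia.
  - apply/seteqP; split => [x [i _ [Lx h]]|x [Lx /existsNP[s /not_implyP[Us0 sx]]]].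
      split => // /(_ (S 0) (US 0)).
      by have := le_S 0 i isT; have := ST i; lia.
    have [|i /andP[h1 h2]] := loc x; first by have := minS0 _ Us0; lia.
    by exists i => //; split => //; rewrite h2 andbT; apply: minT.
  - by move=> i j s t ij [_ h1] [_ h2]; have := le_S _ _ ij; lia.
  - by move=> i j s t ij [_ h1] [_ h2]; have := le_T _ _ ij; lia.
have minU i : min_of (Us i) = S i.
  by apply: min_ofE => [|x [_ /andP[]]//]; split; rewrite ?leqnn ?ST.
have minL i : min_of (Ls i) = T i.
  by apply: min_ofE => [|x [_ /andP[]]//]; split; rewrite ?leqnn ?TS.
exists Us, Ls; split => // i.
  have [||M [LM hM] maxM] := @max_exists (Ls i) (T i) (S i.+1).
  - by split => //; rewrite leqnn TS.
  - by move=> x [_ /andP[_ /ltnW]].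
  have -> : max_of (Ls i) = M by apply: max_ofE.
  rewrite minU; split; first by have := Si i; have := ST i; lia.
  split => //; first by lia.
  move=> r hr; split => [Lr|Ur].
    have : r <= M by apply: maxM; split => //; lia.
    lia.
  have : S i.+1 <= r by apply: minS => //; lia.
  lia.
have [||M [UM hM] maxM] := @max_exists (Us i) (S i) (T i).
- by split => //; rewrite leqnn ST.
- by move=> x [_ /andP[_ /ltnW]].
have -> : max_of (Us i) = M by apply: max_ofE.
rewrite minL; split; first by have := Si i; lia.
split => //; first by lia.
move=> r hr; split => [Ur|Lr].
  have : r <= M by apply: maxM; split => //; lia.
  lia.
have : T i <= r by apply: minT => //; lia.
lia.
Qed.

End MinMax.

Section Profile.
Import Order.TTheory GRing.Theory Num.Theory.
Local Open Scope ring_scope.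
Variables (R : realType) (b : nat -> nat) (E A : nat -> R).

Local Notation lg r := (ln r%:R : R).
Local Notation llb r := (ln (ln (b r)%:R) : R).

(* E and A are the coordinates of a path which the graph of log log b follows,
   as a function of log r, up to an error of smaller order. *)
Record profile : Prop := {
  prof_E0 : E 0%N = 0;
  prof_A0 : A 0%N = 0;
  prof_step : forall i, ln 2 < E i.+1 - E i;
  prof_inc : forall i, 0 <= A i.+1 - A i <= E i.+1 - E i;
  prof_slow : forall e, 0 < e -> exists N, forall i, (N <= i)%N -> E i.+1 - E i <= e * E i;
  prof_apx : forall e, 0 < e -> exists N, forall i, (N <= i)%N ->
    forall r : nat, E i <= lg r <= E i.+1 ->
      0 < ln (b r)%:R :> R /\ `|llb r - A i| <= e * E i
}.

Hypothesis prof : profile.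

Lemma prof_lt i j : (i < j)%N -> E i + ln 2 < E j.
Proof.
have l2 : 0 < ln 2 :> R by rewrite ln_gt0 // ltr1n.
elim: j => // j IH; rewrite ltnS leq_eqVlt => /predU1P[->|/IH lt];
  have := prof_step prof j; lra.
Qed.

Lemma prof_le i j : (i <= j)%N -> E i <= E j.
Proof.
have l2 : 0 < ln 2 :> R by rewrite ln_gt0 // ltr1n.
by rewrite leq_eqVlt => /predU1P[->//|/prof_lt]; lra.
Qed.

Lemma prof_Ale i j : (i <= j)%N -> 0 <= A j - A i <= E j - E i.
Proof.
elim: j => [|j IH]; first by rewrite leqn0 => /eqP ->; lra.
rewrite leq_eqVlt => /predU1P[->|/IH]; first lra.
have := prof_inc prof j; lra.
Qed.

Lemma prof_AE i : 0 <= A i <= E i.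
Proof. by have := prof_Ale (leq0n i); rewrite (prof_E0 prof) (prof_A0 prof) !subr0. Qed.

Lemma prof_ge i : i%:R * ln 2 <= E i.
Proof.
elim: i => [|i IH]; first by rewrite mul0r (prof_E0 prof).
by have := prof_step prof i; rewrite -[i.+1%:R]natr1 mulrDl mul1r; lra.
Qed.

Lemma prof_unbounded x : exists i, x < E i.
Proof.
have l2 : 0 < ln 2 :> R by rewrite ln_gt0 // ltr1n.
exists (Num.truncn (x / ln 2)).+1; apply: lt_le_trans (prof_ge _).
by rewrite -ltr_pdivrMr // truncnS_gt.
Qed.

Lemma locate N (r : nat) : E N <= lg r ->
  exists2 i, (N <= i)%N & E i <= lg r < E i.+1.
Proof.
move=> Nr; have [M rM] := prof_unbounded (lg r).
have ex : exists i, E i <= lg r by exists N.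
have bd i : E i <= lg r -> (i <= M)%N.
  move=> ir; rewrite leqNgt; apply/negP => /ltnW/prof_le; lra.
case: (ex_maxnP ex bd) => i ir imax; exists i; first exact: imax.
by rewrite ir ltNge; apply/negP => /imax; rewrite ltnn.
Qed.

Lemma large_lg (x : R) : exists N : nat, forall r : nat, (N <= r)%N -> x <= lg r.
Proof.
exists (Num.truncn (expR x)).+1 => r Nr.
have xr : expR x <= r%:R.
  apply/ltW/(lt_le_trans (truncnS_gt _)); rewrite ler_nat; exact: Nr.
by rewrite -[x]expRK ler_ln // posrE ?expR_gt0 // (lt_le_trans (expR_gt0 x)).
Qed.

(** Steps of the path are longer than ln 2, so each one contains the logarithm of an integer, at
    which b can be evaluated. *)
Lemma sample i : exists r : nat, E i <= lg r <= E i + ln 2.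
Proof.
have e0 := expR_gt0 (E i); exists (Num.truncn (expR (E i))).+1.
have lt := truncnS_gt (expR (E i)).
have p0 : 0 < (Num.truncn (expR (E i))).+1%:R :> R by rewrite ltr0n.
apply/andP; split.
  by rewrite -[leLHS]expRK ler_ln ?posrE //; apply: ltW.
have E0 : 0 <= E i by rewrite -(prof_E0 prof) prof_le.
have -> : E i + ln 2 = ln (expR (E i) * 2) by rewrite lnM ?posrE // expRK.
rewrite ler_ln ?posrE //; last by rewrite mulr_gt0.
rewrite -[X in X <= _]natr1; have : (Num.truncn (expR (E i)))%:R <= expR (E i).
  by rewrite truncn_le ltW.
have : 1 <= expR (E i) by rewrite -expR0 ler_expR.
lra.
Qed.

Lemma track e M : 0 < e -> exists N : nat, forall r : nat, (N <= r)%N ->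
  exists i, [/\ (M <= i)%N, E i <= lg r < E i.+1, 0 < ln (b r)%:R :> R,
    `|llb r - A i| <= e * E i & lg r <= (1 + e) * E i].
Proof.
move=> e0; have [N1 h1] := prof_slow prof e0; have [N2 h2] := prof_apx prof e0.
have [N hN] := large_lg (E (maxn M (maxn N1 N2))).
exists N => r /hN /locate[i]; rewrite !geq_max => /and3P[Mi N1i N2i] ir.
exists i; have [|p1 p2] := h2 i N2i r; first by move: ir; lra.
by split => //; have := h1 i N1i; move: ir; lra.
Qed.

Lemma upper_setE b' s : (2 <= s)%N -> 0 < ln (b s)%:R :> R ->
  @upper_set R b b' s <-> b' * lg s <= llb s.
Proof.
move=> s2 b0; have s0 : 0 < s%:R :> R by rewrite ltr0n (leq_trans _ s2).
have p0 : 0 < s%:R `^ b' :> R by rewrite powR_gt0.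
rewrite -ln_powR; split => [[_ h]|h]; first by rewrite ler_ln.
by split => //; rewrite -ler_ln.
Qed.

Lemma lower_setE a' s : (2 <= s)%N -> 0 < ln (b s)%:R :> R ->
  @lower_set R b a' s <-> llb s <= a' * lg s.
Proof.
move=> s2 b0; have s0 : 0 < s%:R :> R by rewrite ltr0n (leq_trans _ s2).
have p0 : 0 < s%:R `^ a' :> R by rewrite powR_gt0.
rewrite -ln_powR; split => [[_ h]|h]; first by rewrite ler_ln.
by split => //; rewrite -ler_ln.
Qed.

Section Slopes.
Variables (al be ga de : R) (sg : nat -> R).
Hypothesis sgE : forall i, sg i = de \/ sg i = ga.
Hypothesis window : forall e, 0 < e -> exists N, forall i j, (N <= i)%N -> (i <= j)%N ->
  (forall k, (i <= k < j)%N -> sg k = sg i) ->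
  `|(A j - A i) - sg i * (E j - E i)| <= e * E j.
Hypothesis switch : forall e, 0 < e -> exists N, forall i, (N <= i)%N ->
  sg i.+1 <> sg i -> A i.+1 <= (al + e) * E i.+1 \/ (be - e) * E i.+1 <= A i.+1.

Variables (a' b' : R).
Hypothesis ranges : [/\ al < a', a' < b', b' < be & 0 < a'] /\ [/\ be <= 1, 0 < de, de <= ga & ga <= 1].

Definition crossing x0 x1 r0 r1 :=
  (x0 = a' /\ x1 = b' /\ llb r0 <= a' * lg r0 /\ b' * lg r1 <= llb r1) \/
  (x0 = b' /\ x1 = a' /\ b' * lg r0 <= llb r0 /\ llb r1 <= a' * lg r1).

Lemma lg_lt (r r' : nat) : lg r < lg r' -> (r < r')%N.
Proof.
apply: contraTT; rewrite -leqNgt -leNgt => r'r.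
case: r' r'r => [|r'] r'r; last by rewrite ler_ln ?posrE ?ltr0n ?ler_nat // (leq_trans _ r'r).
case: r {r'r} => [|r] //; rewrite [leLHS]ln0 // ln_ge0 //; exact: (ler_nat R 1 r.+1).
Qed.

(** One step is too short to lead from one line to the other, so there are indices strictly between
    i0 and i1; slowness carries their bounds over to both ends. *)
Lemma gap_ratio d x0 x1 i0 i1 : 0 < d -> d <= 1 -> 20 * d <= b' - a' ->
  (forall i, (i0 <= i)%N -> E i.+1 - E i <= d * E i) -> 0 < E i0 -> (i0 <= i1)%N ->
  (forall i, (i0 < i < i1)%N -> (a' - d) * E i <= A i <= (b' + 2 * d) * E i) ->
  (x0 = a' /\ x1 = b' /\ A i0 <= (a' + 2 * d) * E i0 /\ (b' - d) * E i1 <= A i1) \/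
  (x0 = b' /\ x1 = a' /\ (b' - d) * E i0 <= A i0 /\ A i1 <= (a' + 2 * d) * E i1) ->
  [/\ `|A i0 - x0 * E i0| <= 5 * d * E i0, `|A i1 - x1 * E i1| <= 5 * d * E i1 &
    forall i, (i0 <= i <= i1)%N -> (a' - 3 * d) * E i <= A i <= (b' + 5 * d) * E i].
Proof.
move=> dp d1 dba slow E0 i01 mid cross.
have [[aa ab bb a0] [b1 d0 dg g1]] := ranges.
have b'1 : b' < 1 := lt_le_trans bb b1.
have Ep i : (i0 <= i)%N -> 0 < E i by move=> /prof_le; lra.
have inc i := prof_inc prof i.
have dE i : (i0 <= i)%N -> 0 <= d * E i by move=> /Ep/ltW; apply: mulr_ge0; lra.
have aE i c : 0 <= c -> c <= 1 -> (i0 <= i)%N -> 0 <= c * E i <= E i.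
  by move=> c0 c1 /Ep/ltW Ei; rewrite mulr_ge0 // ler_piMl.
have nonadj : (i0.+1 < i1)%N.
  rewrite ltnNge; apply/negP => adj.
  have A01 : 0 <= A i1 - A i0 <= E i1 - E i0 := prof_Ale i01.
  have E01 : E i1 <= E i0 + d * E i0.
    have := slow i0 (leqnn _); have := prof_le adj; lra.
  have c1 := @aE i0 a' (ltW a0) (ltW (lt_trans ab b'1)) (leqnn _).
  have c2 := @aE i0 d (ltW dp) d1 (leqnn _).
  have key : 20 * d * E i0 <= (b' - a') * E i0 by rewrite ler_wpM2r // ltW.
  have c4 : 0 < d * E i0 by apply: mulr_gt0.
  case: cross => [[_ [_ [h0 h1]]]|[_ [_ [h0 h1]]]].
    have : (b' - d) * E i0 <= (b' - d) * E i1 by rewrite ler_wpM2l //; lra.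
    lra.
  have : (a' + 2 * d) * E i1 <= (a' + 2 * d) * (E i0 + d * E i0).
    by rewrite ler_wpM2l //; lra.
  have : a' * (d * E i0) <= d * E i0 by rewrite ler_piMl //; lra.
  have : d * (d * E i0) <= d * E i0 by rewrite ler_piMl //; lra.
  lra.
have [i1E j0 j1 j2 j3] : [/\ i1 = i1.-1.+1, (i0 < i0.+1 < i1)%N, (i0 < i1.-1 < i1)%N,
    (i0 <= i1.-1)%N & (i1.-1 <= i1)%N] by move: nonadj; tidy; split; lia.
have m0 := mid i0.+1 j0; have m1 := mid i1.-1 j1.
have s0 := slow i0 (leqnn _); have s1 := slow i1.-1 j2; rewrite -i1E in s1.
have n0 := inc i0; have n1 := inc i1.-1; rewrite -i1E in n1.
have e1 := Ep i1 i01; have e2 : 0 < E i1.-1 by apply: Ep.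
have e3 : E i1.-1 <= E i1 by apply: prof_le.
have e4 : E i0 <= E i0.+1 := prof_le (leqnSn _).
have d4 := dE i0 (leqnn _); have d5 := dE i1 i01; have d6 : 0 <= d * E i1.-1 by apply: dE.
have b2d : (b' + 2 * d) * (E i0 + d * E i0) <= (b' + 5 * d) * E i0.
  have : b' * (d * E i0) <= d * E i0 by rewrite ler_piMl //; lra.
  have : d * (d * E i0) <= d * E i0 by rewrite ler_piMl //; lra.
  lra.
have ends : [/\ `|A i0 - x0 * E i0| <= 5 * d * E i0, `|A i1 - x1 * E i1| <= 5 * d * E i1,
    (a' - 3 * d) * E i0 <= A i0 <= (b' + 5 * d) * E i0 &
    (a' - 3 * d) * E i1 <= A i1 <= (b' + 5 * d) * E i1].
  have key0 : 20 * d * E i0 <= (b' - a') * E i0 by rewrite ler_wpM2r // ltW.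
  have key1 : 20 * d * E i1 <= (b' - a') * E i1 by rewrite ler_wpM2r // ltW.
  have dm : d * E i1.-1 <= d * E i1 by rewrite ler_wpM2l // ltW.
  case: cross => [[-> [-> [h0 h1]]]|[-> [-> [h0 h1]]]].
    have lo : (a' - 3 * d) * E i0 <= A i0.
      have : a' * E i0 <= a' * E i0.+1 by rewrite ler_wpM2l // ltW.
      have : d * E i0.+1 <= d * (E i0 + d * E i0) by rewrite ler_wpM2l ?(ltW dp) //; move: s0; tidy; lra.
      have : d * (d * E i0) <= d * E i0 by rewrite ler_piMl //; lra.
      lra.
    have hi : A i1 <= (b' + 5 * d) * E i1.
      have : (b' + 2 * d) * E i1.-1 <= (b' + 2 * d) * E i1 by rewrite ler_wpM2l //; lra.
      lra.
    by split; rewrite ?ler_norml; move: lo hi h0 h1 d4 d5 key0 key1; tidy; lra.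
  have hi : A i0 <= (b' + 5 * d) * E i0.
    have : (b' + 2 * d) * E i0.+1 <= (b' + 2 * d) * (E i0 + d * E i0).
      by rewrite ler_wpM2l //; lra.
    lra.
  have lo : (a' - 3 * d) * E i1 <= A i1.
    have : a' * (d * E i1.-1) <= d * E i1.-1 by rewrite ler_piMl //; lra.
    have : a' * E i1 <= a' * (E i1.-1 + d * E i1.-1) by rewrite ler_wpM2l //; lra.
    lra.
  by split; rewrite ?ler_norml; move: lo hi h0 h1 d4 d5 key0 key1; tidy; lra.
have [g0 g1' g2 g3] := ends; split => // i /andP[].
rewrite leq_eqVlt => /predU1P[<- //|h0]; rewrite leq_eqVlt => /predU1P[-> //|h1].
have := mid i; rewrite h0 h1 => /(_ isT); have := dE i (ltnW h0); tidy; lra.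
Qed.

(* Between r0 and r1 the path stays strictly between the lines of slopes a' and
   b', so that it cannot meet a switch, and its slope is constant. *)
Lemma gap e : 0 < e -> exists N : nat, forall x0 x1 r0 r1, (N <= r0)%N -> (r0 < r1)%N ->
  crossing x0 x1 r0 r1 ->
  (forall r, (r0 < r < r1)%N -> a' * lg r <= llb r <= b' * lg r) ->
  exists i, `|(x1 - sg i) * lg r1 - (x0 - sg i) * lg r0| <= e * lg r1.
Proof.
move=> e0; have [[aa ab bb a0] [b1 d0 dg g1]] := ranges.
have b'1 : b' < 1 := lt_le_trans bb b1.
have l2 : 0 < ln 2 :> R by rewrite ln_gt0 // ltr1n.
(* The errors below are small multiples of d; 20 d stays below every margin to be respected. *)
have [d [dp d1 dba [da db de']]] : exists d : R, [/\ 0 < d, d <= 1, 20 * d <= b' - a' &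
    [/\ 20 * d <= a' - al, 20 * d <= be - b' & 20 * d <= e]].
  exists (Order.min 1 (Order.min (b' - a') (Order.min (a' - al) (Order.min (be - b') e))) / 20).
  have h (x : R) : 20 * (x / 20) = x by field.
  rewrite !h ler_pdivrMr // mul1r !ge_min !lexx ?orbT /=.
  by split => //; [rewrite divr_gt0 // !lt_min ltr01 !subr_gt0 ab aa bb e0 | rewrite ler1n].
have [N1 h1] := prof_slow prof dp; have [N2 h2] := prof_apx prof dp.
have [N3 h3] := window dp; have [N4 h4] := switch dp.
have [N hN] := track (maxn 1 (maxn N1 (maxn N2 (maxn N3 N4)))) dp.
exists N => x0 x1 r0 r1 Nr0 r01 cross mid.
have [i0 [+ /andP[l0 l0'] b0 y0 z0]] := hN r0 Nr0.
have [i1 [_ /andP[l1 l1'] b1' y1 z1]] := hN r1 (leq_trans Nr0 (ltnW r01)).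
rewrite !geq_max => /and5P[i0p N1i N2i N3i N4i].
have lg01 : lg r0 <= lg r1 by rewrite leNgt; apply/negP => /lg_lt; rewrite ltnNge ltnW.
have i01 : (i0 <= i1)%N.
  by rewrite leqNgt; apply/negP => lt; have := prof_le lt; lra.
have E0 : 0 < E i0 by have := prof_le i0p; have := prof_step prof 0; rewrite (prof_E0 prof); lra.
have E01 := prof_le i01.
have Y0 := y0; have Y1 := y1; rewrite !ler_norml in Y0 Y1.
have [g0 g1' g2] : [/\ `|A i0 - x0 * E i0| <= 5 * d * E i0,
    `|A i1 - x1 * E i1| <= 5 * d * E i1 &
    forall i, (i0 <= i <= i1)%N -> (a' - 3 * d) * E i <= A i <= (b' + 5 * d) * E i].
  apply: gap_ratio => //.
  - by move=> i i0i; apply: h1; apply: leq_trans i0i.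
  - move=> i /andP[i0i ii1]; have [r /andP[r1' r2]] := sample i.
    have st := prof_step prof i.
    have N1i' : (N1 <= i)%N by apply: leq_trans (ltnW i0i).
    have sl := h1 i N1i'.
    have [|_ ap] := h2 i (leq_trans N2i (ltnW i0i)) r; first by move: st r1' r2; tidy; lra.
    have rr : (r0 < r < r1)%N.
      apply/andP; split; apply: lg_lt; first by have := prof_le i0i; move: l0' r1'; tidy; lra.
      by have := prof_le ii1; move: st r2 l1; tidy; lra.
    have /andP[m1 m2] := mid r rr; move: ap; rewrite ler_norml => /andP[p1 p2].
    have Ei : 0 < E i by have := prof_le (ltnW i0i); move: E0; tidy; lra.
    have : a' * E i <= a' * lg r by rewrite ler_wpM2l // ltW.
    have b'0 : 0 <= b' by rewrite ltW // (lt_trans a0).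
    have : b' * lg r <= b' * (E i + d * E i) by rewrite ler_wpM2l //; move: r2 st sl; tidy; lra.
    have : b' * (d * E i) <= d * E i by rewrite ler_piMl ?mulr_ge0 ?ltW.
    move: m1 m2 p1 p2; tidy; lra.
  have up r i : E i <= lg r -> lg r <= (1 + d) * E i -> 0 < E i ->
      a' * lg r <= a' * E i + d * E i /\ b' * E i <= b' * lg r.
    move=> q1 q2 Ei; split; last by rewrite ler_wpM2l // (ltW (lt_trans a0 ab)).
    have : a' * lg r <= a' * ((1 + d) * E i) by rewrite ler_wpM2l // ltW.
    have : a' * (d * E i) <= d * E i by rewrite ler_piMl ?mulr_ge0 ?ltW // (lt_trans ab).
    tidy; lra.
  have [u1 u2] := up r0 i0 l0 z0 E0; have [u3 u4] := up r1 i1 l1 z1 (lt_le_trans E0 E01).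
  by case: cross => [[-> [-> [c0 c1]]]|[-> [-> [c0 c1]]]]; [left|right]; do !split => //;
    move: c0 c1 Y0 Y1 u1 u2 u3 u4; tidy; lra.
have nosw k : (i0 <= k < i1)%N -> sg k.+1 = sg k.
  move=> /andP[k0 k1]; apply: contrapT => ne.
  have Ek : 0 < E k.+1 by have := prof_le (leqW k0); move: E0; tidy; lra.
  have := g2 k.+1; rewrite (leqW k0) k1 => /(_ isT) /andP[q1 q2].
  have c1 : (al + d) * E k.+1 < (a' - 3 * d) * E k.+1 by rewrite ltr_pM2r //; move: da dp; tidy; lra.
  have c2 : (b' + 5 * d) * E k.+1 < (be - d) * E k.+1 by rewrite ltr_pM2r //; move: db dp; tidy; lra.
  by have [] := h4 k (leq_trans N4i k0) ne; move: c1 c2 q1 q2; tidy; lra.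
have cst k : (i0 <= k < i1)%N -> sg k = sg i0.
  move=> /andP[]; elim: k => [|k IH]; first by rewrite leqn0 => /eqP ->.
  rewrite leq_eqVlt => /predU1P[<- //|k0] k1.
  by rewrite nosw ?IH // ?k0 ?(ltnW k1) // -ltnS k0.
have win := h3 i0 i1 N3i i01 cst; set s := sg i0 in win *; rewrite ler_norml in win.
exists i0; rewrite -/s; move: g0 g1'; rewrite !ler_norml.
have s01 : 0 < s <= 1 by rewrite /s; case: (sgE i0) => ->; move: d0 dg g1; tidy; lra.
have x01 : 0 < x0 < 1 /\ 0 < x1 < 1.
  by case: cross => [[-> [-> _]]|[-> [-> _]]]; move: a0 ab b'1; tidy; lra.
have bnd (x t : R) : 0 < x < 1 -> 0 <= t -> - t <= (x - s) * t <= t.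
  move=> x1' t0; have : `|(x - s) * t| <= t.
    by rewrite normrM (ger0_norm t0) ler_piMl // ler_norml; move: x1' s01; tidy; lra.
  by rewrite ler_norml.
have B0 := bnd x0 (lg r0 - E i0) x01.1 (_ : 0 <= lg r0 - E i0).
have {}B0 := B0 (_ : is_true (0 <= lg r0 - E i0)); rewrite subr_ge0 in B0; have {}B0 := B0 l0.
have B1 := bnd x1 (lg r1 - E i1) x01.2; rewrite subr_ge0 in B1; have {}B1 := B1 l1.
have dE : d * E i0 <= d * E i1 by rewrite ler_wpM2l // ltW.
have eE : 20 * (d * E i1) <= e * lg r1.
  rewrite mulrA; apply: (@le_trans _ _ (e * E i1)); first by rewrite ler_wpM2r // ltW // (lt_le_trans E0).
  by rewrite ler_wpM2l // ltW.
move: B0 B1 dE eE z0 z1 win; tidy; lra.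
Qed.

End Slopes.

End Profile.

Section Limits.
Import Order.TTheory GRing.Theory Num.Theory.
Import numFieldNormedType.Exports.
Local Open Scope classical_set_scope.
Local Open Scope ring_scope.
Variable R : realType.

Lemma ratio_cvg (l0 l1 : nat -> R) p q : 0 < p -> 0 < q ->
  (exists N, forall i, (N <= i)%N -> 0 < l0 i /\ 0 < l1 i) ->
  (forall e, 0 < e -> exists N, forall i, (N <= i)%N -> `|p * l1 i - q * l0 i| <= e * l1 i) ->
  l1 i / l0 i @[i --> \oo] --> q / p.
Proof.
move=> p0 q0 [N0 pos] app; apply/cvgrPdist_le => t t0.
have [e [e0 ep et]] : exists e : R, [/\ 0 < e, 2 * e <= p & e * (2 * q) <= t * p * p].
  exists (Order.min (p / 2) (t * p * p / (2 * q))).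
  split; first by rewrite lt_min !divr_gt0 ?mulr_gt0.
    have : Order.min (p / 2) (t * p * p / (2 * q)) <= p / 2 by rewrite ge_min lexx.
    lra.
  by rewrite -ler_pdivlMr ?mulr_gt0 // ge_min lexx orbT.
have [N hN] := app e e0; exists (maxn N0 N) => // i /=; rewrite geq_max => /andP[/pos[x0 x1] /hN].
set x := l0 i in x0 *; set y := l1 i in x1 * => h.
have py : p * y <= 2 * (q * x).
  have : 2 * e * y <= p * y by rewrite ler_wpM2r // ltW.
  by move: h; rewrite ler_norml; lra.
have -> : q / p - y / x = (q * x - p * y) / (p * x).
  by field; rewrite !gt_eqF.
rewrite normrM normfV (gtr0_norm (mulr_gt0 p0 x0)) ler_pdivrMr ?mulr_gt0 // distrC.
apply: (le_trans h); rewrite -(ler_pM2l p0).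
have : e * (p * y) <= e * (2 * (q * x)) by rewrite ler_pM2l.
have : e * (2 * q) * x <= t * p * p * x by rewrite ler_pM2r.
lra.
Qed.

Lemma near_corner (al be : R) (P : R * R -> Prop) d : 0 < d ->
  (forall x, al < x.1 < al + d -> be - d < x.2 < be -> P x) ->
  \forall x \near (al^'+, be^'-), P x.
Proof.
move=> d0 h; exists ([set x | al < x < al + d], [set x | be - d < x < be]) => /=.
  split.
    near=> x; apply/andP; split; near: x; first exact: nbhs_right_gt.
    by apply: nbhs_right_lt; rewrite ltrDl.
  near=> x; apply/andP; split; near: x; last exact: nbhs_left_lt.
  by apply: nbhs_left_gt; rewrite gtrBl.
by move=> x [] /= h1 h2; apply: h.
Unshelve. all: by end_near.
Qed.

(* The two pseudo period exponents are limits of such fractions, with s the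
   extreme slope reached between the two barriers. *)
Lemma corner_cvg (f g : R * R -> R) (al be u v : R) :
  (forall e, 0 < e -> exists2 d, 0 < d &
     forall x, al < x.1 < al + d -> be - d < x.2 < be ->
       [/\ `|u - f x| <= e, `|v - g x| <= e & 0 < g x]) -> 0 < u -> 0 <= v ->
  exists l : \bar R, (f x / g x)%:E @[x --> (al^'+, be^'-)] --> l /\
    l = if v == 0 then +oo%E else (u / v)%:E.
Proof.
move=> fg u0 v0; eexists; split; last reflexivity.
case: eqVneq => [v00|vn].
  apply/cvgeyPge => B.
  have [e [e0 eu eB]] : exists e : R, [/\ 0 < e, 2 * e <= u & 2 * e * B <= u].
    exists (Order.min (u / 2) (u / (2 * (`|B| + 1)))).
    have B1 : 0 < `|B| + 1 by rewrite ltr_wpDl.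
    have h0 : 0 < Order.min (u / 2) (u / (2 * (`|B| + 1))).
      by rewrite lt_min !divr_gt0 ?mulr_gt0.
    split=> //.
      have : Order.min (u / 2) (u / (2 * (`|B| + 1))) <= u / 2 by rewrite ge_min lexx.
      lra.
    set m := Order.min _ _ in h0 *.
    have : m * (2 * (`|B| + 1)) <= u.
      by rewrite -ler_pdivlMr ?mulr_gt0 // ge_min lexx orbT.
    have : m * B <= m * `|B| by rewrite ler_pM2l // ler_norm.
    lra.
  have [d d0 hd] := fg e e0; apply: (near_corner d0) => x x1 x2.
  have [] := hd x x1 x2; rewrite v00 sub0r normrN => h1 h2 g0; rewrite lee_fin.
  rewrite ler_pdivlMr //; move: h1 h2; rewrite !ler_norml => /andP[h1 h1'] /andP[h2 h2'].
  have [B0|B0] := ltP B 0; first by have : B * g x < 0 by [rewrite pmulr_llt0]; lra.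
  have : B * g x <= B * e by rewrite ler_wpM2l.
  lra.
have vp : 0 < v by rewrite lt0r vn.
apply: cvg_EFin; first by near=> x.
have cv (h : R * R -> R) w : (forall e, 0 < e -> exists2 d, 0 < d &
     forall x, al < x.1 < al + d -> be - d < x.2 < be -> `|w - h x| <= e) ->
  h x @[x --> (al^'+, be^'-)] --> w.
  move=> hw; apply/cvgrPdist_le => e e0; have [d d0 hd] := hw e e0.
  exact: (near_corner d0).
apply: cvgM.
  by apply: cv => e /fg[d d0 hd]; exists d => // x x1 x2; have [] := hd x x1 x2.
apply: cvgV => //.
by apply: cv => e /fg[d d0 hd]; exists d => // x x1 x2; have [] := hd x x1 x2.
Unshelve. all: by end_near.
Qed.

Variables (b : nat -> nat) (E A : nat -> R).

Local Notation lg r := (ln r%:R : R).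
Local Notation llb r := (ln (ln (b r)%:R) : R).

Hypothesis prof : profile b E A.

Lemma growth_exponent s : 0 <= s ->
  (forall e, 0 < e -> exists N, forall i, (N <= i)%N -> `|A i - s * E i| <= e * E i) ->
  has_growth_exponent b s.
Proof.
move=> s0 h; apply/cvgrPdist_le => t t0.
pose e := t / (2 + s); have s2 : 0 < 2 + s by lra.
have e0 : 0 < e by rewrite divr_gt0.
have et : e * (2 + s) = t by rewrite divfK // gt_eqF.
have [N1 h1] := h e e0; have [N hN] := track prof (maxn 1 N1) e0.
exists N => // r /= /hN[i []]; rewrite geq_max => /andP[i0 /h1 + /andP[l0 _] _ + l1].
have E0 : 0 < E i.
  have l2 : 0 < ln 2 :> R by rewrite ln_gt0 // ltr1n.
  by have := prof_lt prof i0; rewrite (prof_E0 prof); lra.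
have r0 : 0 < lg r by lra.
have -> : s - llb r / lg r = (s * lg r - llb r) / lg r by field; rewrite gt_eqF.
rewrite normrM normfV (gtr0_norm r0) ler_pdivrMr // !ler_norml -et.
have : s * lg r <= s * ((1 + e) * E i) by rewrite ler_wpM2l.
have : s * E i <= s * lg r by rewrite ler_wpM2l.
have : e * E i <= e * lg r by rewrite ler_pM2l.
have : s * (e * E i) <= s * (e * lg r) by rewrite ler_wpM2l // ler_pM2l.
lra.
Qed.

Variables (al be ga de : R) (sg : nat -> R).
Hypothesis sgE : forall i, sg i = de \/ sg i = ga.
Hypothesis window : forall e, 0 < e -> exists N, forall i j, (N <= i)%N -> (i <= j)%N ->
  (forall k, (i <= k < j)%N -> sg k = sg i) ->
  `|(A j - A i) - sg i * (E j - E i)| <= e * E j.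
Hypothesis switch : forall e, 0 < e -> exists N, forall i, (N <= i)%N ->
  sg i.+1 <> sg i -> A i.+1 <= (al + e) * E i.+1 \/ (be - e) * E i.+1 <= A i.+1.
Hypothesis low : forall e M, 0 < e -> exists2 i : nat, (M <= i)%N & A i <= (al + e) * E i.
Hypothesis high : forall e M, 0 < e -> exists2 i : nat, (M <= i)%N & (be - e) * E i <= A i.
Hypotheses (d0 : 0 < de) (da : de <= al) (ab : al < be) (bg : be <= ga) (g1 : ga <= 1).

Section Barriers.
Variables (a' b' : R).
Hypotheses (aa : al < a') (ab' : a' < b') (bb : b' < be).

Lemma visit e M : 0 < e -> exists N, forall i, (N <= i)%N -> exists r,
  [/\ (2 <= r)%N, (M <= r)%N, 0 < ln (b r)%:R :> R,
    `|llb r - A i| <= e * E i & [&& 0 <= E i, E i <= lg r & lg r <= (1 + e) * E i]].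
Proof.
move=> e0; have [N1 h1] := prof_slow prof e0; have [N2 h2] := prof_apx prof e0.
have [i0 hi0] := prof_unbounded prof (Order.max (lg 2) (lg M)).
exists (maxn i0 (maxn N1 N2)) => i; rewrite !geq_max => /and3P[/(prof_le prof) i0i /h1 s1 /h2 s2].
have [r r12] := sample prof i; have st := prof_step prof i.
have [|p1 p2] := s2 r; first by lra.
move: hi0; rewrite gt_max => /andP[hi2 hiM].
have := prof_AE prof i; exists r; split => //.
- by apply: ltnW; apply: (@lg_lt R); lra.
- by apply: ltnW; apply: (@lg_lt R); lra.
- by apply/and3P; split; lra.
Qed.

Lemma upper_unbounded : unbounded (@upper_set R b b').
Proof.
move=> M; have ? := bb; have ? := aa; have ? := ab'; have ? := d0; have ? := da; have ? := g1; have ? := bg.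
pose e := (be - b') / 3; have e0 : 0 < e by rewrite divr_gt0 ?subr_gt0.
have e3 : be - b' = 3 * e by rewrite /e; field.
have [N hN] := visit M e0; have [i Ni hi] := high N e0.
have [r [r2 Mr b0 + /and3P[E0 l0 l1]]] := hN i Ni; rewrite ler_norml => /andP[l2 _].
exists r => //; apply/upper_setE => //.
have : b' * lg r <= b' * ((1 + e) * E i) by rewrite ler_wpM2l //; lra.
have : b' * (e * E i) <= e * E i by rewrite ler_piMl ?(mulr_ge0 (ltW e0)) //; lra.
have : (be - b') * E i = 3 * e * E i by rewrite e3.
lra.
Qed.

Lemma lower_unbounded : unbounded (@lower_set R b a').
Proof.
move=> M; have ? := bb; have ? := aa; have ? := ab'; have ? := d0; have ? := da; have ? := g1; have ? := bg.
pose e := (a' - al) / 3; have e0 : 0 < e by rewrite divr_gt0 ?subr_gt0.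
have e3 : a' - al = 3 * e by rewrite /e; field.
have [N hN] := visit M e0; have [i Ni hi] := low N e0.
have [r [r2 Mr b0 + /and3P[E0 l0 l1]]] := hN i Ni; rewrite ler_norml => /andP[_ l2].
exists r => //; apply/lower_setE => //.
have : a' * E i <= a' * lg r by rewrite ler_wpM2l //; lra.
have : (a' - al) * E i = 3 * e * E i by rewrite e3.
have : 0 <= e * E i by rewrite (mulr_ge0 (ltW e0)).
lra.
Qed.

Lemma upper_lower_disjoint n : @upper_set R b b' n -> @lower_set R b a' n -> False.
Proof.
move=> [n2 h1] [_ h2]; suff : (n%:R `^ a' : R) < n%:R `^ a' by rewrite ltxx.
apply: lt_le_trans (le_trans h1 h2); rewrite /powR pnatr_eq0 gtn_eqF ?(leq_trans _ n2) //.
by rewrite ltr_expR ltr_pM2r // ln_gt0 // ltr1n.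
Qed.

(** By the last hypothesis the direction of the crossing fixes the slope, so [gap] yields the
    estimate that [ratio_cvg] needs; the sign of x1 - s is moved out to get positive
    coefficients. *)
Lemma crossing_cvg x0 x1 (r0 r1 : nat -> nat) s : 0 < (x0 - s) / (x1 - s) ->
  x1 != s ->
  (forall i, (i <= r0 i < r1 i)%N) ->
  (exists N, forall i, (N <= i)%N -> crossing b a' b' x0 x1 (r0 i) (r1 i)) ->
  (exists N, forall i r, (N <= i)%N -> (r0 i < r < r1 i)%N -> a' * lg r <= llb r <= b' * lg r) ->
  (forall t l0 l1, (t = de \/ t = ga) -> 0 < l0 -> l0 <= l1 ->
     `|(x1 - t) * l1 - (x0 - t) * l0| < (b' - a') * l1 -> t = s) ->
  lg (r1 i) / lg (r0 i) @[i --> \oo] --> (x0 - s) / (x1 - s).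
Proof.
move=> q0 x1s r01 [N1 cr] [N2 mid] uniq.
have ? := bb; have ? := aa; have ? := ab'; have ? := d0; have ? := da; have ? := g1; have ? := bg; have ? := ab.
have a0 : 0 < a' by lra.
have b1 : be <= 1 by lra.
have dg : de <= ga by lra.
have pos i : (2 <= i)%N -> 0 < lg (r0 i) /\ lg (r0 i) <= lg (r1 i).
  move=> i2; have /andP[ir rr] := r01 i.
  have r02 : (2 <= r0 i)%N by apply: leq_trans ir.
  split; first by rewrite ln_gt0 // ltr1n.
  by rewrite ler_ln ?posrE ?ltr0n ?ler_nat; move: r02 rr; tidy; lia.
have gp : forall e, 0 < e -> _ := gap prof sgE window switch
  (conj (And4 aa ab' bb a0) (And4 b1 d0 dg g1)).
have -> : (x0 - s) / (x1 - s) = (x0 - s) * Num.sg (x1 - s) / `|x1 - s|.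
  by rewrite normrEsg; field; rewrite sgr_eq0 subr_eq0 x1s.
apply: ratio_cvg.
- by rewrite normr_gt0 subr_eq0.
- have : 0 < (x0 - s) / (x1 - s) * (x1 - s) ^+ 2.
    by rewrite mulr_gt0 // exprn_even_gt0 //= subr_eq0.
  have -> : (x0 - s) / (x1 - s) * (x1 - s) ^+ 2 = (x0 - s) * (x1 - s).
    by field; rewrite subr_eq0.
  by rewrite [x1 - s in X in X -> _]numEsg mulrA pmulr_lgt0 // normr_gt0 subr_eq0.
- by exists 2 => i /pos[]; split => //; lra.
move=> e e0; pose e' := Order.min e ((b' - a') / 2).
have e'0 : 0 < e' by rewrite lt_min e0 divr_gt0 ?subr_gt0.
have [N hN] := gp e' e'0; exists (maxn 2 (maxn N (maxn N1 N2))) => i.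
rewrite !geq_max => /and4P[i2 Ni N1i N2i]; have /andP[ir rr] := r01 i.
have [k hk] := hN x0 x1 (r0 i) (r1 i) (leq_trans Ni ir) rr (cr i N1i) (fun r => mid i r N2i).
have [p0 p1] := pos i i2.
have e1 : e' <= e by rewrite ge_min lexx.
have e2 : e' * 2 <= b' - a' by rewrite -ler_pdivlMr // ge_min lexx orbT.
have l1 : 0 < lg (r1 i) by lra.
have sk : sg k = s.
  apply: (uniq _ (lg (r0 i)) (lg (r1 i))) => //.
  apply: (le_lt_trans hk); rewrite ltr_pM2r //; lra.
rewrite sk in hk; rewrite (normrEsg (x1 - s)); set w := Num.sg _.
have -> : w * (x1 - s) * lg (r1 i) - (x0 - s) * w * lg (r0 i) =
  w * ((x1 - s) * lg (r1 i) - (x0 - s) * lg (r0 i)) by ring.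
rewrite normrM normr_sg subr_eq0 x1s mul1r; apply: (le_trans hk).
by rewrite ler_pM2r.
Qed.

Lemma exponents :
  is_upper_exponent b a' b' ((ga - a') / (ga - b'))%:E /\
  is_lower_exponent b a' b' ((b' - de) / (a' - de))%:E.
Proof.
have ? := bb; have ? := aa; have ? := ab'; have ? := d0; have ? := da; have ? := g1; have ? := bg; have ? := ab.
have [Us [Ls [alt up dn]]] := alternating_exists upper_unbounded lower_unbounded upper_lower_disjoint.
have [N hN] := track prof 0 ltr01.
have b0 r : (N <= r)%N -> 0 < ln (b r)%:R :> R by move=> /hN[i []].
have two (V W : set nat) i t s : (maxn 2 N <= i)%N -> (i <= t)%N /\ consecutive V W t s ->
    [/\ (2 <= t)%N, (2 <= s)%N, 0 < ln (b t)%:R :> R & 0 < ln (b s)%:R :> R].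
  rewrite geq_max => /andP[i2 Ni] [it [_ _ ts _]].
  by split; try (apply: b0); move: i2 Ni it ts; tidy; lia.
have md r : (maxn 2 N <= r)%N -> ~ @lower_set R b a' r -> ~ @upper_set R b b' r ->
    a' * lg r <= llb r <= b' * lg r.
  rewrite geq_max => /andP[r2 /b0 br0] nL nU; apply/andP; split; rewrite leNgt; apply/negP.
    by move=> /ltW/(lower_setE _ r2 br0).
  by move=> /ltW/(upper_setE _ r2 br0).
split; exists Us, Ls; split => //; apply/esym; apply: (cvg_limn_einf_sup _).2.
  have -> : (ga - a') / (ga - b') = (a' - ga) / (b' - ga).
    by rewrite -[RHS](mulrNN _ ) -invrN !opprB.
  apply: cvg_EFin; first by near=> i.
  apply: (@crossing_cvg a' b' (fun i => max_of (Ls i)) (fun i => min_of (Us i.+1))).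
  - by rewrite -mulrNN -invrN !opprB divr_gt0 ?subr_gt0; lra.
  - by rewrite lt_eqF //; lra.
  - by move=> i; have [-> []] := up i.
  - exists (maxn 2 N) => i iN; have [t2 s2 bt bs] := two _ _ _ _ _ iN (up i).
    have [_ [h1 h2 _ _]] := up i.
    by left; do !split => //; [apply/(lower_setE _ t2 bt) | apply/(upper_setE _ s2 bs)].
  - exists (maxn 2 N) => i r iN ir; have [ii [_ _ _ /(_ r ir)[nL nU]]] := up i.
    by apply: md => //; move: iN ii ir; tidy; lia.
  (* Being less than both barrier slopes, the slope de cannot lead up from the line of slope a' to
     that of slope b'. *)
  - move=> t l0 l1 [->|-> //] l00 l01; rewrite ltr_norml => /andP[_].
    have : (a' - de) * l0 <= (a' - de) * l1 by rewrite ler_wpM2l //; lra.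
    lra.
apply: cvg_EFin; first by near=> i.
apply: (@crossing_cvg b' a' (fun i => max_of (Us i)) (fun i => min_of (Ls i))).
- by rewrite divr_gt0 ?subr_gt0; lra.
- by rewrite gt_eqF //; lra.
- by move=> i; have [-> []] := dn i.
- exists (maxn 2 N) => i iN; have [t2 s2 bt bs] := two _ _ _ _ _ iN (dn i).
  have [_ [h1 h2 _ _]] := dn i.
  by right; do !split => //; [apply/(upper_setE _ t2 bt) | apply/(lower_setE _ s2 bs)].
- exists (maxn 2 N) => i r iN ir; have [ii [_ _ _ /(_ r ir)[nL nU]]] := dn i.
  by apply: md => //; move: iN ii ir; tidy; lia.
- move=> t l0 l1 [-> //|->] l00 l01; rewrite ltr_norml => /andP[+ _].
  have : (ga - b') * l0 <= (ga - b') * l1 by rewrite ler_wpM2l //; lra.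
  lra.
Unshelve. all: by end_near.
Qed.

End Barriers.

Lemma pseudo_periods : exists u l : \bar R,
  [/\ is_upper_pseudo_period b al be u, is_lower_pseudo_period b al be l,
      (u <= ((ga - be)%:E)^-1)%E & (l <= ((al - de)%:E)^-1)%E].
Proof.
have ? := d0; have ? := da; have ? := g1; have ? := bg; have ? := ab.
have close : \forall x \near (al^'+, be^'-), is_upper_exponent b x.1 x.2 ((ga - x.1) / (ga - x.2))%:E /\
    is_lower_exponent b x.1 x.2 ((x.2 - de) / (x.1 - de))%:E.
  apply: (@near_corner _ _ _ ((be - al) / 2)); first by rewrite divr_gt0 ?subr_gt0.
  by move=> x /andP[x1 x1'] /andP[x2 x2']; apply: exponents => //; lra.
have [u [cu uE]] : exists l : \bar R,
    ((ga - x.1) / (ga - x.2))%:E @[x --> (al^'+, be^'-)] --> l /\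
    l = if ga - be == 0 then +oo%E else ((ga - al) / (ga - be))%:E.
  apply: (@corner_cvg (fun x => ga - x.1) (fun x => ga - x.2)); [|lra..].
  move=> e e0; exists e => // x /andP[x1 x1'] /andP[x2 x2'].
  by split; rewrite ?ler_norml; lra.
have [l [cl lE]] : exists l : \bar R,
    ((x.2 - de) / (x.1 - de))%:E @[x --> (al^'+, be^'-)] --> l /\
    l = if al - de == 0 then +oo%E else ((be - de) / (al - de))%:E.
  apply: (@corner_cvg (fun x => x.2 - de) (fun x => x.1 - de)); [|lra..].
  move=> e e0; exists e => // x /andP[x1 x1'] /andP[x2 x2'].
  by split; rewrite ?ler_norml; lra.
exists u, l; split.
- by exists (fun x y => ((ga - x) / (ga - y))%:E) => //; apply: filterS close => x [].
- by exists (fun x y => ((y - de) / (x - de))%:E) => //; apply: filterS close => x [].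
(* The numerator ga - al is at most 1; if ga = be, both sides are infinite. *)
- rewrite uE inver; case: eqVneq => // n; rewrite lee_fin ler_piMl ?invr_ge0; lra.
- rewrite lE inver; case: eqVneq => // n; rewrite lee_fin ler_piMl ?invr_ge0; lra.
Qed.

End Limits.

(** * Slopes of the blocks *)

Lemma bstart_le_add d j : bstart (j + d) <= bstart j + d * blen (j + d).
Proof.
elim: d => [|d IH]; first by rewrite !addn0.
rewrite addnS bstartS -/(blen _); have := @blen_mono (j + d) (j + d).+1 (leqnSn _).
move: IH; rewrite !mulSn; move: (blen _) (blen _.+1) => x y IH xy.
have : d * x <= d * y by rewrite leq_mul2l xy orbT.
lia.
Qed.

Lemma bstart_ge_add d j : bstart j + d * blen j <= bstart (j + d).
Proof.
elim: d => [|d IH]; first by rewrite !addn0.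
rewrite addnS bstartS -/(blen _) mulSn.
by have := @blen_mono j (j + d) (leq_addr _ _); move: IH; lia.
Qed.

Lemma cube_le_pow t : 10 <= t -> (9 * t + 19) ^ 3 <= 6 * (2 ^ t) ^ 2 /\ 9 * t + 17 <= 2 ^ t.
Proof.
elim: t => // t IH; rewrite leq_eqVlt => /predU1P[<-|t10]; first by split; rewrite !expnS !expn0; lia.
have [{IH} h1 h2] := IH t10; split; last by rewrite expnS; lia.
apply: (@leq_trans (4 * (6 * (2 ^ t) ^ 2))); last by rewrite !expnS !expn0; lia.
apply: leq_trans (leq_mul (leqnn 4) h1).
have [x xE] : exists x, x = 9 * t + 19 by eexists.
have -> : 9 * t.+1 + 19 = x + 9 by lia.
rewrite -xE -(leq_pmul2l (isT : 0 < 8)).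
have -> : 8 * (x + 9) ^ 3 = (2 * (x + 9)) ^ 3 by rewrite !expnS !expn0; lia.
apply: (@leq_trans ((3 * x) ^ 3)); first by rewrite leq_exp2r //; lia.
by rewrite expnMn mulnA leq_mul2r orbC.
Qed.

(** Going back 17 blocks pays for the losses in [lower_growth]: 15 blocks for [15 * blen j] and 2
    for [bstart h.+1]. The witness is h = 9 t + 17 with 2^t <= j < 2^(t+1), because 2^h = 2^8 *
    (2^(t+1))^9 exceeds the product of three factors of order j^3. *)
Lemma room i (j := i - 17) : 2 ^ 10 + 17 <= i -> exists h, [/\ h <= j,
  32 * (bstart j * ((bstart j).+1 * (bstart j).+2)) <= 2 ^ h &
  bstart j + 15 * blen j + bstart h.+1 <= bstart i].
Proof.
move=> i1; have iE : i = j + 17 by rewrite /j subnK // (leq_trans _ i1) // leq_addl.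
have j10 : 2 ^ 10 <= j by rewrite /j leq_subRL ?(leq_trans _ i1) ?leq_addl // addnC.
clearbody j; subst i; clear i1; pose t := trunc_log 2 j.
have t10 : 10 <= t by apply: trunc_log_max.
have /andP[t1 t2] : 2 ^ t <= j < 2 ^ t.+1.
  by apply: trunc_log_bounds => //; apply: leq_trans j10.
have [c1 c2] := cube_le_pow t10; exists (9 * t + 17); split.
- exact: leq_trans t1.
- have [s sE] : exists s, s = 2 ^ t.+1 by eexists.
  have k1 : bstart j <= s * s ^ 2.
    by rewrite /bstart sE leq_mul // ?leq_exp2r // ltnW.
  have s1 : 2 <= s * s ^ 2.
    by rewrite -expnS sE -expnM (@leq_exp2l 2 1) //; lia.
  have E : 2 ^ (9 * t + 17) = 2 ^ 8 * (s * s ^ 2 * (s * s ^ 2 * (s * s ^ 2))).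
    have -> : s * s ^ 2 * (s * s ^ 2 * (s * s ^ 2)) = s ^ 9 by rewrite !expnS !expn0; ring.
    by rewrite sE -expnM -expnD; congr (_ ^ _); lia.
  rewrite E; move: (s * s ^ 2) (bstart j) k1 s1 => u k ku u2.
  apply: (@leq_trans (32 * (u * (2 * u * (2 * u))))).
    by rewrite leq_mul2l leq_mul //= leq_mul //; lia.
  by rewrite [2 ^ 8]/= !expnS expn0; lia.
- apply: leq_trans (bstart_ge_add 17 j); rewrite -addnA leq_add2l.
  have -> : 17 = 15 + 2 by [].
  rewrite mulnDl leq_add2l.
  apply: (@leq_trans ((9 * t + 19) ^ 3)).
    by rewrite /bstart [(_ + 19) ^ 3]expnS leq_mul // ?leq_exp2r //; lia.
  apply: (leq_trans c1).
  have : (2 ^ t) ^ 2 <= j ^ 2 by rewrite leq_exp2r.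
  by rewrite /blen !expnS !expn0; nia.
Qed.

Section Instances.
Import Order.TTheory GRing.Theory Num.Theory.
Local Open Scope ring_scope.

Lemma blen_small (R : realType) (e C : R) : 0 < e -> 0 <= C -> exists N, forall i,
  (N <= i)%N -> C * (blen i).+1%:R <= e * (bstart i)%:R.
Proof.
move=> e0 C0; exists (Num.truncn (5 * C / e)).+1 => i iN.
have i1 : 5 * C <= e * i%:R.
  rewrite [e * _]mulrC -ler_pdivrMr //; apply: le_trans (ltW (truncnS_gt _)) _.
  by rewrite ler_nat.
have bl : ((blen i).+1 <= 5 * i.+1 ^ 2)%N by rewrite /blen !expnS !expn0; nia.
apply: (@le_trans _ _ (C * (5 * i.+1 ^ 2)%:R)); first by rewrite ler_wpM2l // ler_nat.
rewrite /bstart; move: (i.+1 ^ 2)%N => s; rewrite !natrM !mulrA [C * _]mulrC.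
by rewrite ler_wpM2r.
Qed.

Variables (R : realType) (eta : R).
Hypotheses (eta0 : 0 < eta) (etaE : eta ^+ 3 + eta ^+ 2 + eta = 2).

Definition height i : R := ln 2 * (bstart i)%:R.

Let l2 : 0 < ln 2 :> R. Proof. by rewrite ln_gt0 // ltr1n. Qed.

Lemma ln_eta : 0 < - ln eta <= ln 2.
Proof.
rewrite -lnV ?posrE // ln_gt0 /=; last first.
  by rewrite invf_gt1 // (eta_lt1 etaE).
by rewrite ler_ln ?posrE ?invr_gt0 // (etaV_le2 eta0 etaE).
Qed.

Section Path.
Variables (F : finGroupType) (p : nat -> nat).
Hypotheses (p_gt0 : forall i, (0 < p i)%N) (p_le : forall i, (p i <= i.+1 ^ 2)%N).

Definition logrange i : R := height i + - ln eta * (rots p i)%:R.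

Lemma heightS i : height i.+1 - height i = ln 2 * (blen i)%:R.
Proof. by rewrite /height bstartS natrD mulrDr addrAC subrr add0r. Qed.

Lemma lograngeS i : logrange i.+1 - logrange i = ln 2 * (blen i)%:R + - ln eta * (3 * p i)%:R.
Proof.
rewrite -heightS /logrange /rots big_ord_recr /= [in LHS]natrD; ring.
Qed.

Lemma height_le i : height i <= logrange i.
Proof. by rewrite lerDl mulr_ge0 //; have /andP[/ltW] := ln_eta. Qed.

Lemma logrange_le i : logrange i.+1 - logrange i <= 2 * ln 2 * (blen i)%:R.
Proof.
have /andP[k0 k1] := ln_eta; rewrite lograngeS.
have : - ln eta * (3 * p i)%:R <= ln 2 * (blen i)%:R.
  by rewrite ler_pM ?(ltW k0) // ler_nat /blen; have := p_le i; lia.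
lra.
Qed.

Lemma prod_kapp_block i t : (t <= blen i)%N ->
  \prod_(j < t) kapp eta (brot p) (bstart i + j) = eta ^+ minn t (3 * p i).
Proof.
elim: t => [|t IH] ti; first by rewrite big_ord0 min0n.
rewrite big_ord_recr /= IH ?(ltnW ti) // /kapp (brotE p eta0) //.
have [h1|h1] := ltnP t (3 * p i); first by rewrite (minn_idPl h1) exprSr.
by rewrite (minn_idPr (leqW h1)) mulr1.
Qed.

Lemma prod_kapp i : \prod_(j < bstart i) kapp eta (brot p) j = eta ^+ rots p i.
Proof.
elim: i => [|i IH]; first by rewrite big_ord0 /rots big_ord0.
rewrite bstartS big_split_ord /= IH (@prod_kapp_block i (blen i)) //.
rewrite (minn_idPr _) /rots ?big_ord_recr ?exprD //.
by have := p_le i; rewrite /blen; lia.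
Qed.

Lemma path_growth_le : exists c : R, forall i r, ln r%:R <= logrange i ->
  (1 < Gamma_growth (bom p) F r)%N -> ln (ln (Gamma_growth (bom p) F r)%:R) <= c + height i.
Proof.
set K := #|{: option (bool + option (option (F * option 'I_3)))}|.
have K1 : (1 < K)%N by rewrite /K card_option card_sum card_bool.
exists (ln (22 * ln K%:R)) => i r ri g1.
have lK : 0 < ln K%:R :> R by rewrite ln_gt0 // ltr1n.
have lg : 0 < ln (Gamma_growth (bom p) F r)%:R :> R by rewrite ln_gt0 // ltr1n.
have up : (Gamma_growth (bom p) F r <= K ^ (22 * 2 ^ bstart i))%N.
  apply: (upper_growth F eta0 etaE (bom_rotates p_le)); rewrite prod_kapp.
  have [->|r0] := posnP r; first by rewrite mulr0 exprn_ge0.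
  have r0' : 0 < r%:R :> R by rewrite ltr0n.
  rewrite -ler_ln ?posrE ?mulr_gt0 ?exprn_gt0 // lnM ?posrE ?exprn_gt0 // !lnXn //.
  by move: ri; rewrite /logrange /height !mulr_natr -!(mulr_natr (ln _)); lra.
have -> : ln (22 * ln K%:R) + height i = ln ((22 * 2 ^ bstart i)%:R * ln K%:R) :> R.
  rewrite natrM natrX mulrAC [in RHS]lnM ?posrE ?mulr_gt0 ?exprn_gt0 // lnXn // /height.
  by rewrite mulr_natr.
rewrite ler_ln ?posrE ?mulr_gt0 // ?ltr0n ?muln_gt0 ?expn_gt0 //.
rewrite mulr_natl -lnXn ?ltr0n ?(ltnW K1) // -natrX ler_ln ?posrE ?ltr0n ?expn_gt0 ?ler_nat //.
  exact: ltnW.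
by rewrite (ltnW K1).
Qed.

Lemma path_growth_ge i r : (2 ^ 10 + 17 <= i)%N -> logrange i <= ln r%:R ->
  [/\ (1 < Gamma_growth (bom p) F r)%N &
  height i - 17 * (ln 2 * (blen i)%:R) - ln 2 + ln (ln 2) <=
    ln (ln (Gamma_growth (bom p) F r)%:R)].
Proof.
move=> /[dup] i17 /room[h [hj kh rm]] ri; have /andP[k0 k1] := ln_eta.
set j := (i - 17)%N in hj kh rm.
have [j0 jE] : (0 < j)%N /\ (i = j + 17)%N by rewrite /j; move: i17; clear; lia.
have r0 : 0 < r%:R :> R.
  rewrite ltr0n lt0n; apply/eqP => r0; move: ri; rewrite r0 ln0 //.
  have : 0 < height i.
    rewrite mulr_gt0 // ltr0n; apply: leq_trans (bstart_mono (_ : 0 < i)%N) => //.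
    by rewrite jE addn_gt0 j0.
  have := height_le i; lra.
have big : (2 ^ 2 ^ (bstart j).-1 <= Gamma_growth (bom p) F r)%N.
  apply: (lower_growth eta0 etaE F p_gt0 p_le hj kh _ j0).
  rewrite -ler_ln ?posrE ?mulr_gt0 ?exprn_gt0 ?invr_gt0 // lnM ?posrE ?exprn_gt0 ?invr_gt0 //.
  rewrite !lnXn ?invr_gt0 // lnV ?posrE // -[ln 2 *+ _]mulr_natr -[(- ln eta) *+ _]mulr_natr.
  apply: le_trans ri; apply: lerD; first by rewrite ler_pM2l // ler_nat.
  by rewrite ler_pM2l // ler_nat rots_mono // leq_subr.
have g1 : (1 < Gamma_growth (bom p) F r)%N.
  by apply: leq_trans big; rewrite (@leq_exp2l 2 1) // expn_gt0.
split => //.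
have bE : (bstart i <= (bstart j).-1 + 17 * blen i + 1)%N.
  by have := bstart_le_add 17 j; rewrite -jE; lia.
apply: (@le_trans _ _ (ln 2 * ((bstart j).-1)%:R + ln (ln 2))).
  rewrite lerD2r /height; have : ln 2 * (bstart i)%:R <= ln 2 * ((bstart j).-1 + 17 * blen i + 1)%:R :> R.
    by rewrite ler_pM2l // ler_nat.
  rewrite (natrD _ _ 1) (natrD _ _ (17 * blen i)) (natrM _ 17); lra.
have lg : 0 < ln (Gamma_growth (bom p) F r)%:R :> R by rewrite ln_gt0 // ltr1n.
have -> : ln 2 * ((bstart j).-1)%:R + ln (ln 2) = ln (ln (2 ^ 2 ^ (bstart j).-1)%:R) :> R.
  rewrite natrX lnXn // -[ln 2 *+ (2 ^ _)]mulr_natl lnM ?posrE ?ltr0n ?expn_gt0 //.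
  by rewrite natrX lnXn // mulr_natr.
have t0 : 0 < (2 ^ 2 ^ (bstart j).-1)%:R :> R by rewrite ltr0n expn_gt0.
rewrite ler_ln ?posrE // ?ler_ln ?posrE ?ler_nat // ?ltr0n ?(ltnW g1) //.
by rewrite ln_gt0 // ltr1n (@leq_exp2l 2 1) // expn_gt0.
Qed.

Lemma path_profile : profile (Gamma_growth (bom p) F) logrange height.
Proof.
have /andP[k0 k1] := ln_eta.
have small e C : 0 < e -> 0 <= C -> exists N, forall i, (N <= i)%N ->
    C * (blen i).+1%:R <= e * logrange i.
  move=> e0 C0; have [N hN] := blen_small (mulr_gt0 e0 l2) C0.
  exists N => i /hN h; apply: (le_trans h).
  by rewrite -mulrA ler_pM2l // height_le.
split.
- by rewrite /logrange /height /rots big_ord0 !mulr0 addr0.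
- by rewrite /height mulr0.
- move=> i; rewrite lograngeS.
  have : ln 2 * 4 <= ln 2 * (blen i)%:R :> R by rewrite ler_pM2l // ler_nat /blen; nia.
  have : 0 <= - ln eta * (3 * p i)%:R by rewrite mulr_ge0 // ltW.
  lra.
- move=> i; rewrite heightS lograngeS lerDl.
  by rewrite !mulr_ge0 // ltW.
- move=> e e0; have [|N hN] := small e (2 * ln 2) e0; first by rewrite mulr_ge0 // ltW.
  exists N => i /hN h; apply: le_trans h; apply: (le_trans (logrange_le i)).
  by rewrite ler_pM2l ?mulr_gt0 // ler_nat.
move=> e e0; have [c hc] := path_growth_le.
(* It covers 17 blocks lost in the lower bound, one block lost in the upper bound, which is taken at
   the end of block i, and the constants. *)
pose C := 18 * ln 2 + `|c| + `|ln (ln 2)| : R.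
have [|N hN] := small e C e0.
  by rewrite !addr_ge0 // mulr_ge0 // ltW.
exists (maxn (2 ^ 10 + 17) N) => i; rewrite geq_max => /andP[i17 /hN sm] r /andP[r1 r2].
have [g1 lo] := path_growth_ge i17 r1; have up := hc i.+1 r r2 g1.
split; first by rewrite ln_gt0 // ltr1n.
have hS := heightS i.
have c1 := ler_norm c; have c2 := ler_norm (- ln (ln 2) : R); rewrite normrN in c2.
have n0 : 0 <= (blen i)%:R :> R by [].
have x1 : `|c| <= `|c| * (blen i).+1%:R by rewrite ler_peMr // ler1n.
have x2 : `|ln (ln 2)| <= `|ln (ln 2)| * (blen i).+1%:R :> R by rewrite ler_peMr // ler1n.
have x3 : 0 <= ln 2 * (blen i)%:R :> R by rewrite mulr_ge0 // ltW.
have x4 := ltW l2.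
move: sm x1 x2; rewrite /C -[(blen i).+1]addn1 natrD.
have -> : (18 * ln 2 + `|c| + `|ln (ln 2)|) * ((blen i)%:R + 1) =
  18 * (ln 2 * (blen i)%:R) + 18 * ln 2 + `|c| * ((blen i)%:R + 1)
  + `|ln (ln 2)| * ((blen i)%:R + 1) :> R by ring.
move: (`|c| * _) (`|ln (ln 2)| * _) => y1 y2 sm x1 x2.
have y10 : 0 <= y1 by apply: le_trans x1.
have y20 : 0 <= y2 by apply: le_trans x2.
by rewrite ler_norml; lra.
Qed.

End Path.
End Instances.

Section Turns.
Import Order.TTheory GRing.Theory Num.Theory.
Local Open Scope ring_scope.
Variables (R : realType) (eta : R).
Hypotheses (eta0 : 0 < eta) (etaE : eta ^+ 3 + eta ^+ 2 + eta = 2).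

Definition slope_range (s : R) := ln 2 / (ln 2 - ln eta) <= s <= 1.

(* The density of rotations which gives a block the slope s. *)
Definition density (s : R) := (ln 2 / s - ln 2) / - ln eta.

(** One period 012 is kept even at density 0, so that the value b occurs in every block. *)
Definition turns (s : R) i := maxn 1 (Num.truncn (density s * (i.+1 ^ 2)%:R)).

Let l2 : 0 < ln 2 :> R. Proof. by rewrite ln_gt0 // ltr1n. Qed.

Lemma slope_range_gt0 s : slope_range s -> 0 < s.
Proof.
move=> /andP[+ _]; apply: lt_le_trans; have /andP[k0 _] := ln_eta eta0 etaE.
by rewrite divr_gt0 // addr_gt0.
Qed.

Lemma densityE s : slope_range s -> s * - ln eta * density s = ln 2 - s * ln 2.
Proof.
move=> /slope_range_gt0 s0; have /andP[k0 _] := ln_eta eta0 etaE.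
by rewrite /density; field; rewrite -oppr_eq0 !gt_eqF.
Qed.

Lemma density_range s : slope_range s -> 0 <= density s <= 1.
Proof.
move=> /[dup] sr /andP[s1 s2]; have s0 := slope_range_gt0 sr.
have /andP[k0 _] := ln_eta eta0 etaE.
rewrite /density; apply/andP; split.
  by rewrite divr_ge0 ?(ltW k0) // subr_ge0 ler_pdivlMr // ler_piMr // ltW.
rewrite ler_pdivrMr // mul1r lerBlDr ler_pdivrMr // mulrC -ler_pdivrMr; first by rewrite addrC.
by rewrite addr_gt0.
Qed.

Lemma turns_gt0 s i : (0 < turns s i)%N.
Proof. by rewrite /turns leq_max. Qed.

Lemma turns_le s i : slope_range s -> (turns s i <= i.+1 ^ 2)%N.
Proof.
move=> /density_range/andP[d0 d1]; rewrite geq_max expn_gt0 /=.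
rewrite -(ler_nat R); have q0 : 0 <= (i.+1 ^ 2)%:R :> R by [].
have : (Num.truncn (density s * (i.+1 ^ 2)%:R))%:R <= density s * (i.+1 ^ 2)%:R.
  by rewrite truncn_le mulr_ge0.
by move/le_trans; apply; rewrite ler_piMl.
Qed.

Lemma turns_near s i : slope_range s -> `|density s * (i.+1 ^ 2)%:R - (turns s i)%:R| <= 1.
Proof.
move=> /density_range/andP[d0 d1]; rewrite /turns; move: (density s * _) (mulr_ge0 d0 (ler0n R (i.+1 ^ 2))).
move=> x x0; have t1 : (Num.truncn x)%:R <= x by rewrite truncn_le.
have := truncnS_gt x; rewrite -natr1 ler_norml.
have [h|h] := ltnP 1 (Num.truncn x); first lra.
move: h; rewrite leq_eqVlt ltnS leqn0 => /predU1P[h|/eqP h]; rewrite h in t1 *; lra.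
Qed.

(** Rounding changes the number of rotations by at most 3, and the density ignores i.+1 levels of
    the block; both errors are linear in i. *)
Lemma turns_slope s i : slope_range s ->
  `|ln 2 * (blen i)%:R - s * (ln 2 * (blen i)%:R + - ln eta * (3 * turns s i)%:R)|
    <= 4 * ln 2 * i.+1%:R.
Proof.
move=> sr; have /andP[k0 k1] := ln_eta eta0 etaE; have s0 := slope_range_gt0 sr.
have /andP[_ s1] := sr; have /andP[d0 d1] := density_range sr; have near := turns_near i sr.
have bE : (blen i)%:R = 3 * (i.+1 ^ 2)%:R + i.+1%:R :> R by rewrite /blen natrD natrM.
have -> : ln 2 * (blen i)%:R - s * (ln 2 * (blen i)%:R + - ln eta * (3 * turns s i)%:R) =
    s * - ln eta * (3 * (density s * (i.+1 ^ 2)%:R - (turns s i)%:R) + density s * i.+1%:R).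
  have dE := densityE sr.
  have : (ln 2 - s * ln 2 - s * - ln eta * density s) * (blen i)%:R = 0 by rewrite dE subrr mul0r.
  rewrite bE natrM; lra.
have i1 : 1 <= i.+1%:R :> R by rewrite ler1n.
rewrite normrM ger0_norm ?mulr_ge0 ?(ltW s0) ?(ltW k0) // [leRHS]mulrAC [4 * _ * _]mulrC.
apply: ler_pM; rewrite ?mulr_ge0 ?(ltW s0) ?(ltW k0) //.
  by apply: le_trans k1; rewrite ler_piMl // ltW.
have : 0 <= density s * i.+1%:R <= i.+1%:R by rewrite mulr_ge0 //= ler_piMl.
move: near; rewrite !ler_norml; lra.
Qed.

Section Window.
Variables (sg : nat -> R).
Hypothesis sgr : forall i, slope_range (sg i).
Let p i := turns (sg i) i.

(** The errors of [turns_slope] add up to a multiple of the length of block j, which is negligible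
    against E j. *)
Lemma slope_window e : 0 < e -> exists N, forall i j, (N <= i)%N -> (i <= j)%N ->
  (forall k, (i <= k < j)%N -> sg k = sg i) ->
  `|(height R j - height R i) - sg i * (logrange eta p j - logrange eta p i)|
     <= e * logrange eta p j.
Proof.
move=> e0; have e2 : 0 < e * ln 2 by rewrite mulr_gt0.
have [|N hN] := blen_small (C := 4 * ln 2 : R) e2; first by rewrite mulr_ge0 // ltW.
exists N => i j Ni ij cst.
apply: (@le_trans _ _ (4 * ln 2 * (blen j).+1%:R)); last first.
  apply: (le_trans (hN j (leq_trans Ni ij))); rewrite -mulrA ler_pM2l //.
  exact: (height_le eta0 etaE).
have step k : (blen k).+1%:R + k.+1%:R <= (blen k.+1).+1%:R :> R.
  by rewrite -natrD ler_nat /blen !expnS !expn0; lia.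
have l4 : 0 < 4 * ln 2 :> R by rewrite mulr_gt0.
elim: j ij cst => [|j IH].
  by rewrite leqn0 => /eqP -> _; rewrite !subrr mulr0 subr0 normr0 mulr_ge0 // ltW.
rewrite leq_eqVlt => /predU1P[-> _|ij cst].
  by rewrite !subrr mulr0 subr0 normr0 mulr_ge0 // ltW.
have sj : sg j = sg i by apply: cst; rewrite -ltnS ij ltnS leqnn.
have tj := turns_slope j (sgr j); rewrite -/(p j) -lograngeS -heightS sj in tj.
have s4 : 4 * ln 2 * ((blen j).+1%:R + j.+1%:R) <= 4 * ln 2 * (blen j.+1).+1%:R :> R.
  by rewrite (ler_pM2l l4).
have {}IH : `|height R j - height R i - sg i * (logrange eta p j - logrange eta p i)| <=
   4 * ln 2 * (blen j).+1%:R.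
  by apply: IH => // k /andP[ik kj]; apply: cst; rewrite ik ltnW.
apply: le_trans s4; rewrite [leRHS]mulrDr.
apply: (le_trans _ (le_trans (ler_normD _ _) (lerD IH tj))).
rewrite le_eqVlt; apply/orP; left; apply/eqP; congr `|_|; ring.
Qed.

End Window.
End Turns.

(** * Switching between two slopes *)

Section Hysteresis.
Import Order.TTheory GRing.Theory Num.Theory.
Local Open Scope ring_scope.
Variables (R : realType) (eta : R) (F : finGroupType).
Hypotheses (eta0 : 0 < eta) (etaE : eta ^+ 3 + eta ^+ 2 + eta = 2).

Section Steady.
Variables (sg : nat -> R).
Hypothesis sgr : forall i, slope_range eta (sg i).
Let p i := turns eta (sg i) i.
Local Notation A := (height R).
Local Notation E := (logrange eta p).

Lemma turns_profile : profile (Gamma_growth (bom p) F) E A.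
Proof.
apply: path_profile => // i; first exact: turns_gt0.
exact: turns_le.
Qed.

Lemma steady_slope i0 s e : (forall i, (i0 <= i)%N -> sg i = s) -> 0 < e ->
  exists N, forall i, (N <= i)%N -> `|A i - s * E i| <= e * E i.
Proof.
move=> cst e0; have e2 : 0 < e / 2 by rewrite divr_gt0.
have [N hN] := slope_window eta0 etaE sgr e2; pose k := maxn i0 N.
have [M hM] := prof_unbounded turns_profile (`|A k - s * E k| / (e / 2)).
exists (maxn k M) => i; rewrite geq_max => /andP[ki /(prof_le turns_profile) Mi].
have sk : sg k = s by apply: cst; rewrite leq_maxl.
have w := hN k i (leq_maxr _ _) ki; rewrite -/p sk in w.
have Ek : `|A k - s * E k| <= e / 2 * E i.
  by rewrite [leRHS]mulrC -ler_pdivrMr // (le_trans (ltW hM)).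
have -> : A i - s * E i = (A i - A k - s * (E i - E k)) + (A k - s * E k) by ring.
apply: le_trans (ler_normD _ _) _.
rewrite [e](splitr e) mulrDl lerD //; apply: w => j /andP[kj _].
by apply: cst; apply: leq_trans kj; rewrite leq_maxl.
Qed.

End Steady.

Lemma constant_growth s : slope_range eta s ->
  has_growth_exponent (Gamma_growth (bom (turns eta s)) F) s.
Proof.
move=> sr; have s0 := slope_range_gt0 eta0 etaE sr.
apply: (growth_exponent (turns_profile (sg := fun=> s) (fun=> sr))) (ltW s0) _ => e e0.
exact: (@steady_slope (fun=> s) _ 0%N).
Qed.

Variables (al be ga de : R).
Hypotheses (dr : slope_range eta de) (gr : slope_range eta ga).
Hypotheses (da : de <= al) (ab : al < be) (bg : be <= ga).

Definition slope c := if odd c then ga else de.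
(** The margin is positive because for ga = be or de = al the path may approach the line without
    ever crossing it. *)
Definition tol c : R := (be - al) / c.+1%:R.

(* The path climbs with slope ga until it is near the line of slope be, then
   follows slope de until it is near the line of slope al, with margins tending
   to 0; the state is the number of switches so far, together with the number
   of rotations. *)
Fixpoint state i : nat * nat :=
  if i is j.+1 then
    let: (c, r) := state j in
    let r' := (r + 3 * turns eta (slope c) j)%N in
    let E := height R i + - ln eta * r'%:R in
    ((c + if odd c then ((be - tol c) * E <= height R i)%R
          else (height R i <= (al + tol c) * E)%R)%N, r')
  else (0%N, 0%N).

Definition switches i := (state i).1.
Definition mixed i := turns eta (slope (switches i)) i.

Local Notation A := (height R).
Local Notation E := (logrange eta mixed).

Lemma rots_mixed i : rots mixed i = (state i).2.
Proof.
elim: i => [|i IH]; first by rewrite /rots big_ord0.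
rewrite /rots big_ord_recr /= -/(rots _ _) IH /mixed /switches.
by case: (state i).
Qed.

Lemma switchesS i : switches i.+1 = (switches i +
  if odd (switches i) then ((be - tol (switches i)) * E i.+1 <= A i.+1)%R
  else (A i.+1 <= (al + tol (switches i)) * E i.+1)%R)%N.
Proof.
rewrite /logrange rots_mixed {1}/switches /= /switches.
by case: (state i).
Qed.

Lemma switches_le i j : (i <= j)%N -> (switches i <= switches j)%N.
Proof.
elim: j => [|j IH]; first by rewrite leqn0 => /eqP ->.
rewrite leq_eqVlt => /predU1P[-> //|/IH ij]; apply: leq_trans ij _.
by rewrite switchesS leq_addr.
Qed.

Lemma switchesS_le i : (switches i.+1 <= (switches i).+1)%N.
Proof. by rewrite switchesS -[(switches i).+1]addn1 leq_add2l leq_b1. Qed.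

Lemma switches_bound i : (switches i <= i)%N.
Proof. by elim: i => // i IH; apply: leq_trans (switchesS_le i) _. Qed.

Lemma slopes i : slope_range eta (slope (switches i)).
Proof. by rewrite /slope; case: ifP. Qed.

Let prof := turns_profile slopes.

Lemma tol_gt0 c : 0 < tol c.
Proof. by rewrite divr_gt0 ?subr_gt0. Qed.

(** Otherwise the slope would be ga >= be, or de <= al, forever, and [steady_slope] would bring the
    path within the margin of the switching line. *)
Lemma switches_unbounded c : exists i, (c <= switches i)%N.
Proof.
elim: c => [|c [i ci]]; first by exists 0%N.
apply: contrapT => no.
have cst j : (i <= j)%N -> switches j = c.
  move=> ij; apply/eqP; rewrite eqn_leq (leq_trans ci (switches_le ij)) andbT.
  by rewrite leqNgt; apply/negP => cj; apply: no; exists j.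
have [|N hN] := @steady_slope (fun i => slope (switches i)) slopes i (slope c) (tol c) _ (tol_gt0 c).
  by move=> j /cst ->.
pose j := maxn i N; have ij : (i <= j)%N by rewrite leq_maxl.
have /hN : (N <= j.+1)%N by rewrite leqW // leq_maxr.
have := switchesS j; rewrite !cst ?leqW //; rewrite -/mixed ler_norml.
have E0 : 0 <= E j.+1 by have := prof_AE prof j.+1; rewrite -/mixed; lra.
have gE : be * E j.+1 <= ga * E j.+1 by rewrite ler_wpM2r.
have dE : de * E j.+1 <= al * E j.+1 by rewrite ler_wpM2r.
rewrite /slope; case: ifP => _ h w; move: h.
  by rewrite (_ : _ <= _) ?addn1; [move/eqP; rewrite ltn_eqF | lra].
by rewrite (_ : _ <= _) ?addn1; [move/eqP; rewrite ltn_eqF | lra].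
Qed.

Lemma switch_times : exists T : nat -> nat, forall c, switches (T c) = c.+1 /\
  forall l, (T c <= l)%N = (c < switches l)%N.
Proof.
suff ex c : exists t, switches t = c.+1 /\ forall l, (t <= l)%N = (c < switches l)%N.
  by have [T hT] := boolp.choice ex; exists T.
have ex : exists i, (c < switches i)%N by have [i] := switches_unbounded c.+1; exists i.
exists (ex_minn ex); case: ex_minnP => t ct tmin; split.
  apply/eqP; rewrite eqn_leq ct andbT; case: t ct tmin => [|t] ct tmin //.
  apply: leq_trans (switchesS_le t) _; rewrite ltnS leqNgt; apply/negP => /tmin.
  by rewrite ltnn.
move=> l; apply/idP/idP => [tl|/tmin //].
exact: leq_trans ct (switches_le tl).
Qed.

Lemma tol_small e : 0 < e -> exists N, forall c, (N <= c)%N -> tol c <= e.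
Proof.
move=> e0; exists (Num.truncn ((be - al) / e)).+1 => c Nc.
rewrite /tol ler_pdivrMr // mulrC -ler_pdivrMr //.
apply: le_trans (ltW (truncnS_gt _)) _; rewrite ler_nat; exact: leqW.
Qed.

Lemma mixed_pseudo_periods : 0 < de -> ga <= 1 -> exists u l : \bar R,
  [/\ is_upper_pseudo_period (Gamma_growth (bom mixed) F) al be u,
      is_lower_pseudo_period (Gamma_growth (bom mixed) F) al be l,
      (u <= ((ga - be)%:E)^-1)%E & (l <= ((al - de)%:E)^-1)%E].
Proof.
move=> d0 g1; have [T hT] := switch_times.
have E0 i : 0 <= E i by have := prof_AE prof i; rewrite -/mixed; lra.
have turn c : exists i, [/\ T c = i.+1, switches i = c & (c <= i)%N].
  have [h1 h2] := hT c; case TE : (T c) => [|i]; first by move: h1; rewrite TE.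
  exists i; split => //.
    apply/eqP; rewrite eqn_leq; have := switchesS_le i; rewrite -TE h1 ltnS => ->.
    by rewrite andbT leqNgt -h2 TE ltnn.
  by have := switches_bound (T c); rewrite h1 TE.
apply: (pseudo_periods prof (sg := fun i => slope (switches i))) => //.
- by move=> i; rewrite /slope; case: ifP; [right|left].
- by move=> e e0; apply: (slope_window eta0 etaE slopes e0).
- move=> e e0; have [N hN] := tol_small e0; have [M hM] := switches_unbounded N.
  exists M => i Mi ne; have tl := hN _ (leq_trans hM (switches_le Mi)).
  have te : tol (switches i) * E i.+1 <= e * E i.+1 by rewrite ler_wpM2r.
  move: ne; have := switchesS i; case: ifP => _.
    case: (boolP (_ <= _)) => h; last by rewrite addn0 => ->.
    by move=> _ _; right; rewrite -/mixed; lra.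
  case: (boolP (_ <= _)) => h; last by rewrite addn0 => ->.
  by move=> _ _; left; rewrite -/mixed; lra.
(* A switch out of an even state takes place within the margin of the line of slope al, and a large
   state makes the margin small. *)
- move=> e M e0; have [N hN] := tol_small e0.
  have [i [Ti ci Mi]] := turn (maxn M N).*2.
  have [h1 _] := hT (maxn M N).*2; rewrite Ti in h1.
  have big : (maxn M N <= (maxn M N).*2)%N by rewrite -addnn leq_addr.
  have tl := hN _ (leq_trans (leq_maxr M N) big).
  exists i.+1; first by rewrite leqW // (leq_trans (leq_maxl M N)) // (leq_trans big).
  have := switchesS i; rewrite h1 ci odd_double -/mixed; case: (boolP (_ <= _)) => h.
    move=> _; have : tol (maxn M N).*2 * E i.+1 <= e * E i.+1 by rewrite ler_wpM2r.
    lra.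
  by rewrite addn0 => /eqP; rewrite gtn_eqF.
- move=> e M e0; have [N hN] := tol_small e0.
  have [i [Ti ci Mi]] := turn (maxn M N).*2.+1.
  have [h1 _] := hT (maxn M N).*2.+1; rewrite Ti in h1.
  have big : (maxn M N <= (maxn M N).*2.+1)%N by rewrite leqW // -addnn leq_addr.
  have tl := hN _ (leq_trans (leq_maxr M N) big).
  exists i.+1; first by rewrite leqW // (leq_trans (leq_maxl M N)) // (leq_trans big).
  have := switchesS i; rewrite h1 ci /= odd_double -/mixed; case: (boolP (_ <= _)) => h.
    move=> _; have : tol (maxn M N).*2.+1 * E i.+1 <= e * E i.+1 by rewrite ler_wpM2r.
    lra.
  by rewrite addn0 => /eqP; rewrite gtn_eqF.
Qed.

(** Blocks start at the same levels for every p. *)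
Lemma bom_eq p q l : p (bidx l) = q (bidx l) -> bom p l = bom q l.
Proof. by move=> e; rewrite /bom /brot e. Qed.

Lemma mixed_interleave : exists m n : nat -> nat, (forall i, m i < n i < m i.+1)%N /\
  interleave (bom (turns eta de)) (bom (turns eta ga)) m n = bom mixed.
Proof.
have [T hT] := switch_times.
have Tlt c : (T c < T c.+1)%N.
  have [h _] := hT c; have [_ h'] := hT c.+1.
  by rewrite ltnNge h' h ltnn.
have T0 c : (0 < T c)%N.
  by case E : (T c) => //; have [] := hT c; rewrite E.
have B0 c : (0 < bstart (T c))%N by apply: leq_ltn_trans (bstart_mono (T0 c)).
(* Block T c is the first one after c.+1 switches, and slope ga belongs to the odd numbers of
   switches; each bound is the last level before such a block. *)
exists (fun i => (bstart (T i.*2)).-1), (fun i => (bstart (T i.*2.+1)).-1); split.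
  have pl a b : (0 < a)%N -> (a < b)%N -> (a.-1 < b.-1)%N by case: a b => [|a] [|b].
  by move=> i; apply/andP; split; apply: pl => //; apply: bstart_mono.
apply/funext => l; rewrite /interleave.
have loc c : (bstart (T c) <= l)%N = (c < switches (bidx l))%N.
  have [_ <-] := hT c; have /andP[l1 l2] := bidxP l.
  apply/idP/idP => [h|/bstart_le h]; last exact: leq_trans h l1.
  rewrite leqNgt; apply/negP => /bstart_le h'.
  by move: (leq_trans h' h); rewrite leqNgt l2.
have inside i : ((bstart (T i.*2)).-1 < l <= (bstart (T i.*2.+1)).-1)%N =
    (switches (bidx l) == i.*2.+1).
  rewrite prednK // loc; set y := bstart _.
  have -> : (l <= y.-1)%N = ~~ (y <= l)%N by have : (0 < y)%N := B0 _; case: (y) => [|z] _ //; rewrite -ltnNge.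
  rewrite loc -leqNgt.
  by rewrite eqn_leq andbC.
case: asboolP => [[i]|no]; first rewrite inside => /eqP sE.
  by apply: bom_eq; rewrite /mixed /slope sE /= odd_double.
apply: bom_eq; rewrite /mixed /slope; case: ifP => // od; case: no.
by exists (switches (bidx l))./2; rewrite inside -[X in X == _]odd_double_half od.
Qed.

End Hysteresis.

Import Order.TTheory GRing.Theory Num.Theory.
Local Open Scope ring_scope.

Theorem proposition8p6 (R : realType) (F : finGroupType)
    (eta alpha beta gamma delta : R) :
  root ('X^3 + 'X^2 + 'X - 2%:P) eta ->
  let alpha0 := ln 2 / (ln 2 - ln eta) in
  alpha0 <= delta -> delta <= alpha -> alpha < beta -> beta <= gamma ->
  gamma <= 1 ->
  exists om_delta om_gamma : nat -> 'I_3,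
    [/\ has_growth_exponent (Gamma_growth om_delta F) delta,
        has_growth_exponent (Gamma_growth om_gamma F) gamma &
        exists m n : nat -> nat,
          (forall i, m i < n i < m i.+1)%N /\
          let b := Gamma_growth (interleave om_delta om_gamma m n) F in
          exists u l : \bar R,
            [/\ is_upper_pseudo_period b alpha beta u,
                is_lower_pseudo_period b alpha beta l,
                (u <= ((gamma - beta)%:E)^-1)%E &
                (l <= ((alpha - delta)%:E)^-1)%E]].
Proof.
move=> /rootP; rewrite !hornerE => eta_root alpha0 dl da ab bg g1.
have etaE : (eta ^+ 3 + eta ^+ 2 + eta = 2)%R by move: eta_root; lra.
(* As eta^2 + eta + 1 is positive, eta has the sign of 2. *)
have eta0 : (0 < eta)%R by rewrite ltNge; apply/negP => le; nra.
have dr : slope_range eta delta by rewrite /slope_range dl /=; lra.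
have gr : slope_range eta gamma.
  by rewrite /slope_range g1 andbT (le_trans dl) //; lra.
exists (bom (turns eta delta)), (bom (turns eta gamma)); split.
- exact: constant_growth.
- exact: constant_growth.
have [m [n [mn mixE]]] := mixed_interleave F eta0 etaE dr gr da ab bg.
exists m, n; split => //=; rewrite mixE.
exact: (mixed_pseudo_periods F eta0 etaE dr gr da ab bg (slope_range_gt0 eta0 etaE dr) g1).
Qed.
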